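(* Let $\alpha,\beta\geq0$ and let $g\in H(\mathbb D)$ be such that $g'$ has no zeros in $\mathbb D$ and an analytic branch of $\log(g')$ belongs to $\mathcal B$. Then $T_g: H^{\infty}_\alpha\rightarrow H^{\infty}_\beta$ is compact if and only if $$\lim_{t_2\rightarrow1^-}\limsup_{t_1\rightarrow1^-}\sup_{0\leq\theta<2\pi}(1-t^2_1)^\beta\int_{t_2}^{t_1}\frac{|g'(re^{i\theta})|}{(1-r^2)^\alpha}\,dr=0\,.$$
   Context: $\mathbb D$ is the open unit disk and $H(\mathbb D)$ the space of analytic functions on $\mathbb D$. For $\alpha\geq0$, $H^{\infty}_\alpha=\{f\in H(\mathbb D): \|f\|_{H^\infty_\alpha}:=\sup_{z\in\mathbb D}(1-|z|^2)^\alpha|f(z)|<\infty\}$. The Bloch space is $\mathcal B=\{f\in H(\mathbb D): |f(0)|+\sup_{z\in\mathbb D}(1-|z|^2)|f'(z)|<\infty\}$. For $g\in H(\mathbb D)$, $(T_gf)(z)=\int_0^z f(\omega)g'(\omega)\,d\omega$. *)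

(* Defs.v *)
From Stdlib Require Import Reals Lra ClassicalEpsilon.
Open Scope R_scope.

Definition Cx := (R * R)%type.
Definition Cre (z : Cx) : R := fst z.
Definition Cim (z : Cx) : R := snd z.
Definition C0 : Cx := (0, 0).
Definition Cadd (z w : Cx) : Cx := (fst z + fst w, snd z + snd w).
Definition Csub (z w : Cx) : Cx := (fst z - fst w, snd z - snd w).
Definition Cmul (z w : Cx) : Cx :=
  (fst z * fst w - snd z * snd w, fst z * snd w + snd z * fst w).
Definition Cmod (z : Cx) : R := sqrt (fst z * fst z + snd z * snd z).
Definition Cexp (z : Cx) : Cx := (exp (fst z) * cos (snd z), exp (fst z) * sin (snd z)).
Definition polar (r theta : R) : Cx := (r * cos theta, r * sin theta).

Definition in_disk (z : Cx) : Prop := Cmod z < 1.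

Definition Cderiv (f : Cx -> Cx) (z l : Cx) : Prop :=
  forall eps : R, 0 < eps -> exists delta : R, 0 < delta /\
    forall h : Cx, Cmod h < delta ->
      Cmod (Csub (Csub (f (Cadd z h)) (f z)) (Cmul l h)) <= eps * Cmod h.

Definition analytic_on_disk (f : Cx -> Cx) : Prop :=
  forall z, in_disk z -> exists l, Cderiv f z l.

Definition is_deriv_on_disk (f df : Cx -> Cx) : Prop :=
  forall z, in_disk z -> Cderiv f z (df z).

(** weight (1 - |z|^2)^alpha, alpha a real number (base is > 0 on D) *)
Definition weight (alpha : R) (z : Cx) : R := Rpower (1 - Cmod z ^ 2) alpha.

Definition in_Hinf (alpha : R) (f : Cx -> Cx) : Prop :=
  analytic_on_disk f /\
  exists M : R, forall z, in_disk z -> weight alpha z * Cmod (f z) <= M.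

Definition in_Bloch (f : Cx -> Cx) : Prop :=
  exists df : Cx -> Cx, is_deriv_on_disk f df /\
  exists M : R, forall z, in_disk z -> (1 - Cmod z ^ 2) * Cmod (df z) <= M.

(** h = T_g f, where dg = g' :  h(z) = int_0^z f(w) g'(w) dw, i.e. h is the
    (unique, D being connected) analytic function on D with h(0) = 0 and
    h' = f g'. *)
Definition is_Tg (dg f h : Cx -> Cx) : Prop :=
  h C0 = C0 /\ forall z, in_disk z -> Cderiv h z (Cmul (f z) (dg z)).

Definition Tg_compact (dg : Cx -> Cx) (alpha beta : R) : Prop :=
  (forall f h, in_Hinf alpha f -> is_Tg dg f h -> in_Hinf beta h) /\
  forall (f h : nat -> Cx -> Cx),
    (forall n, in_Hinf alpha (f n)) ->
    (exists M : R, forall n z, in_disk z -> weight alpha z * Cmod (f n z) <= M) ->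
    (forall n, is_Tg dg (f n) (h n)) ->
    exists (phi : nat -> nat) (H : Cx -> Cx),
      (forall n, (phi n < phi (S n))%nat) /\ in_Hinf beta H /\
      forall eps : R, 0 < eps -> exists N : nat, forall n, (N <= n)%nat ->
        forall z, in_disk z -> weight beta z * Cmod (Csub (h (phi n) z) (H z)) <= eps.

(** Riemann integral int_a^b f (0 if f is not Riemann integrable; by
    RiemannInt_P5 the value does not depend on the integrability proof). *)
Definition RInt (f : R -> R) (a b : R) : R :=
  match excluded_middle_informative (exists pr : Riemann_integrable f a b, True) with
  | left H => RiemannInt (proj1_sig (constructive_indefinite_description _ H))
  | right _ => 0
  end.

Definition radial_quantity (dg : Cx -> Cx) (alpha beta t1 t2 theta : R) : R :=
  Rpower (1 - t1 ^ 2) beta *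
  RInt (fun r => Cmod (dg (polar r theta)) / Rpower (1 - r ^ 2) alpha) t2 t1.

(** lim_{t2->1^-} limsup_{t1->1^-} sup_{0<=theta<2pi} radial_quantity = 0,
    written out (the quantity is >= 0 for t2 <= t1, possibly +infinity):
    for every eps > 0 there is a < 1 such that for t2 in (a,1) there is b < 1
    such that for t1 in (b,1) the sup over theta is <= eps. *)
Definition radial_condition (dg : Cx -> Cx) (alpha beta : R) : Prop :=
  forall eps : R, 0 < eps ->
    exists a : R, a < 1 /\ forall t2 : R, a < t2 < 1 ->
      exists b : R, b < 1 /\ forall t1 : R, b < t1 < 1 ->
        forall theta : R, 0 <= theta < 2 * PI ->
          radial_quantity dg alpha beta t1 t2 theta <= eps.

(* Main.v *)
(** The easy direction integrates [h' = f g'] along radii: up to its values on a smaller disk,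
    a function [h = T_g f] is controlled in the [beta]-norm by the radial integrals, and on
    that disk the family [(h_n)] is equi-Lipschitz. So every sequence [(h_n)] has a Cauchy
    subsequence in the [beta]-norm, and the limit is analytic by Cauchy's estimate.

    For the converse we build, for each radius, a function [f] of bounded [alpha]-norm such that
    [Re (f g')] dominates a constant times [|g'| (1 - r^2)^(-alpha)] on that radius.  In the
    hyperbolic variable [s = - log (1 - r)] the Bloch condition on [log g'] says that
    [arg g'] is Lipschitz, so it is nearly constant at scale [1/n]; [f] is a finite sum of bumps,
    located at [s = k/n] and of width comparable to [1/n], each carrying the weight and the phase
    conjugate to that of [g'] at its centre. The bumps are large powers of the rational function
    [4 a u / (a + u)^2] with [u = 1 - z], so they stay bounded on the whole disk. Multiplying by
    [z^j] gives a sequence whose images tend to 0 pointwise, but not in norm if the radial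
    condition fails.

    Since analyticity is mere complex differentiability, primitives and Cauchy's estimate rest
    on Goursat's theorem for rectangles. *)

Require Import Defs.
From Stdlib Require Import Reals Lra Lia Psatz List Classical ClassicalEpsilon.
From Coquelicot Require Import Rcomplements Hierarchy Continuity Derive RInt RInt_analysis AutoDerive.
Open Scope R_scope.

(** * Complex arithmetic *)

(** The obstacle in the converse is that the obvious candidate, the weight times the conjugate phase
    of [dg], is not analytic. Along one radius an analytic function can nevertheless imitate it: the
    bumps centred near [s] have phase error at most 1 and contribute nonnegatively, and the decay of
    the kernel makes all the others add up to O(1/n). For [n] large in terms of [alpha] and the
    Bloch constant only, the nearest bump wins, so the constants depend neither on the radius nor on
    the number of bumps. Truncating at a radius [T] < 1 keeps the sum finite, so no convergence
    question arises.

    The factor z^j costs only a factor 1/2, because a failure of the radial condition supplies radii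
    [t2] arbitrarily close to 1, in particular beyond the point where r^j >= 1/2.

    Increments of complex functions are handled by real calculus: a modulus is bounded by bounding
    Re (c w) for every c, and an integral along a radius is replaced by an antiderivative, compared
    through the mean value theorem. *)

Definition Cone : Cx := (1, 0).
Definition Copp (z : Cx) : Cx := (- fst z, - snd z).
Definition RtoCx (x : R) : Cx := (x, 0).

Lemma Cx_ring_theory : ring_theory C0 Cone Cadd Cmul Csub Copp (@eq Cx).
Proof.
  split; intros; unfold C0, Cone, Cadd, Cmul, Csub, Copp;
    apply injective_projections; simpl; ring.
Qed.
Add Ring Cx_ring : Cx_ring_theory.

Lemma Cmod_nonneg (z : Cx) : 0 <= Cmod z.
Proof. apply sqrt_pos. Qed.

Lemma Cmod_sqr (z : Cx) : Cmod z * Cmod z = fst z * fst z + snd z * snd z.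
Proof. apply sqrt_sqrt; nra. Qed.

Lemma Cmod_le_intro (z : Cx) (m : R) :
  0 <= m -> fst z * fst z + snd z * snd z <= m * m -> Cmod z <= m.
Proof.
  intros Hm H. rewrite <- (sqrt_square m Hm). apply sqrt_le_1_alt. exact H.
Qed.

Lemma Cmod_eq_intro (z : Cx) (m : R) :
  0 <= m -> fst z * fst z + snd z * snd z = m * m -> Cmod z = m.
Proof. intros Hm H. unfold Cmod. rewrite H. apply sqrt_square, Hm. Qed.

Lemma Cmod_mul (z w : Cx) : Cmod (Cmul z w) = Cmod z * Cmod w.
Proof.
  apply Cmod_eq_intro.
  - apply Rmult_le_pos; apply Cmod_nonneg.
  - replace (Cmod z * Cmod w * (Cmod z * Cmod w))
      with ((Cmod z * Cmod z) * (Cmod w * Cmod w)) by ring.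
    rewrite !Cmod_sqr. simpl. ring.
Qed.

(** Cauchy-Schwarz, from Lagrange's identity: the two squares differ by (z1 w2 - z2 w1)^2. *)
Lemma Cre_mul_le (z w : Cx) :
  fst z * fst w + snd z * snd w <= Cmod z * Cmod w.
Proof.
  assert (Hz := Cmod_nonneg z). assert (Hw := Cmod_nonneg w).
  apply Rsqr_incr_0_var; [ | apply Rmult_le_pos; assumption].
  unfold Rsqr.
  replace (Cmod z * Cmod w * (Cmod z * Cmod w))
    with ((Cmod z * Cmod z) * (Cmod w * Cmod w)) by ring.
  rewrite !Cmod_sqr.
  assert (H := Rle_0_sqr (fst z * snd w - snd z * fst w)). unfold Rsqr in H. lra.
Qed.

Lemma Cmod_add (z w : Cx) : Cmod (Cadd z w) <= Cmod z + Cmod w.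
Proof.
  assert (Hz := Cmod_nonneg z). assert (Hw := Cmod_nonneg w).
  apply Cmod_le_intro; [lra | ].
  assert (H := Cre_mul_le z w). assert (Ez := Cmod_sqr z). assert (Ew := Cmod_sqr w).
  simpl. lra.
Qed.

Lemma Cmod_opp (z : Cx) : Cmod (Copp z) = Cmod z.
Proof. unfold Cmod, Copp; simpl. f_equal. ring. Qed.

Lemma Cmod_sub (z w : Cx) : Cmod (Csub z w) <= Cmod z + Cmod w.
Proof.
  replace (Csub z w) with (Cadd z (Copp w)) by ring.
  rewrite <- (Cmod_opp w). apply Cmod_add.
Qed.

Lemma Cmod_sub_sym (z w : Cx) : Cmod (Csub z w) = Cmod (Csub w z).
Proof. rewrite <- Cmod_opp. f_equal. ring. Qed.

Lemma Cmod_sub_triangle (z w v : Cx) :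
  Cmod (Csub z v) <= Cmod (Csub z w) + Cmod (Csub w v).
Proof. replace (Csub z v) with (Cadd (Csub z w) (Csub w v)) by ring. apply Cmod_add. Qed.

Lemma Cmod_le_sub (z w : Cx) : Cmod z <= Cmod w + Cmod (Csub z w).
Proof.
  replace z with (Cadd w (Csub z w)) at 1 by ring. apply Cmod_add.
Qed.

Lemma Cmod_C0 : Cmod C0 = 0.
Proof. apply Cmod_eq_intro; simpl; lra. Qed.

Lemma Cmod_C1 : Cmod Cone = 1.
Proof. apply Cmod_eq_intro; simpl; lra. Qed.

Lemma Cmod_eq0 (z : Cx) : Cmod z = 0 -> z = C0.
Proof.
  intros H. assert (E := Cmod_sqr z). rewrite H in E.
  apply injective_projections; simpl; nra.
Qed.

Lemma Cmod_pos (z : Cx) : z <> C0 -> 0 < Cmod z.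
Proof.
  intros H. destruct (Cmod_nonneg z) as [|E]; [assumption|].
  exfalso; apply H, Cmod_eq0; auto.
Qed.

Lemma Cmod_real (x : R) : Cmod (RtoCx x) = Rabs x.
Proof.
  apply Cmod_eq_intro; [apply Rabs_pos|]. unfold RtoCx; simpl.
  rewrite <- Rabs_mult, Rabs_pos_eq; nra.
Qed.

Lemma Rabs_fst_le (z : Cx) : Rabs (fst z) <= Cmod z.
Proof.
  rewrite <- (Rabs_pos_eq _ (Cmod_nonneg z)). apply Rsqr_le_abs_0.
  unfold Rsqr. rewrite Cmod_sqr. nra.
Qed.

Lemma Rabs_snd_le (z : Cx) : Rabs (snd z) <= Cmod z.
Proof.
  rewrite <- (Rabs_pos_eq _ (Cmod_nonneg z)). apply Rsqr_le_abs_0.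
  unfold Rsqr. rewrite Cmod_sqr. nra.
Qed.

Lemma Cmod_le_abs (z : Cx) : Cmod z <= Rabs (fst z) + Rabs (snd z).
Proof.
  apply Cmod_le_intro.
  - assert (H1 := Rabs_pos (fst z)). assert (H2 := Rabs_pos (snd z)). lra.
  - assert (H1 := Rabs_pos (fst z)). assert (H2 := Rabs_pos (snd z)).
    assert (E1 : Rabs (fst z) * Rabs (fst z) = fst z * fst z)
      by (rewrite <- Rabs_mult, Rabs_pos_eq; nra).
    assert (E2 : Rabs (snd z) * Rabs (snd z) = snd z * snd z)
      by (rewrite <- Rabs_mult, Rabs_pos_eq; nra).
    nra.
Qed.

Lemma Cmod_unit (theta : R) : Cmod (cos theta, sin theta) = 1.
Proof.
  apply Cmod_eq_intro; [lra|]. simpl. assert (H := sin2_cos2 theta). unfold Rsqr in H. lra.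
Qed.

Lemma Cmod_unit_conj (theta : R) : Cmod (cos theta, - sin theta) = 1.
Proof. rewrite <- (Cmod_unit theta). unfold Cmod; simpl. f_equal; ring. Qed.

Lemma polar_eq (r theta : R) : polar r theta = Cmul (RtoCx r) (cos theta, sin theta).
Proof. apply injective_projections; simpl; ring. Qed.

Lemma Cmod_polar (r theta : R) : Cmod (polar r theta) = Rabs r.
Proof. rewrite polar_eq, Cmod_mul, Cmod_unit, Cmod_real. ring. Qed.

Lemma polar_surj (z : Cx) : exists theta, 0 <= theta < 2 * PI /\ z = polar (Cmod z) theta.
Proof.
  assert (HPI := PI_RGT_0).
  destruct (Req_dec (Cmod z) 0) as [E|E].
  - exists 0. split; [lra|]. rewrite (Cmod_eq0 z E), Cmod_C0.
    apply injective_projections; simpl; ring.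
  - assert (Hm := Cmod_nonneg z). assert (Hp : 0 < Cmod z) by lra.
    assert (Hx := Rabs_fst_le z). assert (Es := Cmod_sqr z).
    set (m := Cmod z) in *.
    assert (Hc : -1 <= fst z / m <= 1).
    { apply Rabs_le_between. unfold Rdiv. rewrite Rabs_mult, (Rabs_pos_eq (/ m)).
      - apply (Rmult_le_reg_r m); [assumption|]. rewrite Rmult_assoc, Rinv_l; lra.
      - apply Rlt_le, Rinv_0_lt_compat, Hp. }
    assert (Hb := acos_bound (fst z / m)).
    assert (Hcos := cos_acos _ Hc).
    assert (Hsin := sin_acos _ Hc).
    assert (Hsq : sqrt (1 - (fst z / m)²) = Rabs (snd z) / m).
    { apply sqrt_lem_1.
      - unfold Rsqr; nra.
      - apply Rmult_le_pos; [apply Rabs_pos|]. apply Rlt_le, Rinv_0_lt_compat, Hp.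
      - unfold Rsqr.
        assert (E2 : Rabs (snd z) * Rabs (snd z) = m * m - fst z * fst z)
          by (rewrite <- Rabs_mult, Rabs_pos_eq; nra).
        replace (Rabs (snd z) / m * (Rabs (snd z) / m))
          with (Rabs (snd z) * Rabs (snd z) / (m * m)) by (field; lra).
        rewrite E2. field. lra. }
    rewrite Hsq in Hsin.
    destruct (Rle_dec 0 (snd z)) as [H|H].
    + exists (acos (fst z / m)). split; [lra|].
      rewrite Rabs_pos_eq in Hsin by assumption.
      apply injective_projections; simpl; rewrite ?Hcos, ?Hsin; field; lra.
    + exists (2 * PI - acos (fst z / m)).
      rewrite Rabs_left in Hsin by lra.
      (* An arccosine equal to 0 would give the angle 2 pi, which the range excludes; it would force
         the imaginary part to vanish. *)
      assert (0 < acos (fst z / m)).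
      { destruct (Req_dec (acos (fst z / m)) 0) as [E0|]; [|lra].
        rewrite E0, sin_0 in Hsin. exfalso.
        assert (0 < - snd z / m) by (apply Rdiv_lt_0_compat; lra). lra. }
      split; [lra|].
      assert (Hc2 : cos (2 * PI - acos (fst z / m)) = fst z / m).
      { rewrite cos_minus, cos_2PI, sin_2PI, Hcos. ring. }
      assert (Hs2 : sin (2 * PI - acos (fst z / m)) = snd z / m).
      { rewrite sin_minus, cos_2PI, sin_2PI, Hsin. field; lra. }
      apply injective_projections; simpl; rewrite ?Hc2, ?Hs2; field; lra.
Qed.

(** * Complex derivatives *)

Definition Cdiff (f : Cx -> Cx) (z : Cx) : Prop := exists l, Cderiv f z l.

Lemma Cderiv_bound (f : Cx -> Cx) (z l : Cx) :
  Cderiv f z l -> exists d, 0 < d /\ forall h, Cmod h < d ->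
    Cmod (Csub (f (Cadd z h)) (f z)) <= (Cmod l + 1) * Cmod h.
Proof.
  intros H. destruct (H 1 Rlt_0_1) as [d [Hd Hh]]. exists d; split; [assumption|].
  intros h Hlt. specialize (Hh h Hlt).
  replace (Csub (f (Cadd z h)) (f z)) with
    (Cadd (Csub (Csub (f (Cadd z h)) (f z)) (Cmul l h)) (Cmul l h)) by ring.
  eapply Rle_trans; [apply Cmod_add|]. rewrite Cmod_mul. lra.
Qed.

Lemma Cdiff_cont (f : Cx -> Cx) (z : Cx) (eps : R) :
  Cdiff f z -> 0 < eps -> exists d, 0 < d /\ forall h, Cmod h < d ->
    Cmod (Csub (f (Cadd z h)) (f z)) <= eps.
Proof.
  intros [l H] He. destruct (Cderiv_bound f z l H) as [d [Hd Hh]].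
  assert (Hl := Cmod_nonneg l).
  exists (Rmin d (eps / (Cmod l + 1))). split.
  - apply Rmin_glb_lt; [assumption|]. apply Rdiv_lt_0_compat; lra.
  - intros h Hlt. eapply Rle_trans; [apply Hh|].
    + eapply Rlt_le_trans; [exact Hlt|apply Rmin_l].
    + assert (Cmod h < eps / (Cmod l + 1))
        by (eapply Rlt_le_trans; [exact Hlt|apply Rmin_r]).
      apply Rle_trans with ((Cmod l + 1) * (eps / (Cmod l + 1))).
      * apply Rmult_le_compat_l; lra.
      * right. field. lra.
Qed.

Lemma Cderiv_ext_loc (f g : Cx -> Cx) (z l : Cx) (d : R) :
  0 < d -> (forall h, Cmod h < d -> f (Cadd z h) = g (Cadd z h)) ->
  Cderiv f z l -> Cderiv g z l.
Proof.
  intros Hd E H eps He. destruct (H eps He) as [d' [Hd' Hh]].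
  exists (Rmin d d'). split; [apply Rmin_glb_lt; assumption|].
  intros h Hlt. rewrite <- E by (eapply Rlt_le_trans; [exact Hlt|apply Rmin_l]).
  replace (g z) with (f z).
  - apply Hh. eapply Rlt_le_trans; [exact Hlt|apply Rmin_r].
  - replace z with (Cadd z C0) by ring. apply E. rewrite Cmod_C0; assumption.
Qed.

Lemma in_disk_ball (z : Cx) : in_disk z ->
  exists d, 0 < d /\ forall h, Cmod h < d -> in_disk (Cadd z h).
Proof.
  unfold in_disk. intros H. exists (1 - Cmod z). split; [lra|].
  intros h Hh. assert (T := Cmod_add z h). lra.
Qed.

Lemma Cderiv_ext_disk (f g : Cx -> Cx) (z l : Cx) :
  in_disk z -> (forall w, in_disk w -> f w = g w) -> Cderiv f z l -> Cderiv g z l.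
Proof.
  intros Hz E. destruct (in_disk_ball z Hz) as [d [Hd Hb]].
  apply Cderiv_ext_loc with d; auto.
Qed.

Lemma Cderiv_const (c z : Cx) : Cderiv (fun _ => c) z C0.
Proof.
  intros eps He. exists 1. split; [lra|]. intros h _.
  replace (Csub (Csub c c) (Cmul C0 h)) with C0 by ring.
  rewrite Cmod_C0. assert (H := Cmod_nonneg h). nra.
Qed.

Lemma Cderiv_id (z : Cx) : Cderiv (fun w => w) z Cone.
Proof.
  intros eps He. exists 1. split; [lra|]. intros h _.
  replace (Csub (Csub (Cadd z h) z) (Cmul Cone h)) with C0 by ring.
  rewrite Cmod_C0. assert (H := Cmod_nonneg h). nra.
Qed.

Lemma Cderiv_add (f g : Cx -> Cx) (z l m : Cx) :
  Cderiv f z l -> Cderiv g z m -> Cderiv (fun w => Cadd (f w) (g w)) z (Cadd l m).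
Proof.
  intros Hf Hg eps He.
  destruct (Hf (eps / 2)) as [d1 [Hd1 H1]]; [lra|].
  destruct (Hg (eps / 2)) as [d2 [Hd2 H2]]; [lra|].
  exists (Rmin d1 d2). split; [apply Rmin_glb_lt; assumption|].
  intros h Hh.
  specialize (H1 h (Rlt_le_trans _ _ _ Hh (Rmin_l _ _))).
  specialize (H2 h (Rlt_le_trans _ _ _ Hh (Rmin_r _ _))).
  match goal with |- Cmod ?a <= _ =>
    replace a with (Cadd (Csub (Csub (f (Cadd z h)) (f z)) (Cmul l h))
      (Csub (Csub (g (Cadd z h)) (g z)) (Cmul m h))) by ring end.
  eapply Rle_trans; [apply Cmod_add|]. lra.
Qed.

Lemma Cderiv_mul (f g : Cx -> Cx) (z l m : Cx) :
  Cderiv f z l -> Cderiv g z m ->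
  Cderiv (fun w => Cmul (f w) (g w)) z (Cadd (Cmul l (g z)) (Cmul (f z) m)).
Proof.
  intros Hf Hg eps He.
  (* The three error terms below have coefficients |g z| + 1, |l| and |f z|; [A] is their sum. *)
  set (A := Cmod (g z) + 1 + Cmod l + Cmod (f z)).
  assert (Ag := Cmod_nonneg (g z)). assert (Al := Cmod_nonneg l).
  assert (Af := Cmod_nonneg (f z)).
  assert (HA : 0 < A) by (unfold A; lra).
  assert (He' : 0 < eps / A) by (apply Rdiv_lt_0_compat; lra).
  destruct (Hf _ He') as [d1 [Hd1 H1]].
  destruct (Hg _ He') as [d2 [Hd2 H2]].
  destruct (Cdiff_cont g z (Rmin 1 (eps / A)) (ex_intro _ m Hg)) as [d3 [Hd3 H3]].
  { apply Rmin_glb_lt; lra. }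
  exists (Rmin d1 (Rmin d2 d3)). split; [repeat apply Rmin_glb_lt; assumption|].
  intros h Hh.
  assert (Hh2 := Rlt_le_trans _ _ _ Hh (Rmin_r _ _)).
  specialize (H1 h (Rlt_le_trans _ _ _ Hh (Rmin_l _ _))).
  specialize (H2 h (Rlt_le_trans _ _ _ Hh2 (Rmin_l _ _))).
  specialize (H3 h (Rlt_le_trans _ _ _ Hh2 (Rmin_r _ _))).
  match goal with |- Cmod ?a <= _ =>
    replace a with (Cadd (Cadd
      (Cmul (Csub (Csub (f (Cadd z h)) (f z)) (Cmul l h)) (g (Cadd z h)))
      (Cmul (Cmul l h) (Csub (g (Cadd z h)) (g z))))
      (Cmul (f z) (Csub (Csub (g (Cadd z h)) (g z)) (Cmul m h)))) by ring end.
  eapply Rle_trans; [apply Cmod_add|].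
  eapply Rle_trans; [apply Rplus_le_compat_r, Cmod_add|].
  rewrite !Cmod_mul.
  assert (Hg' : Cmod (g (Cadd z h)) <= Cmod (g z) + 1).
  { eapply Rle_trans; [apply (Cmod_le_sub _ (g z))|].
    assert (K := Rmin_l 1 (eps / A)). lra. }
  assert (H3' := Rle_trans _ _ _ H3 (Rmin_r _ _)).
  assert (Hh0 := Cmod_nonneg h).
  apply Rle_trans with (eps / A * Cmod h * (Cmod (g z) + 1) + Cmod l * Cmod h * (eps / A)
    + Cmod (f z) * (eps / A * Cmod h)).
  - apply Rplus_le_compat; [apply Rplus_le_compat|].
    + apply Rmult_le_compat; try apply Cmod_nonneg; assumption.
    + apply Rmult_le_compat_l; [apply Rmult_le_pos; assumption | assumption].
    + apply Rmult_le_compat_l; assumption.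
  - right. unfold A. field. fold A. lra.
Qed.

Lemma Cderiv_comp (f g : Cx -> Cx) (z l m : Cx) :
  Cderiv g z m -> Cderiv f (g z) l -> Cderiv (fun w => f (g w)) z (Cmul l m).
Proof.
  intros Hg Hf eps He.
  assert (Am := Cmod_nonneg m). assert (Al := Cmod_nonneg l).
  set (A := Cmod m + 1 + Cmod l).
  assert (HA : 0 < A) by (unfold A; lra).
  assert (He' : 0 < eps / A) by (apply Rdiv_lt_0_compat; lra).
  destruct (Hf _ He') as [d1 [Hd1 H1]].
  destruct (Hg _ He') as [d2 [Hd2 H2]].
  destruct (Cderiv_bound g z m Hg) as [d3 [Hd3 H3]].
  destruct (Cdiff_cont g z (d1 / 2) (ex_intro _ m Hg)) as [d4 [Hd4 H4]]; [lra|].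
  exists (Rmin d2 (Rmin d3 d4)). split; [repeat apply Rmin_glb_lt; assumption|].
  intros h Hh.
  assert (Hh2 := Rlt_le_trans _ _ _ Hh (Rmin_r _ _)).
  specialize (H2 h (Rlt_le_trans _ _ _ Hh (Rmin_l _ _))).
  specialize (H3 h (Rlt_le_trans _ _ _ Hh2 (Rmin_l _ _))).
  specialize (H4 h (Rlt_le_trans _ _ _ Hh2 (Rmin_r _ _))).
  set (k := Csub (g (Cadd z h)) (g z)) in *.
  assert (Ek : g (Cadd z h) = Cadd (g z) k) by (unfold k; ring).
  assert (Hk : Cmod k < d1) by lra.
  specialize (H1 k Hk). rewrite Ek.
  match goal with |- Cmod ?a <= _ =>
    replace a with (Cadd (Csub (Csub (f (Cadd (g z) k)) (f (g z))) (Cmul l k))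
      (Cmul l (Csub k (Cmul m h)))) by ring end.
  eapply Rle_trans; [apply Cmod_add|]. rewrite Cmod_mul.
  apply Rle_trans with (eps / A * ((Cmod m + 1) * Cmod h) + Cmod l * (eps / A * Cmod h)).
  - apply Rplus_le_compat.
    + eapply Rle_trans; [exact H1|]. apply Rmult_le_compat_l; lra.
    + apply Rmult_le_compat_l; assumption.
  - right. unfold A. field. fold A; lra.
Qed.

(** * Inversion and the exponential function *)

Definition Cinv (z : Cx) : Cx :=
  (fst z / (fst z * fst z + snd z * snd z), - snd z / (fst z * fst z + snd z * snd z)).

Lemma Cinv_r (z : Cx) : z <> C0 -> Cmul z (Cinv z) = Cone.
Proof.
  intros H. assert (Hm := Cmod_pos z H). assert (E := Cmod_sqr z).
  assert (fst z * fst z + snd z * snd z <> 0) by nra.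
  apply injective_projections; unfold Cinv; simpl; field; assumption.
Qed.

Lemma Cmod_inv (z : Cx) : z <> C0 -> Cmod (Cinv z) = / Cmod z.
Proof.
  intros H. assert (Hm := Cmod_pos z H).
  apply (Rmult_eq_reg_l (Cmod z)); [|lra].
  rewrite <- Cmod_mul, Cinv_r, Cmod_C1, Rinv_r; auto; lra.
Qed.

Lemma Cderiv_inv (z : Cx) : z <> C0 -> Cderiv Cinv z (Copp (Cmul (Cinv z) (Cinv z))).
Proof.
  intros H eps He. assert (Hm := Cmod_pos z H). set (m := Cmod z) in *.
  (* The first bound keeps |z + h| >= m/2. The remainder is exactly h^2 / (z^2 (z + h)), of modulus
     at most 2 |h|^2 / m^3, whence the second bound. *)
  exists (Rmin (m / 2) (eps * (m * m * m) / 2)).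
  assert (Hm3 : 0 < m * m * m) by (repeat apply Rmult_lt_0_compat; assumption).
  split; [apply Rmin_glb_lt; [lra|]|].
  - apply Rdiv_lt_0_compat; [|lra]. apply Rmult_lt_0_compat; assumption.
  - intros h Hh.
    assert (H1 := Rlt_le_trans _ _ _ Hh (Rmin_l _ _)).
    assert (H2 := Rlt_le_trans _ _ _ Hh (Rmin_r _ _)).
    assert (Hzh : m / 2 <= Cmod (Cadd z h)).
    { assert (T := Cmod_le_sub z (Cadd z h)).
      replace (Csub z (Cadd z h)) with (Copp h) in T by ring.
      rewrite Cmod_opp in T. fold m in T. lra. }
    assert (Hn : Cadd z h <> C0).
    { intros E. rewrite E, Cmod_C0 in Hzh. lra. }
    assert (E1 := Cinv_r z H). assert (E2 := Cinv_r _ Hn).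
    set (a := Cinv z) in *. set (b := Cinv (Cadd z h)) in *.
    assert (Ea : Cmod a = / m) by (apply Cmod_inv; assumption).
    assert (Eb : Cmod b <= 2 / m).
    { unfold b. rewrite Cmod_inv by assumption.
      replace (2 / m) with (/ (m / 2)) by (field; lra).
      apply Rinv_le_contravar; lra. }
    assert (EE : Csub (Csub b a) (Cmul (Copp (Cmul a a)) h) =
                 Cmul (Cmul a a) (Cmul b (Cmul h h))).
    { (* both sides are compared after inserting z a = (z + h) b = 1 *)
      assert (Eh : Cmul b h = Csub Cone (Cmul b z)).
      { rewrite <- E2. ring. }
      assert (Eh2 : Cmul a (Cmul b h) = Csub a b).
      { rewrite Eh. transitivity (Csub a (Cmul b (Cmul z a))); [ring|]. rewrite E1. ring. }
      transitivity (Cmul (Cmul a h) (Cmul a (Cmul b h))); [|ring].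
      rewrite Eh2.
      transitivity (Cadd (Csub b a) (Cmul a (Cmul a h))); [ring|].
      transitivity (Csub (Cmul (Cmul a h) a) (Cmul a (Cmul b h))); [|ring].
      rewrite Eh2. ring. }
    rewrite EE, !Cmod_mul, Ea.
    assert (Hh0 := Cmod_nonneg h).
    apply Rle_trans with (/ m * / m * (2 / m * (Cmod h * (eps * (m * m * m) / 2)))).
    + apply Rmult_le_compat_l.
      * apply Rlt_le, Rmult_lt_0_compat; apply Rinv_0_lt_compat; assumption.
      * apply Rmult_le_compat; try apply Cmod_nonneg; [|assumption|].
        -- apply Rmult_le_pos; assumption.
        -- apply Rmult_le_compat_l; lra.
    + right. field. lra.
Qed.

Lemma Cexp_add (z w : Cx) : Cexp (Cadd z w) = Cmul (Cexp z) (Cexp w).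
Proof.
  unfold Cexp, Cadd, Cmul; simpl. rewrite exp_plus, cos_plus, sin_plus.
  f_equal; ring.
Qed.

Lemma Cmod_exp (z : Cx) : Cmod (Cexp z) = exp (fst z).
Proof.
  apply Cmod_eq_intro; [apply Rlt_le, exp_pos|]. unfold Cexp; simpl.
  assert (H := sin2_cos2 (snd z)). unfold Rsqr in H.
  transitivity (exp (fst z) * exp (fst z) *
    (sin (snd z) * sin (snd z) + cos (snd z) * cos (snd z))); [ring|].
  rewrite H. ring.
Qed.

(** Clearing the denominator admits h = 0 and matches the shape of [Cderiv]. *)
Lemma derivable_pt_lim_small (f : R -> R) (x l eps : R) :
  derivable_pt_lim f x l -> 0 < eps ->
  exists d, 0 < d /\ forall h, Rabs h < d -> Rabs (f (x + h) - f x - l * h) <= eps * Rabs h.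
Proof.
  intros H He. destruct (H eps He) as [[d Hd] Hh]; simpl in Hh.
  exists d. split; [assumption|]. intros h Hlt.
  destruct (Req_dec h 0) as [->|Hn].
  - rewrite Rplus_0_r, Rmult_0_r, Rabs_R0. replace (f x - f x - 0) with 0 by ring.
    rewrite Rabs_R0. lra.
  - specialize (Hh h Hn Hlt).
    replace (f (x + h) - f x - l * h) with (((f (x + h) - f x) / h - l) * h)
      by (field; assumption).
    rewrite Rabs_mult. apply Rmult_le_compat_r; [apply Rabs_pos|lra].
Qed.

Lemma derivable_pt_lim_of_small (f : R -> R) (x l : R) :
  (forall eps, 0 < eps -> exists d, 0 < d /\ forall h, Rabs h < d ->
    Rabs (f (x + h) - f x - l * h) <= eps * Rabs h) -> derivable_pt_lim f x l.
Proof.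
  intros H eps He. destruct (H (eps / 2)) as [d [Hd Hh]]; [lra|].
  exists (mkposreal d Hd). intros h Hn Hlt. simpl in Hlt. specialize (Hh h Hlt).
  assert (Hp := Rabs_pos_lt h Hn).
  apply (Rmult_lt_reg_r (Rabs h)); [assumption|].
  rewrite <- Rabs_mult.
  replace (((f (x + h) - f x) / h - l) * h) with (f (x + h) - f x - l * h) by (field; assumption).
  nra.
Qed.

(** The functional equation [Cexp_add] moves the question to the origin, where first-order
    expansions of the real exp, sin and cos suffice. *)
Lemma Cderiv_exp (z : Cx) : Cderiv Cexp z (Cexp z).
Proof.
  assert (H0 : forall eps, 0 < eps -> exists d, 0 < d /\ forall h, Cmod h < d ->
    Cmod (Csub (Csub (Cexp h) Cone) h) <= eps * Cmod h).
  (* The four errors collected at the end are e n, 2 e n, 4 e n and e n, with n = |h|: a total of 8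
     e n. *)
  { intros eps He. set (e := Rmin 1 (eps / 8)).
    assert (Hen : 0 < e) by (apply Rmin_glb_lt; lra).
    assert (He1 : e <= 1) by apply Rmin_l. assert (He8 : e <= eps / 8) by apply Rmin_r.
    clearbody e.
    destruct (derivable_pt_lim_small exp 0 1 e) as [d1 [Hd1 H1]]; [apply derivable_pt_lim_exp_0|assumption|].
    destruct (derivable_pt_lim_small sin 0 1 e) as [d2 [Hd2 H2]]; [|assumption|].
    { rewrite <- cos_0. apply derivable_pt_lim_sin. }
    destruct (derivable_pt_lim_small cos 0 0 e) as [d3 [Hd3 H3]]; [|assumption|].
    { replace 0 with (- sin 0) at 2 by (rewrite sin_0; ring). apply derivable_pt_lim_cos. }
    exists (Rmin (Rmin d1 e) (Rmin d2 d3)).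
    split; [repeat apply Rmin_glb_lt; assumption|].
    intros h Hh.
    assert (Ha := Rlt_le_trans _ _ _ Hh (Rmin_l _ _)).
    assert (Hb := Rlt_le_trans _ _ _ Hh (Rmin_r _ _)).
    assert (Hx := Rabs_fst_le h). assert (Hy := Rabs_snd_le h).
    assert (Ha1 := Rlt_le_trans _ _ _ Ha (Rmin_l _ _)).
    assert (Ha2 := Rlt_le_trans _ _ _ Ha (Rmin_r _ _)).
    assert (Hb1 := Rlt_le_trans _ _ _ Hb (Rmin_l _ _)).
    assert (Hb2 := Rlt_le_trans _ _ _ Hb (Rmin_r _ _)).
    specialize (H1 (fst h) ltac:(lra)). specialize (H2 (snd h) ltac:(lra)).
    specialize (H3 (snd h) ltac:(lra)).
    rewrite Rplus_0_l, exp_0 in H1. rewrite Rplus_0_l, sin_0 in H2.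
    rewrite Rplus_0_l, cos_0 in H3.
    set (x := fst h) in *. set (y := snd h) in *. set (n := Cmod h) in *.
    assert (Hn : 0 <= n) by apply Cmod_nonneg.
    assert (Hx0 := Rabs_pos x). assert (Hy0 := Rabs_pos y).
    assert (H1' : Rabs (exp x - 1 - 1 * x) <= e * n) by nra.
    assert (H2' : Rabs (sin y - 0 - 1 * y) <= e * n) by nra.
    assert (H3' : Rabs (cos y - 1 - 0 * y) <= e * n) by nra.
    assert (Hc : Rabs (cos y) <= 1) by (apply Rabs_le; apply COS_bound).
    assert (Hs : Rabs (sin y) <= 1) by (apply Rabs_le; apply SIN_bound).
    assert (Hs' : Rabs (sin y) <= 2 * e).
    { replace (sin y) with ((sin y - 0 - 1 * y) + y) by ring.
      eapply Rle_trans; [apply Rabs_triang|]. nra. }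
    assert (Hex : Rabs (exp x - 1) <= 2 * n).
    { replace (exp x - 1) with ((exp x - 1 - 1 * x) + x) by ring.
      eapply Rle_trans; [apply Rabs_triang|]. nra. }
    eapply Rle_trans; [apply Cmod_le_abs|].
    unfold Cexp; simpl fst; simpl snd. fold x y.
    replace (exp x * cos y - 1 - x) with
      ((exp x - 1 - 1 * x) * cos y + (cos y - 1 - 0 * y) * (1 + x)) by ring.
    replace (exp x * sin y - 0 - y) with
      ((exp x - 1) * sin y + (sin y - 0 - 1 * y)) by ring.
    assert (Hx1 : Rabs (1 + x) <= 2).
    { eapply Rle_trans; [apply Rabs_triang|]. rewrite Rabs_R1. lra. }
    assert (P1 : Rabs ((exp x - 1 - 1 * x) * cos y) <= e * n * 1).
    { rewrite Rabs_mult. apply Rmult_le_compat; auto using Rabs_pos. }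
    assert (P2 : Rabs ((cos y - 1 - 0 * y) * (1 + x)) <= e * n * 2).
    { rewrite Rabs_mult. apply Rmult_le_compat; auto using Rabs_pos. }
    assert (P3 : Rabs ((exp x - 1) * sin y) <= 2 * n * (2 * e)).
    { rewrite Rabs_mult. apply Rmult_le_compat; auto using Rabs_pos. }
    eapply Rle_trans; [apply Rplus_le_compat; apply Rabs_triang|].
    assert (e * n <= eps / 8 * n) by (apply Rmult_le_compat_r; assumption).
    lra. }
  intros eps He. assert (Hz : 0 < Cmod (Cexp z)) by (rewrite Cmod_exp; apply exp_pos).
  destruct (H0 (eps / Cmod (Cexp z))) as [d [Hd Hh]]; [apply Rdiv_lt_0_compat; assumption|].
  exists d; split; [assumption|]. intros h Hlt. specialize (Hh h Hlt).
  rewrite Cexp_add.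
  replace (Csub (Csub (Cmul (Cexp z) (Cexp h)) (Cexp z)) (Cmul (Cexp z) h)) with
    (Cmul (Cexp z) (Csub (Csub (Cexp h) Cone) h)) by ring.
  rewrite Cmod_mul.
  apply Rle_trans with (Cmod (Cexp z) * (eps / Cmod (Cexp z) * Cmod h)).
  - apply Rmult_le_compat_l; lra.
  - right. field. lra.
Qed.

Lemma Cdiff_const (c z : Cx) : Cdiff (fun _ => c) z.
Proof. eexists; apply Cderiv_const. Qed.

Lemma Cdiff_id (z : Cx) : Cdiff (fun w => w) z.
Proof. eexists; apply Cderiv_id. Qed.

Lemma Cdiff_add (f g : Cx -> Cx) (z : Cx) :
  Cdiff f z -> Cdiff g z -> Cdiff (fun w => Cadd (f w) (g w)) z.
Proof. intros [l Hl] [m Hm]. eexists; apply Cderiv_add; eassumption. Qed.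

Lemma Cdiff_mul (f g : Cx -> Cx) (z : Cx) :
  Cdiff f z -> Cdiff g z -> Cdiff (fun w => Cmul (f w) (g w)) z.
Proof. intros [l Hl] [m Hm]. eexists; apply Cderiv_mul; eassumption. Qed.

Lemma Cderiv_sub (f g : Cx -> Cx) (z l m : Cx) :
  Cderiv f z l -> Cderiv g z m -> Cderiv (fun w => Csub (f w) (g w)) z (Csub l m).
Proof.
  intros Hf Hg.
  replace (Csub l m) with
    (Cadd l (Cadd (Cmul C0 (g z)) (Cmul (Copp Cone) m))) by ring.
  apply Cderiv_ext_loc with (f := fun w => Cadd (f w) (Cmul (Copp Cone) (g w))) (d := 1); [lra| |].
  - intros; ring.
  - apply Cderiv_add; [assumption|]. apply (Cderiv_mul (fun _ => Copp Cone) g); [apply Cderiv_const|assumption].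
Qed.

Lemma Cdiff_comp (f g : Cx -> Cx) (z : Cx) :
  Cdiff g z -> Cdiff f (g z) -> Cdiff (fun w => f (g w)) z.
Proof. intros [l Hl] [m Hm]. eexists; apply (Cderiv_comp f g); eassumption. Qed.

(** Testing a complex function against the functional Re (c .) along a line opens the way to the
    real mean value theorem. *)
Lemma derivable_along (f : Cx -> Cx) (c z d l : Cx) (t : R) :
  Cderiv f (Cadd z (Cmul (RtoCx t) d)) l ->
  derivable_pt_lim (fun s => Cre (Cmul c (f (Cadd z (Cmul (RtoCx s) d))))) t
    (Cre (Cmul c (Cmul l d))).
Proof.
  intros H. apply derivable_pt_lim_of_small. intros eps He.
  assert (Hc := Cmod_nonneg c). assert (Hd0 := Cmod_nonneg d).
  set (A := Cmod c * Cmod d + 1).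
  assert (HA : 0 < A) by (unfold A; nra).
  destruct (H (eps / A)) as [d' [Hd' Hh]]; [apply Rdiv_lt_0_compat; assumption|].
  exists (d' / (Cmod d + 1)). split; [apply Rdiv_lt_0_compat; lra|].
  intros h Hlt.
  assert (Hm : Cmod (Cmul (RtoCx h) d) < d').
  { rewrite Cmod_mul, Cmod_real.
    apply Rle_lt_trans with (Rabs h * (Cmod d + 1)).
    - apply Rmult_le_compat_l; [apply Rabs_pos|lra].
    - apply (Rmult_lt_compat_r (Cmod d + 1)) in Hlt; [|lra].
      replace (d' / (Cmod d + 1) * (Cmod d + 1)) with d' in Hlt by (field; lra). assumption. }
  specialize (Hh _ Hm).
  replace (Cadd (Cadd z (Cmul (RtoCx t) d)) (Cmul (RtoCx h) d)) with
    (Cadd z (Cmul (RtoCx (t + h)) d)) in Hh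
    by (apply injective_projections; simpl; ring).
  set (p := f (Cadd z (Cmul (RtoCx (t + h)) d))) in *.
  set (q := f (Cadd z (Cmul (RtoCx t) d))) in *.
  replace (Cre (Cmul c p) - Cre (Cmul c q) - Cre (Cmul c (Cmul l d)) * h) with
    (Cre (Cmul c (Csub (Csub p q) (Cmul l (Cmul (RtoCx h) d)))))
    by (unfold Cre; simpl; ring).
  eapply Rle_trans; [apply Rabs_fst_le|]. rewrite Cmod_mul.
  rewrite Cmod_mul, Cmod_real in Hh.
  apply Rle_trans with (Cmod c * (eps / A * (Rabs h * Cmod d))).
  - apply Rmult_le_compat_l; assumption.
  - replace (Cmod c * (eps / A * (Rabs h * Cmod d))) with
      ((Cmod c * Cmod d) / A * (eps * Rabs h)) by (field; lra).
    assert (0 <= eps * Rabs h) by (apply Rmult_le_pos; [lra|apply Rabs_pos]).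
    assert ((Cmod c * Cmod d) / A <= 1).
    { apply (Rmult_le_reg_r A); [assumption|]. unfold Rdiv.
      rewrite Rmult_assoc, Rinv_l by lra. unfold A; lra. }
    nra.
Qed.

(** With c the conjugate of z, the hypothesis reads |z|^2 <= |z| m. *)
Lemma Cmod_le_of_re (z : Cx) (m : R) :
  0 <= m -> (forall c, Cre (Cmul c z) <= Cmod c * m) -> Cmod z <= m.
Proof.
  intros Hm H. specialize (H (fst z, - snd z)).
  replace (Cmod (fst z, - snd z)) with (Cmod z) in H
    by (unfold Cmod; simpl; f_equal; ring).
  unfold Cre in H; simpl in H.
  assert (E := Cmod_sqr z). assert (Hn := Cmod_nonneg z).
  destruct (Rle_dec (Cmod z) m); [assumption|]. nra.
Qed.

(** The mean value theorem fails for complex values, so it is applied to Re (c h) on the segment,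
    with an intermediate point that depends on c; the ball contains the segment by convexity. *)
Lemma Lipschitz_ball (h dh : Cx -> Cx) (r B : R) :
  0 <= B -> (forall z, Cmod z <= r -> Cderiv h z (dh z)) ->
  (forall z, Cmod z <= r -> Cmod (dh z) <= B) ->
  forall z w, Cmod z <= r -> Cmod w <= r -> Cmod (Csub (h w) (h z)) <= B * Cmod (Csub w z).
Proof.
  intros HB Hd Hb z w Hz Hw. set (d := Csub w z).
  assert (Hseg : forall t, 0 <= t <= 1 -> Cmod (Cadd z (Cmul (RtoCx t) d)) <= r).
  { intros t Ht. unfold d.
    replace (Cadd z (Cmul (RtoCx t) (Csub w z))) with
      (Cadd (Cmul (RtoCx (1 - t)) z) (Cmul (RtoCx t) w))
      by (apply injective_projections; simpl; ring).
    eapply Rle_trans; [apply Cmod_add|]. rewrite !Cmod_mul, !Cmod_real, !Rabs_pos_eq by lra.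
    nra. }
  apply Cmod_le_of_re; [apply Rmult_le_pos; [assumption|apply Cmod_nonneg]|].
  intros c.
  destruct (MVT_cor2 (fun s => Cre (Cmul c (h (Cadd z (Cmul (RtoCx s) d)))))
    (fun s => Cre (Cmul c (Cmul (dh (Cadd z (Cmul (RtoCx s) d))) d))) 0 1) as [t [E Ht]];
    [lra| |].
  { intros t Ht. apply derivable_along. apply Hd, Hseg, Ht. }
  replace (Cadd z (Cmul (RtoCx 1) d)) with w in E
    by (unfold d; apply injective_projections; simpl; ring).
  replace (Cadd z (Cmul (RtoCx 0) d)) with z in E
    by (unfold d; apply injective_projections; simpl; ring).
  replace (Cre (Cmul c (Csub (h w) (h z)))) with
    (Cre (Cmul c (h w)) - Cre (Cmul c (h z))) by (unfold Cre; simpl; ring).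
  rewrite E, Rminus_0_r, Rmult_1_r.
  eapply Rle_trans; [apply Rle_abs|]. eapply Rle_trans; [apply Rabs_fst_le|].
  rewrite !Cmod_mul. apply Rmult_le_compat_l; [apply Cmod_nonneg|].
  apply Rmult_le_compat_r; [apply Cmod_nonneg|]. apply Hb, Hseg. lra.
Qed.

(** [I] is the invariant of a stage and [Q] links consecutive stages. It drives both the bisection
    in Goursat's theorem and the extraction of subsequences. *)
Lemma dependent_choice (T : Type) (I : nat -> T -> Prop) (Q : nat -> T -> T -> Prop) (x0 : T) :
  I 0%nat x0 -> (forall n x, I n x -> exists y, I (S n) y /\ Q n x y) ->
  exists s : nat -> T, s 0%nat = x0 /\ forall n, I n (s n) /\ Q n (s n) (s (S n)).
Proof.
  intros H0 Hs.
  set (s := fix s n := match n with O => x0 | S n' =>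
    epsilon (inhabits x0) (fun y => I (S n') y /\ Q n' (s n') y) end).
  assert (HI : forall n, I n (s n)).
  { induction n as [|n IH]; [exact H0|]. simpl.
    apply (epsilon_spec (inhabits x0) (fun y => I (S n) y /\ Q n (s n) y)). apply Hs, IH. }
  exists s. split; [reflexivity|]. intros n. split; [apply HI|].
  simpl. apply (epsilon_spec (inhabits x0) (fun y => I (S n) y /\ Q n (s n) y)).
  apply Hs, HI.
Qed.

(** * Goursat's theorem on rectangles *)

(* First-order expansions of P and Q whose mixed coefficients agree: the form
   P dx + Q dy is closed at (x, y), with no continuity of the partial derivatives. *)
Definition closed_at (P Q : R -> R -> R) (x y : R) : Prop :=
  exists p q r, forall eps, 0 < eps -> exists d, 0 < d /\
    forall h k, Rabs h < d -> Rabs k < d ->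
      Rabs (P (x + h) (y + k) - P x y - (p * h + q * k)) <= eps * (Rabs h + Rabs k) /\
      Rabs (Q (x + h) (y + k) - Q x y - (q * h + r * k)) <= eps * (Rabs h + Rabs k).

Definition circulation (P Q : R -> R -> R) (x1 x2 y1 y2 : R) : R :=
  RInt (fun x => P x y1) x1 x2 + RInt (fun y => Q x2 y) y1 y2
  - RInt (fun x => P x y2) x1 x2 - RInt (fun y => Q x1 y) y1 y2.

Lemma continuous_of_small (f : R -> R) (x : R) :
  (forall eps, 0 < eps -> exists d, 0 < d /\ forall h, Rabs h < d ->
    Rabs (f (x + h) - f x) <= eps) -> continuous f x.
Proof.
  intros H. apply continuity_pt_filterlim. intros eps He.
  destruct (H (eps / 2)) as [d [Hd Hh]]; [lra|].
  exists d. split; [assumption|]. intros y [_ Hy]. simpl in *.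
  unfold R_dist in *. specialize (Hh (y - x) Hy).
  replace (x + (y - x)) with y in Hh by ring. lra.
Qed.

Lemma closed_at_continuous (P Q : R -> R -> R) (x y : R) :
  closed_at P Q x y -> forall eps, 0 < eps -> exists d, 0 < d /\
    forall h k, Rabs h < d -> Rabs k < d ->
      Rabs (P (x + h) (y + k) - P x y) <= eps /\ Rabs (Q (x + h) (y + k) - Q x y) <= eps.
Proof.
  intros (p & q & r & H) eps He.
  destruct (H 1 Rlt_0_1) as [d [Hd Hh]].
  assert (Hp := Rabs_pos p). assert (Hq := Rabs_pos q). assert (Hr := Rabs_pos r).
  set (A := Rabs p + Rabs q + Rabs q + Rabs r + 2).
  assert (HA : 0 < A) by (unfold A; lra).
  exists (Rmin d (eps / A)). split.
  { apply Rmin_glb_lt; [assumption|]. apply Rdiv_lt_0_compat; assumption. }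
  intros h k Hh1 Hk1.
  destruct (Hh h k) as [H1 H2]; [eapply Rlt_le_trans; [eassumption|apply Rmin_l]..|].
  assert (Hh2 := Rlt_le_trans _ _ _ Hh1 (Rmin_r _ _)).
  assert (Hk2 := Rlt_le_trans _ _ _ Hk1 (Rmin_r _ _)).
  assert (Hh0 := Rabs_pos h). assert (Hk0 := Rabs_pos k).
  set (e := eps / A) in *.
  assert (Ee : eps = A * e) by (unfold e; field; lra).
  assert (Rabs (p * h) <= Rabs p * e) by (rewrite Rabs_mult; nra).
  assert (Rabs (q * k) <= Rabs q * e) by (rewrite Rabs_mult; nra).
  assert (Rabs (q * h) <= Rabs q * e) by (rewrite Rabs_mult; nra).
  assert (Rabs (r * k) <= Rabs r * e) by (rewrite Rabs_mult; nra).
  assert (0 <= Rabs p * e) by (apply Rmult_le_pos; lra).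
  assert (0 <= Rabs q * e) by (apply Rmult_le_pos; lra).
  assert (0 <= Rabs r * e) by (apply Rmult_le_pos; lra).
  rewrite Ee. unfold A.
  split.
  - replace (P (x + h) (y + k) - P x y) with
      ((P (x + h) (y + k) - P x y - (p * h + q * k)) + (p * h + q * k)) by ring.
    eapply Rle_trans; [apply Rabs_triang|]. assert (T := Rabs_triang (p * h) (q * k)). lra.
  - replace (Q (x + h) (y + k) - Q x y) with
      ((Q (x + h) (y + k) - Q x y - (q * h + r * k)) + (q * h + r * k)) by ring.
    eapply Rle_trans; [apply Rabs_triang|]. assert (T := Rabs_triang (q * h) (r * k)). lra.
Qed.

Lemma closed_at_ex_RInt_h (P Q : R -> R -> R) (y a b : R) :
  (forall x, Rmin a b <= x <= Rmax a b -> closed_at P Q x y) ->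
  ex_RInt (fun x => P x y) a b.
Proof.
  intros H. apply (ex_RInt_continuous (V := R_CompleteNormedModule)). intros x Hx.
  apply continuous_of_small. intros eps He.
  destruct (closed_at_continuous P Q x y (H x Hx) eps He) as [d [Hd Hh]].
  exists d. split; [assumption|]. intros h Hl.
  destruct (Hh h 0 Hl) as [H1 _]; [rewrite Rabs_R0; assumption|].
  rewrite Rplus_0_r in H1. exact H1.
Qed.

Lemma closed_at_ex_RInt_v (P Q : R -> R -> R) (x a b : R) :
  (forall y, Rmin a b <= y <= Rmax a b -> closed_at P Q x y) ->
  ex_RInt (fun y => Q x y) a b.
Proof.
  intros H. apply (ex_RInt_continuous (V := R_CompleteNormedModule)). intros y Hy.
  apply continuous_of_small. intros eps He.
  destruct (closed_at_continuous P Q x y (H y Hy) eps He) as [d [Hd Hh]].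
  exists d. split; [assumption|]. intros h Hl.
  destruct (Hh 0 h) as [_ H1]; [rewrite Rabs_R0; assumption|assumption|].
  rewrite Rplus_0_r in H1. exact H1.
Qed.

(** The affine part is integrated exactly, so that on each side of a rectangle only the uniform
    error [e] is left to estimate. *)
Lemma RInt_near_affine (f : R -> R) (a b A p x0 e : R) :
  a <= b -> ex_RInt f a b ->
  (forall x, a <= x <= b -> Rabs (f x - (A + p * (x - x0))) <= e) ->
  Rabs (RInt f a b - (A * (b - a) + p * ((b - x0) ^ 2 - (a - x0) ^ 2) / 2)) <= (b - a) * e.
Proof.
  intros Hab Hf He.
  assert (Haff : is_RInt (fun x => A + p * (x - x0)) a b
    (A * (b - a) + p * ((b - x0) ^ 2 - (a - x0) ^ 2) / 2)).
  { replace (A * (b - a) + p * ((b - x0) ^ 2 - (a - x0) ^ 2) / 2) with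
      (minus (A * b + p * (b - x0) ^ 2 / 2) (A * a + p * (a - x0) ^ 2 / 2))
      by (unfold minus, plus, opp; simpl; field).
    apply (is_RInt_derive (fun x => A * x + p * (x - x0) ^ 2 / 2)).
    - intros x _. auto_derive; [exact I|]. field.
    - intros x _. apply continuous_of_small. intros eps Hp.
      exists (eps / (Rabs p + 1)). assert (Hq := Rabs_pos p).
      split; [apply Rdiv_lt_0_compat; lra|]. intros h Hh.
      replace (A + p * (x + h - x0) - (A + p * (x - x0))) with (p * h) by ring.
      rewrite Rabs_mult. apply Rle_trans with ((Rabs p + 1) * (eps / (Rabs p + 1))).
      + apply Rmult_le_compat; try apply Rabs_pos; lra.
      + right; field; lra. }
  rewrite <- (is_RInt_unique _ _ _ _ Haff).
  assert (E := RInt_minus f _ a b Hf (ex_intro _ _ Haff)).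
  unfold minus, plus, opp in E; simpl in E. unfold Rminus at 1. rewrite <- E.
  apply abs_RInt_le_const; [assumption| |exact He].
  apply (ex_RInt_minus f); [assumption|]. eexists; exact Haff.
Qed.

Definition closed_on (P Q : R -> R -> R) (x1 x2 y1 y2 : R) : Prop :=
  forall x y, x1 <= x <= x2 -> y1 <= y <= y2 -> closed_at P Q x y.

(** The approximating affine form has the same mixed coefficient [q] in both components, so it is
    exact and its circulation vanishes; what remains is the error [e] times the perimeter. *)
Lemma circulation_near_closed (P Q : R -> R -> R) (x y u v x0 y0 P0 Q0 p q r e : R) :
  0 <= u -> 0 <= v -> closed_on P Q x (x + u) y (y + v) ->
  (forall x' y', x <= x' <= x + u -> y <= y' <= y + v ->
    Rabs (P x' y' - P0 - (p * (x' - x0) + q * (y' - y0))) <= e /\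
    Rabs (Q x' y' - Q0 - (q * (x' - x0) + r * (y' - y0))) <= e) ->
  Rabs (circulation P Q x (x + u) y (y + v)) <= 2 * (u + v) * e.
Proof.
  intros Hu Hv Hc He.
  assert (Hh : forall y', y <= y' <= y + v ->
    Rabs (RInt (fun x' => P x' y') x (x + u) - ((P0 + q * (y' - y0)) * (x + u - x) +
      p * ((x + u - x0) ^ 2 - (x - x0) ^ 2) / 2)) <= (x + u - x) * e).
  { intros y' Hy. apply RInt_near_affine; [lra| |].
    - apply closed_at_ex_RInt_h with Q. intros x'. rewrite Rmin_left, Rmax_right by lra.
      intros; apply Hc; assumption.
    - intros x' Hx. destruct (He x' y' Hx Hy) as [H1 _].
      replace (P x' y' - (P0 + q * (y' - y0) + p * (x' - x0))) with
        (P x' y' - P0 - (p * (x' - x0) + q * (y' - y0))) by ring. exact H1. }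
  assert (Hw : forall x', x <= x' <= x + u ->
    Rabs (RInt (fun y' => Q x' y') y (y + v) - ((Q0 + q * (x' - x0)) * (y + v - y) +
      r * ((y + v - y0) ^ 2 - (y - y0) ^ 2) / 2)) <= (y + v - y) * e).
  { intros x' Hx. apply RInt_near_affine; [lra| |].
    - apply closed_at_ex_RInt_v with P. intros y'. rewrite Rmin_left, Rmax_right by lra.
      intros; apply Hc; assumption.
    - intros y' Hy. destruct (He x' y' Hx Hy) as [_ H1].
      replace (Q x' y' - (Q0 + q * (x' - x0) + r * (y' - y0))) with
        (Q x' y' - Q0 - (q * (x' - x0) + r * (y' - y0))) by ring. exact H1. }
  unfold circulation.
  assert (A1 := Hh y ltac:(lra)). assert (A2 := Hh (y + v) ltac:(lra)).
  assert (A3 := Hw x ltac:(lra)). assert (A4 := Hw (x + u) ltac:(lra)).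
  apply Rabs_le_between in A1, A2, A3, A4. apply Rabs_le_between. lra.
Qed.

(** A side shared by two quarters is traversed once in each direction and cancels. *)
Lemma circulation_split (P Q : R -> R -> R) (x y u v : R) :
  0 <= u -> 0 <= v -> closed_on P Q x (x + u + u) y (y + v + v) ->
  circulation P Q x (x + u + u) y (y + v + v) =
  circulation P Q x (x + u) y (y + v) + circulation P Q (x + u) (x + u + u) y (y + v) +
  circulation P Q x (x + u) (y + v) (y + v + v) +
  circulation P Q (x + u) (x + u + u) (y + v) (y + v + v).
Proof.
  intros Hu Hv Hc.
  assert (Hh : forall y', y <= y' <= y + v + v ->
    RInt (fun x' => P x' y') x (x + u + u) =
    RInt (fun x' => P x' y') x (x + u) + RInt (fun x' => P x' y') (x + u) (x + u + u)).
  { intros y' Hy. symmetry. apply (RInt_Chasles (V := R_CompleteNormedModule));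
      apply closed_at_ex_RInt_h with Q; intros x'; rewrite Rmin_left, Rmax_right by lra;
      intros; apply Hc; lra. }
  assert (Hw : forall x', x <= x' <= x + u + u ->
    RInt (fun y' => Q x' y') y (y + v + v) =
    RInt (fun y' => Q x' y') y (y + v) + RInt (fun y' => Q x' y') (y + v) (y + v + v)).
  { intros x' Hx. symmetry. apply (RInt_Chasles (V := R_CompleteNormedModule));
      apply closed_at_ex_RInt_v with P; intros y'; rewrite Rmin_left, Rmax_right by lra;
      intros; apply Hc; lra. }
  unfold circulation.
  rewrite (Hh y), (Hh (y + v + v)), (Hw x), (Hw (x + u + u)) by lra. ring.
Qed.

Lemma nested_intervals (l r : nat -> R) :
  (forall n, l n <= l (S n)) -> (forall n, r (S n) <= r n) -> (forall n, l n <= r n) ->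
  exists x, forall n, l n <= x <= r n.
Proof.
  intros Hl Hr Hlr.
  assert (Hl' : forall n m, (n <= m)%nat -> l n <= l m)
    by (intros n m H; induction H as [|m H IH]; [lra|specialize (Hl m); lra]).
  assert (Hr' : forall n m, (n <= m)%nat -> r m <= r n)
    by (intros n m H; induction H as [|m H IH]; [lra|specialize (Hr m); lra]).
  assert (Hnm : forall n m, l n <= r m).
  { intros n m. apply Rle_trans with (l (Nat.max n m)); [apply Hl'; lia|].
    apply Rle_trans with (r (Nat.max n m)); [apply Hlr|apply Hr'; lia]. }
  destruct (completeness (fun z => exists n, z = l n)) as [x [Hub Hlub]].
  - exists (r 0%nat). intros z [n ->]. apply Hnm.
  - exists (l 0%nat), 0%nat. reflexivity.
  - exists x. intros n. split; [apply Hub; exists n; reflexivity|].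
    apply Hlub. intros z [m ->]. apply Hnm.
Qed.

Lemma pow_half_lt (a d : R) : 0 < d -> exists n, a * (/ 2) ^ n < d.
Proof.
  intros Hd. destruct (pow_lt_1_zero (/ 2)) with (y := d / (Rabs a + 1)) as [n Hn].
  - rewrite Rabs_pos_eq; lra.
  - apply Rdiv_lt_0_compat; [assumption|]. assert (H := Rabs_pos a). lra.
  - exists n. specialize (Hn n (le_n n)).
    assert (Ha := Rabs_pos a). assert (Hp : 0 < (/ 2) ^ n) by (apply pow_lt; lra).
    rewrite Rabs_pos_eq in Hn by lra.
    apply (Rmult_lt_compat_l (Rabs a + 1)) in Hn; [|lra].
    replace ((Rabs a + 1) * (d / (Rabs a + 1))) with d in Hn by (field; lra).
    assert (Hle := Rle_abs a). nra.
Qed.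

(** Goursat's bisection: some quarter always carries at least a fourth of the circulation in
    modulus. The nested rectangles shrink to a point (x0, y0), at which the first-order expansion
    applies. *)
Lemma circulation_closed_le (P Q : R -> R -> R) (x y u v : R) :
  0 <= u -> 0 <= v -> closed_on P Q x (x + u) y (y + v) ->
  circulation P Q x (x + u) y (y + v) = 0.
Proof.
  intros Hu Hv Hc.
  set (w := fun n : nat => (/ 2) ^ n).
  assert (Hw : forall n, 0 < w n) by (intros n; apply pow_lt; lra).
  assert (HwS : forall n, w n = w (S n) + w (S n)) by (intros n; unfold w; simpl; lra).
  set (c := fun n (z : R * R) =>
    circulation P Q (fst z) (fst z + u * w n) (snd z) (snd z + v * w n)).
  set (K := Rabs (circulation P Q x (x + u) y (y + v))).
  destruct (dependent_choice (R * R)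
    (fun n z => x <= fst z /\ fst z + u * w n <= x + u /\
                y <= snd z /\ snd z + v * w n <= y + v /\ K <= 4 ^ n * Rabs (c n z))
    (fun n z z' => (fst z <= fst z' <= fst z + u * w (S n)) /\
                   (snd z <= snd z' <= snd z + v * w (S n))) (x, y)) as [s [_ Hs]].
  - simpl. unfold c, w, K; simpl. rewrite !Rmult_1_r, Rmult_1_l. lra.
  - intros n z (Hx1 & Hx2 & Hy1 & Hy2 & HK).
    assert (Hun : 0 <= u * w (S n)) by (apply Rmult_le_pos; [assumption|apply Rlt_le, Hw]).
    assert (Hvn : 0 <= v * w (S n)) by (apply Rmult_le_pos; [assumption|apply Rlt_le, Hw]).
    rewrite (HwS n), Rmult_plus_distr_l, <- Rplus_assoc in Hx2.
    rewrite (HwS n), Rmult_plus_distr_l, <- Rplus_assoc in Hy2.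
    assert (Ec := circulation_split P Q (fst z) (snd z) (u * w (S n)) (v * w (S n)) Hun Hvn).
    set (c0 := c (S n) z). set (c1 := c (S n) (fst z + u * w (S n), snd z)).
    set (c2 := c (S n) (fst z, snd z + v * w (S n))).
    set (c3 := c (S n) (fst z + u * w (S n), snd z + v * w (S n))).
    assert (Et : c n z = c0 + c1 + c2 + c3).
    { unfold c0, c1, c2, c3, c. simpl fst; simpl snd.
      rewrite (HwS n), !Rmult_plus_distr_l, <- !Rplus_assoc. apply Ec.
      intros x' y' Hx' Hy'. apply Hc; lra. }
    assert (H4 : 0 < 4 ^ n) by (apply pow_lt; lra).
    assert (Hmax : exists c' : R, (c' = c0 \/ c' = c1 \/ c' = c2 \/ c' = c3) /\
      Rabs (c n z) <= 4 * Rabs c').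
    { rewrite Et.
      assert (T1 := Rabs_triang (c0 + c1 + c2) c3). assert (T2 := Rabs_triang (c0 + c1) c2).
      assert (T3 := Rabs_triang c0 c1).
      destruct (Rle_dec (Rabs (c0 + c1 + c2 + c3)) (4 * Rabs c0)); [exists c0; tauto|].
      destruct (Rle_dec (Rabs (c0 + c1 + c2 + c3)) (4 * Rabs c1)); [exists c1; tauto|].
      destruct (Rle_dec (Rabs (c0 + c1 + c2 + c3)) (4 * Rabs c2)); [exists c2; tauto|].
      exists c3. split; [tauto|lra]. }
    destruct Hmax as [c' [Hc' Hle]].
    assert (HK' : K <= 4 ^ S n * Rabs c') by (simpl; nra).
    destruct Hc' as [E|[E|[E|E]]]; rewrite E in HK'.
    + exists z. repeat split; try lra. exact HK'.
    + exists (fst z + u * w (S n), snd z). simpl fst; simpl snd.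
      repeat split; try lra. exact HK'.
    + exists (fst z, snd z + v * w (S n)). simpl fst; simpl snd.
      repeat split; try lra. exact HK'.
    + exists (fst z + u * w (S n), snd z + v * w (S n)). simpl fst; simpl snd.
      repeat split; try lra. exact HK'.
  - destruct (nested_intervals (fun n => fst (s n)) (fun n => fst (s n) + u * w n)) as [x0 Hx0].
    { intros n. apply Hs. }
    { intros n. destruct (Hs n) as [_ [[_ H] _]]. rewrite (HwS n). lra. }
    { intros n. assert (H := Rmult_le_pos _ _ Hu (Rlt_le _ _ (Hw n))). lra. }
    destruct (nested_intervals (fun n => snd (s n)) (fun n => snd (s n) + v * w n)) as [y0 Hy0].
    { intros n. apply Hs. }
    { intros n. destruct (Hs n) as [_ [_ [_ H]]]. rewrite (HwS n). lra. }
    { intros n. assert (H := Rmult_le_pos _ _ Hv (Rlt_le _ _ (Hw n))). lra. }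
    assert (Hxy : closed_at P Q x0 y0).
    { destruct (Hs 0%nat) as [(B1 & B2 & B3 & B4 & _) _].
      apply Hc; [specialize (Hx0 0%nat)|specialize (Hy0 0%nat)]; simpl in *; lra. }
    destruct Hxy as (p & q & r & Hd).
    (* At depth [n] both the perimeter and the error scale like 2^(-n); their product cancels the
       factor 4^n of the invariant. *)
    assert (HKle : forall eps, 0 < eps -> K <= 2 * (u + v) * (eps * (u + v))).
    { intros eps He. destruct (Hd eps He) as [d [Hd0 Hdd]].
      destruct (pow_half_lt (u + v) d Hd0) as [n Hn]. fold (w n) in Hn.
      destruct (Hs n) as [(B1 & B2 & B3 & B4 & HK) _].
      specialize (Hx0 n). specialize (Hy0 n). simpl in Hx0, Hy0.
      assert (Hun := Rmult_le_pos _ _ Hu (Rlt_le _ _ (Hw n))).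
      assert (Hvn := Rmult_le_pos _ _ Hv (Rlt_le _ _ (Hw n))).
      assert (Hcn : Rabs (c n (s n)) <= 2 * (u * w n + v * w n) * (eps * (u * w n + v * w n))).
      { unfold c. apply circulation_near_closed with x0 y0 (P x0 y0) (Q x0 y0) p q r;
          [assumption|assumption| |].
        - intros x' y' Hx' Hy'. apply Hc; lra.
        - intros x' y' Hx' Hy'.
          assert (Hx'' : Rabs (x' - x0) <= u * w n) by (apply Rabs_le_between; lra).
          assert (Hy'' : Rabs (y' - y0) <= v * w n) by (apply Rabs_le_between; lra).
          destruct (Hdd (x' - x0) (y' - y0)) as [G1 G2]; [lra|lra|].
          replace (x0 + (x' - x0)) with x' in G1, G2 by ring.
          replace (y0 + (y' - y0)) with y' in G1, G2 by ring.
          assert (eps * (Rabs (x' - x0) + Rabs (y' - y0)) <= eps * (u * w n + v * w n))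
            by (apply Rmult_le_compat_l; lra).
          split; lra. }
      eapply Rle_trans; [exact HK|].
      assert (H4 : 0 < 4 ^ n) by (apply pow_lt; lra).
      eapply Rle_trans; [apply Rmult_le_compat_l; [lra|exact Hcn]|].
      right. assert (E : 4 ^ n * (w n * w n) = 1).
      { unfold w. rewrite <- !Rpow_mult_distr. replace (4 * (/ 2 * / 2)) with 1 by field.
        apply pow1. }
      transitivity (2 * (u + v) * (eps * (u + v)) * (4 ^ n * (w n * w n))); [ring|].
      rewrite E. ring. }
    assert (HK0 : K <= 0).
    { apply Rnot_lt_le. intros HKp.
      (* With eps = K / (2 B) the bound becomes K <= (K / 2) (B - 1) / B < K. The summand 1 keeps
         [B] positive for a degenerate rectangle. *)
      set (B := 2 * (u + v) * (u + v) + 1).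
      assert (HB : 0 < B) by (unfold B; nra).
      assert (Hk := HKle (K / (2 * B)) ltac:(apply Rdiv_lt_0_compat; lra)).
      replace (2 * (u + v) * (K / (2 * B) * (u + v))) with
        (K / 2 * ((B - 1) / B)) in Hk by (unfold B; field; fold B; lra).
      assert ((B - 1) / B < 1).
      { apply (Rmult_lt_reg_r B); [assumption|]. unfold Rdiv.
        rewrite Rmult_assoc, Rinv_l; lra. }
      nra. }
    assert (Hz := Rabs_pos (circulation P Q x (x + u) y (y + v))). fold K in Hz.
    apply Rabs_eq_0. fold K. lra.
Qed.

(** Exchanging two opposite bounds only changes the sign. Unordered corners occur because the paths
    for the potential start at 0 and go in every direction. *)
Theorem circulation_closed (P Q : R -> R -> R) (x1 x2 y1 y2 : R) :
  closed_on P Q (Rmin x1 x2) (Rmax x1 x2) (Rmin y1 y2) (Rmax y1 y2) ->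
  circulation P Q x1 x2 y1 y2 = 0.
Proof.
  assert (Hle : forall x1 x2 y1 y2, x1 <= x2 -> y1 <= y2 -> closed_on P Q x1 x2 y1 y2 ->
    circulation P Q x1 x2 y1 y2 = 0).
  { clear. intros x1 x2 y1 y2 Hx Hy Hc.
    assert (E := circulation_closed_le P Q x1 y1 (x2 - x1) (y2 - y1)).
    replace (x1 + (x2 - x1)) with x2 in E by ring.
    replace (y1 + (y2 - y1)) with y2 in E by ring. apply E; [lra|lra|exact Hc]. }
  intros Hc.
  assert (Sx : forall y, Rmin y1 y2 <= y <= Rmax y1 y2 ->
    RInt (fun x => P x y) x2 x1 = - RInt (fun x => P x y) x1 x2).
  { intros y Hy. symmetry. apply (opp_RInt_swap (fun x => P x y)).
    apply closed_at_ex_RInt_h with Q. intros x Hx. apply Hc; assumption. }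
  assert (Sy : forall x, Rmin x1 x2 <= x <= Rmax x1 x2 ->
    RInt (fun y => Q x y) y2 y1 = - RInt (fun y => Q x y) y1 y2).
  { intros x Hx. symmetry. apply (opp_RInt_swap (fun y => Q x y)).
    apply closed_at_ex_RInt_v with P. intros y Hy. apply Hc; assumption. }
  assert (M1 := conj (Rmin_l x1 x2) (Rmax_l x1 x2)).
  assert (M2 := conj (Rmin_r x1 x2) (Rmax_r x1 x2)).
  assert (M3 := conj (Rmin_l y1 y2) (Rmax_l y1 y2)).
  assert (M4 := conj (Rmin_r y1 y2) (Rmax_r y1 y2)).
  destruct (Rle_dec x1 x2) as [Hx|Hx]; destruct (Rle_dec y1 y2) as [Hy|Hy].
  - rewrite !Rmin_left, !Rmax_right in Hc by lra. apply Hle; assumption.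
  - rewrite (Rmin_left x1), (Rmax_right x1), (Rmin_right y1), (Rmax_left y1) in Hc by lra.
    assert (E := Hle x1 x2 y2 y1 Hx ltac:(lra) Hc). unfold circulation in *.
    rewrite !Sy in E by assumption. lra.
  - rewrite (Rmin_right x1), (Rmax_left x1), (Rmin_left y1), (Rmax_right y1) in Hc by lra.
    assert (E := Hle x2 x1 y1 y2 ltac:(lra) Hy Hc). unfold circulation in *.
    rewrite !Sx in E by assumption. lra.
  - rewrite (Rmin_right x1), (Rmax_left x1), (Rmin_right y1), (Rmax_left y1) in Hc by lra.
    assert (E := Hle x2 x1 y2 y1 ltac:(lra) ltac:(lra) Hc). unfold circulation in *.
    rewrite !Sx, !Sy in E by assumption. lra.
Qed.

(** With F = U + i V, the real and imaginary parts of F dz are U dx - V dy and V dx + U dy; the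
    Cauchy-Riemann equations are precisely the equality of their mixed coefficients. *)
Lemma Cdiff_closed_at (F : Cx -> Cx) (x y : R) :
  Cdiff F (x, y) ->
  closed_at (fun s t => fst (F (s, t))) (fun s t => - snd (F (s, t))) x y /\
  closed_at (fun s t => snd (F (s, t))) (fun s t => fst (F (s, t))) x y.
Proof.
  intros [[a b] H].
  assert (Hk : forall eps, 0 < eps -> exists d, 0 < d /\
    forall h k, Rabs h < d -> Rabs k < d ->
      Rabs (fst (F (x + h, y + k)) - fst (F (x, y)) - (a * h - b * k)) <= eps * (Rabs h + Rabs k) /\
      Rabs (snd (F (x + h, y + k)) - snd (F (x, y)) - (b * h + a * k)) <= eps * (Rabs h + Rabs k)).
  { intros eps He. destruct (H eps He) as [d [Hd Hh]].
    exists (d / 2). split; [lra|]. intros h k Hh1 Hk1.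
    assert (T := Cmod_le_abs (h, k)). simpl in T.
    specialize (Hh (h, k) ltac:(lra)).
    change (Cadd (x, y) (h, k)) with (x + h, y + k) in Hh.
    assert (T1 := Rabs_fst_le (Csub (Csub (F (x + h, y + k)) (F (x, y))) (Cmul (a, b) (h, k)))).
    assert (T2 := Rabs_snd_le (Csub (Csub (F (x + h, y + k)) (F (x, y))) (Cmul (a, b) (h, k)))).
    simpl in T1, T2.
    assert (eps * Cmod (h, k) <= eps * (Rabs h + Rabs k)) by (apply Rmult_le_compat_l; lra).
    split; [eapply Rle_trans; [|eapply Rle_trans; [exact T1|lra]]
           |eapply Rle_trans; [|eapply Rle_trans; [exact T2|lra]]];
      right; f_equal; ring. }
  split.
  - exists a, (- b), (- a). intros eps He. destruct (Hk eps He) as [d [Hd Hh]].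
    exists d; split; [assumption|]. intros h k Hh1 Hk1. destruct (Hh h k Hh1 Hk1) as [G1 G2].
    split.
    + eapply Rle_trans; [|exact G1]. right; f_equal; ring.
    + eapply Rle_trans; [|exact G2]. right. rewrite <- Rabs_Ropp. f_equal; ring.
  - exists b, a, (- b). intros eps He. destruct (Hk eps He) as [d [Hd Hh]].
    exists d; split; [assumption|]. intros h k Hh1 Hk1. destruct (Hh h k Hh1 Hk1) as [G1 G2].
    split.
    + exact G2.
    + eapply Rle_trans; [|exact G1]. right; f_equal; ring.
Qed.

(** * Primitives and Cauchy's estimate for analytic functions *)

Definition in_disk2 (x y : R) : Prop := x * x + y * y < 1.

Lemma in_disk_iff (x y : R) : in_disk (x, y) <-> in_disk2 x y.
Proof.
  unfold in_disk, in_disk2. assert (E := Cmod_sqr (x, y)). simpl in E.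
  assert (H := Cmod_nonneg (x, y)). split; intros; nra.
Qed.

Lemma RInt_near_const (f : R -> R) (a b A e : R) :
  ex_RInt f a b -> (forall x, Rmin a b <= x <= Rmax a b -> Rabs (f x - A) <= e) ->
  Rabs (RInt f a b - A * (b - a)) <= e * Rabs (b - a).
Proof.
  assert (Hle : forall a b, a <= b -> ex_RInt f a b ->
    (forall x, Rmin a b <= x <= Rmax a b -> Rabs (f x - A) <= e) ->
    Rabs (RInt f a b - A * (b - a)) <= e * Rabs (b - a)).
  { clear a b. intros a b Hab Hf He.
    assert (E := RInt_near_affine f a b A 0 0 e Hab Hf).
    rewrite (Rabs_pos_eq (b - a)) by lra. rewrite Rmin_left, Rmax_right in He by assumption.
    replace (A * (b - a)) with (A * (b - a) + 0 * ((b - 0) ^ 2 - (a - 0) ^ 2) / 2) by field.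
    rewrite (Rmult_comm e). apply E. intros x Hx. rewrite Rmult_0_l, Rplus_0_r. apply He, Hx. }
  intros Hf He. destruct (Rle_dec a b) as [Hab|Hab]; [apply Hle; assumption|].
  assert (E := opp_RInt_swap f a b Hf). unfold opp in E; simpl in E.
  assert (G := Hle b a ltac:(lra) (ex_RInt_swap _ _ _ Hf)).
  rewrite Rmin_comm, Rmax_comm in G. specialize (G He). rewrite <- E in G.
  rewrite <- Rabs_Ropp. rewrite (Rabs_minus_sym b a).
  eapply Rle_trans; [|exact G]. right; f_equal; ring.
Qed.

(** Convexity of the square; it keeps the paths and rectangles of the next proof inside the disk. *)
Lemma Rmin_Rmax_sqr_le (a b x m : R) :
  a * a <= m -> b * b <= m -> Rmin a b <= x <= Rmax a b -> x * x <= m.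
Proof.
  assert (K : forall u v, u * u <= m -> v * v <= m -> u <= x <= v -> x * x <= m).
  { intros u v Hu Hv [H1 H2]. destruct (Rle_dec 0 x).
    - assert (x * x <= v * v) by (apply Rmult_le_compat; lra). lra.
    - assert (- x * - x <= - u * - u) by (apply Rmult_le_compat; lra). lra. }
  intros Ha Hb. unfold Rmin, Rmax. destruct (Rle_dec a b); apply K; assumption.
Qed.

(** The potential integrates along the horizontal axis and then vertically. Only first-order
    increments of [phi] are asserted, which is the form that [Cderiv] needs. *)
Lemma potential_on_disk (P Q : R -> R -> R) :
  (forall x y, in_disk2 x y -> closed_at P Q x y) ->
  exists phi : R -> R -> R, phi 0 0 = 0 /\
    forall x y, in_disk2 x y -> forall eps, 0 < eps -> exists d, 0 < d /\
      forall h k, Rabs h < d -> Rabs k < d ->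
        Rabs (phi (x + h) (y + k) - phi x y - (P x y * h + Q x y * k))
          <= eps * (Rabs h + Rabs k).
Proof.
  intros Hc.
  set (phi := fun x y => RInt (fun s => P s 0) 0 x + RInt (fun t => Q x t) 0 y).
  exists phi. split.
  { unfold phi. rewrite !(RInt_point (V := R_CompleteNormedModule)). unfold zero; simpl. ring. }
  (* The rectangle between [x], [x'], 0 and [y] lies in the disk because (x, y) and (x', y) do; its
     zero circulation moves the horizontal step from height 0 to height [y]. *)
  assert (Hstep : forall x x' y y', in_disk2 x y -> in_disk2 x' y -> in_disk2 x' y' ->
    phi x' y' - phi x y = RInt (fun s => P s y) x x' + RInt (fun t => Q x' t) y y').
  { intros x x' y y' H1 H2 H3. unfold in_disk2 in *.
    assert (G : circulation P Q x x' 0 y = 0).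
    { apply circulation_closed. intros s t Hs Ht. apply Hc. unfold in_disk2.
      assert (s * s <= Rmax (x * x) (x' * x'))
        by (apply (Rmin_Rmax_sqr_le x x'); auto using Rmax_l, Rmax_r).
      assert (t * t <= y * y) by (apply (Rmin_Rmax_sqr_le 0 y); auto; nra).
      unfold Rmax in *. destruct (Rle_dec (x * x) (x' * x')); lra. }
    assert (Cone' : RInt (fun s => P s 0) 0 x + RInt (fun s => P s 0) x x' =
                 RInt (fun s => P s 0) 0 x').
    { apply (RInt_Chasles (V := R_CompleteNormedModule));
        apply closed_at_ex_RInt_h with Q; intros s Hs; apply Hc; unfold in_disk2.
      - assert (s * s <= x * x) by (apply (Rmin_Rmax_sqr_le 0 x); auto; nra). nra.
      - assert (s * s <= Rmax (x * x) (x' * x'))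
          by (apply (Rmin_Rmax_sqr_le x x'); auto using Rmax_l, Rmax_r).
        unfold Rmax in *. destruct (Rle_dec (x * x) (x' * x')); nra. }
    assert (C2' : RInt (fun t => Q x' t) 0 y + RInt (fun t => Q x' t) y y' =
                 RInt (fun t => Q x' t) 0 y').
    { apply (RInt_Chasles (V := R_CompleteNormedModule));
        apply closed_at_ex_RInt_v with P; intros t Ht; apply Hc; unfold in_disk2.
      - assert (t * t <= y * y) by (apply (Rmin_Rmax_sqr_le 0 y); auto; nra). nra.
      - assert (t * t <= Rmax (y * y) (y' * y'))
          by (apply (Rmin_Rmax_sqr_le y y'); auto using Rmax_l, Rmax_r).
        unfold Rmax in *. destruct (Rle_dec (y * y) (y' * y')); nra. }
    unfold circulation in G. unfold phi. lra. }
  intros x y Hxy eps He.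
  destruct (closed_at_continuous P Q x y (Hc x y Hxy) eps He) as [d1 [Hd1 Hcont]].
  destruct (in_disk_ball (x, y)) as [d2 [Hd2 Hball]]; [apply in_disk_iff; exact Hxy|].
  exists (Rmin d1 (d2 / 2)). split; [apply Rmin_glb_lt; lra|].
  intros h k Hh Hk.
  assert (Hh1 := Rlt_le_trans _ _ _ Hh (Rmin_l _ _)).
  assert (Hh2 := Rlt_le_trans _ _ _ Hh (Rmin_r _ _)).
  assert (Hk1 := Rlt_le_trans _ _ _ Hk (Rmin_l _ _)).
  assert (Hk2 := Rlt_le_trans _ _ _ Hk (Rmin_r _ _)).
  assert (Hin : forall h' k', Rabs h' <= Rabs h -> Rabs k' <= Rabs k -> in_disk2 (x + h') (y + k')).
  { intros h' k' Hh' Hk'. apply in_disk_iff. apply (Hball (h', k')).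
    eapply Rle_lt_trans; [apply Cmod_le_abs|]. simpl. lra. }
  assert (Hh0 := Rabs_pos h). assert (Hk0 := Rabs_pos k).
  assert (Hbet : forall a u v, Rmin a (a + u) <= v <= Rmax a (a + u) -> Rabs (v - a) <= Rabs u).
  { intros a u v. unfold Rmin, Rmax. destruct (Rle_dec a (a + u)); intros [L1 L2].
    - rewrite (Rabs_pos_eq u), Rabs_pos_eq by lra. lra.
    - rewrite (Rabs_left1 u), Rabs_left1 by lra. lra. }
  rewrite Hstep; [|exact Hxy| |].
  2: { rewrite <- (Rplus_0_r y). apply Hin; [lra|rewrite Rabs_R0; lra]. }
  2: { apply Hin; lra. }
  assert (A1 : Rabs (RInt (fun s => P s y) x (x + h) - P x y * (x + h - x)) <= eps * Rabs (x + h - x)).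
  { assert (Hs : forall s, Rmin x (x + h) <= s <= Rmax x (x + h) -> Rabs (s - x) <= Rabs h)
      by (intros; apply Hbet; assumption).
    apply RInt_near_const.
    - apply closed_at_ex_RInt_h with Q. intros s Hs'. apply Hc.
      replace s with (x + (s - x)) by ring. rewrite <- (Rplus_0_r y).
      apply Hin; [apply Hs, Hs'|rewrite Rabs_R0; lra].
    - intros s Hs'. specialize (Hs s Hs').
      destruct (Hcont (s - x) 0) as [G _]; [lra|rewrite Rabs_R0; lra|].
      rewrite Rplus_0_r in G. replace (x + (s - x)) with s in G by ring. exact G. }
  assert (A2 : Rabs (RInt (fun t => Q (x + h) t) y (y + k) - Q x y * (y + k - y)) <= eps * Rabs (y + k - y)).
  { assert (Ht : forall t, Rmin y (y + k) <= t <= Rmax y (y + k) -> Rabs (t - y) <= Rabs k)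
      by (intros; apply Hbet; assumption).
    apply RInt_near_const.
    - apply closed_at_ex_RInt_v with P. intros t Ht'. apply Hc.
      replace t with (y + (t - y)) by ring. apply Hin; [lra|apply Ht, Ht'].
    - intros t Ht'. specialize (Ht t Ht').
      destruct (Hcont h (t - y)) as [_ G]; [lra|lra|].
      replace (y + (t - y)) with t in G by ring. exact G. }
  replace (x + h - x) with h in A1 by ring. replace (y + k - y) with k in A2 by ring.
  replace (RInt (fun s => P s y) x (x + h) + RInt (fun t => Q (x + h) t) y (y + k) -
    (P x y * h + Q x y * k)) with
    ((RInt (fun s => P s y) x (x + h) - P x y * h) +
     (RInt (fun t => Q (x + h) t) y (y + k) - Q x y * k)) by ring.
  eapply Rle_trans; [apply Rabs_triang|]. lra.
Qed.

Theorem primitive_on_disk (F : Cx -> Cx) :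
  analytic_on_disk F -> exists H, H C0 = C0 /\ forall z, in_disk z -> Cderiv H z (F z).
Proof.
  intros HF.
  destruct (potential_on_disk (fun s t => fst (F (s, t))) (fun s t => - snd (F (s, t))))
    as [phi [Hphi0 Hphi]].
  { intros x y Hxy. apply Cdiff_closed_at, HF, in_disk_iff, Hxy. }
  destruct (potential_on_disk (fun s t => snd (F (s, t))) (fun s t => fst (F (s, t))))
    as [psi [Hpsi0 Hpsi]].
  { intros x y Hxy. apply Cdiff_closed_at, HF, in_disk_iff, Hxy. }
  exists (fun z => (phi (fst z) (snd z), psi (fst z) (snd z))). split.
  { unfold C0; simpl. rewrite Hphi0, Hpsi0. reflexivity. }
  intros [x y] Hz eps He.
  destruct (Hphi x y ltac:(apply in_disk_iff, Hz) (eps / 4)) as [d1 [Hd1 H1]]; [lra|].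
  destruct (Hpsi x y ltac:(apply in_disk_iff, Hz) (eps / 4)) as [d2 [Hd2 H2]]; [lra|].
  exists (Rmin d1 d2). split; [apply Rmin_glb_lt; assumption|].
  intros [h k] Hhk.
  assert (Th := Rabs_fst_le (h, k)). assert (Tk := Rabs_snd_le (h, k)). simpl in Th, Tk.
  assert (L1 := Rlt_le_trans _ _ _ Hhk (Rmin_l _ _)).
  assert (L2 := Rlt_le_trans _ _ _ Hhk (Rmin_r _ _)).
  specialize (H1 h k ltac:(lra) ltac:(lra)). specialize (H2 h k ltac:(lra) ltac:(lra)).
  eapply Rle_trans; [apply Cmod_le_abs|]. simpl.
  replace (phi (x + h) (y + k) - phi x y - (fst (F (x, y)) * h - snd (F (x, y)) * k)) with
    (phi (x + h) (y + k) - phi x y - (fst (F (x, y)) * h + - snd (F (x, y)) * k)) by ring.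
  replace (psi (x + h) (y + k) - psi x y - (fst (F (x, y)) * k + snd (F (x, y)) * h)) with
    (psi (x + h) (y + k) - psi x y - (snd (F (x, y)) * h + fst (F (x, y)) * k)) by ring.
  eapply Rle_trans; [apply Rplus_le_compat; eassumption|].
  nra.
Qed.

(* The function w |-> (f (z + e^w) - f z) e^(-w) is 2 pi i-periodic, so Goursat's theorem on
   [s, ln rho] x [0, 2 pi] equates its integrals over the two vertical sides; as s -> -oo
   the left one tends to 2 pi f'(z). *)
Theorem Cauchy_estimate (f : Cx -> Cx) (z l : Cx) (rho M : R) :
  0 < rho -> (forall h, Cmod h <= rho -> Cdiff f (Cadd z h)) ->
  (forall h, Cmod h <= rho -> Cmod (f (Cadd z h)) <= M) ->
  Cderiv f z l -> Cmod l <= 4 * M / rho.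
Proof.
  intros Hrho Hd HM Hl.
  assert (HPI := PI_RGT_0).
  set (F := fun w => Cmul (Csub (f (Cadd z (Cexp w))) (f z)) (Cexp (Cmul (Copp Cone) w))).
  set (s2 := ln rho).
  assert (Emod : forall s t, Cmod (Cexp (s, t)) = exp s) by (intros; apply Cmod_exp).
  assert (HF : forall s t, s <= s2 -> Cdiff F (s, t)).
  { intros s t Hs. apply Cdiff_mul.
    - assert (Hf : Cdiff (fun w => f (Cadd z (Cexp w))) (s, t)).
      { apply (Cdiff_comp f (fun w => Cadd z (Cexp w))).
        - apply Cdiff_add; [apply Cdiff_const|]. eexists; apply Cderiv_exp.
        - apply Hd. rewrite Emod. rewrite <- (exp_ln rho Hrho). fold s2.
          destruct Hs as [Hs| ->]; [left; apply exp_increasing; assumption|lra]. }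
      destruct Hf as [m Hm]. eexists. apply (Cderiv_sub (fun w => f (Cadd z (Cexp w))));
        [exact Hm|apply Cderiv_const].
    - apply (Cdiff_comp Cexp).
      + apply Cdiff_mul; [apply Cdiff_const|apply Cdiff_id].
      + eexists; apply Cderiv_exp. }
  assert (Hper : forall s, F (s, 2 * PI) = F (s, 0)).
  { intros s. unfold F.
    assert (E1 : Cexp (s, 2 * PI) = Cexp (s, 0)).
    { unfold Cexp; simpl. rewrite cos_2PI, sin_2PI, cos_0, sin_0. reflexivity. }
    assert (E2 : Cexp (Cmul (Copp Cone) (s, 2 * PI)) = Cexp (Cmul (Copp Cone) (s, 0))).
    { unfold Cexp, Cmul, Copp, Cone; simpl.
      replace (- (1) * (2 * PI) + - 0 * s) with (- (2 * PI)) by ring.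
      replace (- (1) * 0 + - 0 * s) with (- 0) by ring.
      replace (- (1) * s - - 0 * (2 * PI)) with (- (1) * s - - 0 * 0) by ring.
      rewrite !cos_neg, !sin_neg, cos_2PI, sin_2PI, cos_0, sin_0. reflexivity. }
    rewrite E1, E2. reflexivity. }
  assert (Hex : forall s, s <= s2 -> ex_RInt (fun t => fst (F (s, t))) 0 (2 * PI) /\
                                     ex_RInt (fun t => snd (F (s, t))) 0 (2 * PI)).
  { intros s Hs. split.
    - apply (closed_at_ex_RInt_v (fun s t => snd (F (s, t))) (fun s t => fst (F (s, t)))).
      intros t _. apply Cdiff_closed_at, HF, Hs.
    - apply (ex_RInt_ext (fun t => opp (opp (snd (F (s, t)))))).
      { intros t _. unfold opp; simpl. ring. }
      apply (ex_RInt_opp (V := R_NormedModule)).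
      apply (closed_at_ex_RInt_v (fun s t => fst (F (s, t))) (fun s t => - snd (F (s, t)))).
      intros t _. apply Cdiff_closed_at, HF, Hs. }
  assert (Heq : forall s, s <= s2 ->
    RInt (fun t => fst (F (s, t))) 0 (2 * PI) = RInt (fun t => fst (F (s2, t))) 0 (2 * PI) /\
    RInt (fun t => snd (F (s, t))) 0 (2 * PI) = RInt (fun t => snd (F (s2, t))) 0 (2 * PI)).
  { intros s Hs.
    assert (Hc : forall x, Rmin s s2 <= x <= Rmax s s2 -> x <= s2)
      by (intros x; rewrite Rmax_right by lra; lra).
    assert (G1 := circulation_closed (fun s t => fst (F (s, t))) (fun s t => - snd (F (s, t)))
      s s2 0 (2 * PI) ltac:(intros x y Hx _; apply Cdiff_closed_at, HF, Hc, Hx)).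
    assert (G2 := circulation_closed (fun s t => snd (F (s, t))) (fun s t => fst (F (s, t)))
      s s2 0 (2 * PI) ltac:(intros x y Hx _; apply Cdiff_closed_at, HF, Hc, Hx)).
    unfold circulation in G1, G2.
    rewrite (RInt_ext (fun x => fst (F (x, 2 * PI))) (fun x => fst (F (x, 0)))) in G1
      by (intros; rewrite Hper; reflexivity).
    rewrite (RInt_ext (fun x => snd (F (x, 2 * PI))) (fun x => snd (F (x, 0)))) in G2
      by (intros; rewrite Hper; reflexivity).
    assert (O : forall s, s <= s2 -> RInt (fun t => - snd (F (s, t))) 0 (2 * PI) =
      - RInt (fun t => snd (F (s, t))) 0 (2 * PI))
      by (intros; apply (RInt_opp (V := R_CompleteNormedModule)), Hex; assumption).
    rewrite !O in G1 by lra. split; lra. }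
  assert (HF2 : forall t, Cmod (F (s2, t)) <= 2 * M / rho).
  { intros t. unfold F. rewrite Cmod_mul, Cmod_exp. simpl.
    replace (- (1) * s2 - - 0 * t) with (- s2) by ring. rewrite exp_Ropp. unfold s2.
    rewrite exp_ln by assumption.
    apply Rmult_le_compat_r; [apply Rlt_le, Rinv_0_lt_compat, Hrho|].
    eapply Rle_trans; [apply Cmod_sub|].
    assert (B1 := HM (Cexp (ln rho, t))). rewrite Emod, exp_ln in B1 by assumption.
    assert (B2 := HM C0). rewrite Cmod_C0 in B2. replace (Cadd z C0) with z in B2 by ring.
    specialize (B1 (Rle_refl _)). specialize (B2 ltac:(lra)). lra. }
  assert (Hlim : forall eps, 0 < eps -> exists s, s <= s2 /\
    forall t, Cmod (Csub (F (s, t)) l) <= eps).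
  { intros eps He. destruct (Hl eps He) as [d [Hd0 Hh]].
    set (s := Rmin s2 (ln (d / 2))). exists s. split; [apply Rmin_l|].
    intros t. assert (Hes : exp s < d).
    { apply Rle_lt_trans with (exp (ln (d / 2))); [|rewrite exp_ln by lra; lra].
      destruct (Rmin_r s2 (ln (d / 2))) as [H|H]; fold s in H;
        [left; apply exp_increasing, H|rewrite H; lra]. }
    specialize (Hh (Cexp (s, t))). rewrite Emod in Hh. specialize (Hh Hes).
    assert (Einv : Cmul (Cexp (s, t)) (Cexp (Cmul (Copp Cone) (s, t))) = Cone).
    { rewrite <- Cexp_add. replace (Cadd (s, t) (Cmul (Copp Cone) (s, t))) with C0 by ring.
      unfold Cexp, C0, Cone; simpl. rewrite exp_0, cos_0, sin_0. f_equal; ring. }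
    replace (Csub (F (s, t)) l) with
      (Cmul (Csub (Csub (f (Cadd z (Cexp (s, t)))) (f z)) (Cmul l (Cexp (s, t))))
        (Cexp (Cmul (Copp Cone) (s, t)))).
    2: { unfold F. transitivity
      (Csub (Cmul (Csub (f (Cadd z (Cexp (s, t)))) (f z)) (Cexp (Cmul (Copp Cone) (s, t))))
        (Cmul l (Cmul (Cexp (s, t)) (Cexp (Cmul (Copp Cone) (s, t)))))); [ring|].
      rewrite Einv. ring. }
    rewrite Cmod_mul. rewrite (Cmod_exp (Cmul (Copp Cone) (s, t))). simpl.
    replace (- (1) * s - - 0 * t) with (- s) by ring. rewrite exp_Ropp.
    assert (Hp := exp_pos s).
    apply Rle_trans with (eps * exp s * / exp s).
    - apply Rmult_le_compat_r; [apply Rlt_le, Rinv_0_lt_compat, Hp|exact Hh].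
    - right. field. lra. }
  (* [g] stands for the real or the imaginary part. Each is bounded by 2 M / rho, and adding the two
     bounds produces the constant 4. *)
  assert (Hcomp : forall g : Cx -> R, (forall w, Rabs (g w) <= Cmod w) ->
    (forall v w, g (Csub v w) = g v - g w) ->
    (forall s, s <= s2 -> ex_RInt (fun t => g (F (s, t))) 0 (2 * PI) /\
      RInt (fun t => g (F (s, t))) 0 (2 * PI) = RInt (fun t => g (F (s2, t))) 0 (2 * PI)) ->
    Rabs (g l) <= 2 * M / rho).
  { intros g Hg1 Hg2 Hg3. apply le_epsilon. intros eps He.
    destruct (Hlim eps He) as [s [Hs Ht]].
    destruct (Hg3 s Hs) as [Ex1 E]. destruct (Hg3 s2 (Rle_refl _)) as [Ex2 _].
    assert (N1 := RInt_near_const _ 0 (2 * PI) (g l) eps Ex1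
      ltac:(intros t _; cbv beta; rewrite <- Hg2; eapply Rle_trans; [apply Hg1|apply Ht])).
    assert (N2 := RInt_near_const _ 0 (2 * PI) 0 (2 * M / rho) Ex2
      ltac:(intros t _; rewrite Rminus_0_r; eapply Rle_trans; [apply Hg1|apply HF2])).
    rewrite E in N1. rewrite Rmult_0_l, Rminus_0_r in N2.
    rewrite Rminus_0_r, (Rabs_pos_eq (2 * PI)) in N1, N2 by lra.
    set (J := RInt (fun t => g (F (s2, t))) 0 (2 * PI)) in *.
    assert (T := Rabs_triang (g l * (2 * PI) - J) J).
    replace (g l * (2 * PI) - J + J) with (g l * (2 * PI)) in T by ring.
    rewrite Rabs_minus_sym in N1. rewrite Rabs_mult, (Rabs_pos_eq (2 * PI)) in T by lra.
    apply (Rmult_le_reg_r (2 * PI)); [lra|]. lra. }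
  eapply Rle_trans; [apply Cmod_le_abs|].
  assert (B1 : Rabs (fst l) <= 2 * M / rho).
  { apply (Hcomp fst); [exact Rabs_fst_le|intros v w; reflexivity|].
    intros s Hs. split; [exact (proj1 (Hex s Hs))|exact (proj1 (Heq s Hs))]. }
  assert (B2 : Rabs (snd l) <= 2 * M / rho).
  { apply (Hcomp snd); [exact Rabs_snd_le|intros v w; reflexivity|].
    intros s Hs. split; [exact (proj2 (Hex s Hs))|exact (proj2 (Heq s Hs))]. }
  replace (4 * M / rho) with (2 * M / rho + 2 * M / rho) by (field; lra). lra.
Qed.

(** * Weights and radial integrals *)

Lemma Rpower_pos (x a : R) : 0 < Rpower x a.
Proof. apply exp_pos. Qed.

Lemma weight_pos (a : R) (z : Cx) : 0 < weight a z.
Proof. apply Rpower_pos. Qed.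

Lemma one_minus_sqr_pos (r : R) : -1 < r < 1 -> 0 < 1 - r ^ 2.
Proof. intros H. nra. Qed.

Lemma Rpower_le_1 (x a : R) : 0 <= a -> 0 < x <= 1 -> Rpower x a <= 1.
Proof.
  intros Ha Hx. replace 1 with (Rpower 1 a).
  - apply Rle_Rpower_l; lra.
  - unfold Rpower. rewrite ln_1, Rmult_0_r. apply exp_0.
Qed.

Lemma weight_le_1 (a : R) (z : Cx) : 0 <= a -> in_disk z -> weight a z <= 1.
Proof.
  intros Ha Hz. unfold in_disk in Hz. assert (H := Cmod_nonneg z).
  apply Rpower_le_1; [assumption|]. nra.
Qed.

Lemma weight_ge (a r : R) (z : Cx) :
  0 <= a -> 0 <= r < 1 -> Cmod z <= r -> Rpower (1 - r ^ 2) a <= weight a z.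
Proof.
  intros Ha Hr Hz. assert (H := Cmod_nonneg z). apply Rle_Rpower_l; [assumption|]. nra.
Qed.

(** The derivative of [L] is at most M / (1 - r^2) on the ball, so Re L is bounded there, and |g'| =
    exp (Re L). *)
Lemma log_Lipschitz_bounded (dg L : Cx -> Cx) :
  (forall z, in_disk z -> Cexp (L z) = dg z) -> in_Bloch L ->
  forall r, 0 <= r < 1 -> exists B, 0 <= B /\ forall z, Cmod z <= r -> Cmod (dg z) <= B.
Proof.
  intros HL [dL [Hd [M HM]]] r Hr.
  set (K := Rmax M 0 / (1 - r ^ 2)).
  assert (Hr2 : 0 < 1 - r ^ 2) by (apply one_minus_sqr_pos; lra).
  assert (HM0 := Rmax_r M 0). assert (HM1 := Rmax_l M 0).
  assert (HK : 0 <= K).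
  { apply Rmult_le_pos; [assumption|]. apply Rlt_le, Rinv_0_lt_compat; assumption. }
  assert (HLip := Lipschitz_ball L dL r K HK).
  exists (exp (Cmod (L C0) + K)). split; [apply Rlt_le, exp_pos|].
  intros z Hz. rewrite <- HL by (unfold in_disk; lra). rewrite Cmod_exp.
  assert (Hle : fst (L z) <= Cmod (L C0) + K).
  { eapply Rle_trans; [apply Rle_abs|]. eapply Rle_trans; [apply Rabs_fst_le|].
    eapply Rle_trans; [apply (Cmod_le_sub _ (L C0))|]. apply Rplus_le_compat_l.
    eapply Rle_trans; [apply HLip|].
    - intros w Hw. apply Hd. unfold in_disk; lra.
    - intros w Hw. assert (Hw0 := Cmod_nonneg w). assert (Hm := HM w ltac:(unfold in_disk; lra)).
      unfold K. apply (Rmult_le_reg_r (1 - r ^ 2)); [assumption|].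
      unfold Rdiv. rewrite Rmult_assoc, Rinv_l, Rmult_1_r by lra.
      assert (Hn := Cmod_nonneg (dL w)).
      assert (Cmod (dL w) * (1 - r ^ 2) <= (1 - Cmod w ^ 2) * Cmod (dL w)).
      { rewrite Rmult_comm. apply Rmult_le_compat_r; [assumption|]. nra. }
      lra.
    - rewrite Cmod_C0; lra.
    - assumption.
    - replace (Csub z C0) with z by ring. nra. }
  destruct Hle as [Hle| ->]; [left; apply exp_increasing; assumption|lra].
Qed.

Definition radial_density (dg : Cx -> Cx) (alpha theta r : R) : R :=
  Cmod (dg (polar r theta)) / Rpower (1 - r ^ 2) alpha.

Lemma radial_density_nonneg (dg : Cx -> Cx) (alpha theta r : R) :
  0 <= radial_density dg alpha theta r.
Proof.
  apply Rmult_le_pos; [apply Cmod_nonneg|]. apply Rlt_le, Rinv_0_lt_compat, Rpower_pos.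
Qed.

Lemma radial_density_continuous (dg : Cx -> Cx) (alpha theta r : R) :
  analytic_on_disk dg -> -1 < r < 1 -> continuous (radial_density dg alpha theta) r.
Proof.
  intros Hdg Hr. unfold radial_density, Rdiv.
  apply (continuous_mult (K := R_AbsRing)).
  - apply continuous_of_small. intros eps He.
    destruct (Cdiff_cont dg (polar r theta) eps) as [d [Hd Hh]]; [|assumption|].
    { apply Hdg. unfold in_disk. rewrite Cmod_polar. apply Rabs_def1; lra. }
    exists d; split; [assumption|]. intros h Hlt.
    specialize (Hh (polar h theta)). rewrite Cmod_polar in Hh. specialize (Hh Hlt).
    replace (Cadd (polar r theta) (polar h theta)) with (polar (r + h) theta) in Hh
      by (apply injective_projections; simpl; ring).
    eapply Rle_trans; [|exact Hh]. apply Rabs_le_between.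
    assert (T1 := Cmod_le_sub (dg (polar (r + h) theta)) (dg (polar r theta))).
    assert (T2 := Cmod_le_sub (dg (polar r theta)) (dg (polar (r + h) theta))).
    rewrite Cmod_sub_sym in T2. lra.
  - apply (ex_derive_continuous (V := R_NormedModule)). unfold Rpower.
    auto_derive. assert (H := one_minus_sqr_pos r Hr). simpl in H. split; [lra|].
    split; [|exact I]. apply Rgt_not_eq, exp_pos.
Qed.

Lemma Defs_RInt_eq (f : R -> R) (a b : R) : ex_RInt f a b -> Defs.RInt f a b = RInt f a b.
Proof.
  intros H. unfold Defs.RInt.
  destruct (excluded_middle_informative _) as [E|E].
  - symmetry. apply RInt_Reals.
  - exfalso. apply E. exists (ex_RInt_Reals_0 _ _ _ H). exact I.
Qed.

(** Turns comparisons of integrals into comparisons of derivatives. Continuity on a strictly larger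
    open interval yields two-sided derivatives at [a] and [b]. *)
Lemma Defs_RInt_antiderivative (k : R -> R) (lo hi a b : R) :
  (forall x, lo < x < hi -> continuous k x) -> lo < a -> a <= b -> b < hi ->
  exists K : R -> R, (forall x, a <= x <= b -> derivable_pt_lim K x (k x)) /\
    Defs.RInt k a b = K b - K a.
Proof.
  intros Hk Ha Hab Hb.
  assert (Hex : forall x, lo < x < hi -> ex_RInt k a x).
  { intros x Hx. apply (ex_RInt_continuous (V := R_CompleteNormedModule)). intros t Ht.
    apply Hk. unfold Rmin, Rmax in Ht. destruct (Rle_dec a x); lra. }
  exists (fun x => RInt k a x). split.
  - intros x Hx. apply is_derive_Reals.
    apply (is_derive_RInt (V := R_NormedModule) k (fun x => RInt k a x) a x).
    + assert (Hd : 0 < Rmin (x - lo) (hi - x)) by (apply Rmin_glb_lt; lra).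
      exists (mkposreal _ Hd). intros y Hy. simpl in Hy.
      apply (RInt_correct (V := R_CompleteNormedModule)). apply Hex.
      unfold ball in Hy; simpl in Hy. unfold AbsRing_ball, abs, minus, plus, opp in Hy; simpl in Hy.
      apply Rabs_def2 in Hy.
      assert (M1 := Rmin_l (x - lo) (hi - x)). assert (M2 := Rmin_r (x - lo) (hi - x)). lra.
    + apply Hk. lra.
  - rewrite Defs_RInt_eq by (apply Hex; lra).
    rewrite (RInt_point (V := R_CompleteNormedModule)). symmetry. apply Rminus_0_r.
Qed.

Lemma polar_line (r theta : R) : Cadd C0 (Cmul (RtoCx r) (cos theta, sin theta)) = polar r theta.
Proof. apply injective_projections; simpl; ring. Qed.

Lemma derivable_radial (h : Cx -> Cx) (c l : Cx) (theta r : R) :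
  Cderiv h (polar r theta) l ->
  derivable_pt_lim (fun s => Cre (Cmul c (h (polar s theta)))) r
    (Cre (Cmul c (Cmul l (cos theta, sin theta)))).
Proof.
  intros H. assert (D := derivable_along h c C0 (cos theta, sin theta) l r).
  rewrite polar_line in D. specialize (D H).
  intros eps He. destruct (D eps He) as [d Hd]. exists d. intros s Hs0 Hs.
  specialize (Hd s Hs0 Hs). rewrite !polar_line in Hd. exact Hd.
Qed.

Lemma derivable_increment_le (u v du dv : R -> R) (a b : R) :
  a <= b -> (forall x, a <= x <= b -> derivable_pt_lim u x (du x)) ->
  (forall x, a <= x <= b -> derivable_pt_lim v x (dv x)) ->
  (forall x, a <= x <= b -> du x <= dv x) -> u b - u a <= v b - v a.
Proof.
  intros [Hab| ->] Hu Hv Hle; [|lra].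
  destruct (MVT_cor2 (fun x => v x - u x) (fun x => dv x - du x) a b Hab) as [c [E Hc]].
  - intros x Hx. apply derivable_pt_lim_minus; [apply Hv|apply Hu]; assumption.
  - specialize (Hle c ltac:(lra)). nra.
Qed.

(** Along the radius |h'| = |f g'| is at most [M] times the radial density; integrate. *)
Lemma radial_increment_le (alpha : R) (dg f h : Cx -> Cx) (M theta t1 t2 : R) :
  analytic_on_disk dg -> 0 <= M ->
  (forall z, in_disk z -> weight alpha z * Cmod (f z) <= M) ->
  (forall z, in_disk z -> Cderiv h z (Cmul (f z) (dg z))) ->
  0 <= t2 -> t2 <= t1 -> t1 < 1 ->
  Cmod (Csub (h (polar t1 theta)) (h (polar t2 theta)))
    <= M * Defs.RInt (radial_density dg alpha theta) t2 t1.
Proof.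
  intros Hdg HM Hf Hh H0 H12 H1.
  destruct (Defs_RInt_antiderivative (radial_density dg alpha theta) (-1) 1 t2 t1)
    as [K [HK EK]]; [|lra|lra|lra|].
  { intros x Hx. apply radial_density_continuous; assumption. }
  rewrite EK.
  assert (HKpos : 0 <= K t1 - K t2).
  { replace 0 with (0 - 0) by ring.
    apply (derivable_increment_le (fun _ => 0) K (fun _ => 0) (radial_density dg alpha theta));
      [assumption|intros; apply derivable_pt_lim_const|exact HK|].
    intros; apply radial_density_nonneg. }
  apply Cmod_le_of_re; [apply Rmult_le_pos; assumption|].
  intros c.
  replace (Cre (Cmul c (Csub (h (polar t1 theta)) (h (polar t2 theta))))) with
    (Cre (Cmul c (h (polar t1 theta))) - Cre (Cmul c (h (polar t2 theta))))
    by (unfold Cre; simpl; ring).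
  replace (Cmod c * (M * (K t1 - K t2))) with (Cmod c * M * K t1 - Cmod c * M * K t2) by ring.
  apply (derivable_increment_le (fun s => Cre (Cmul c (h (polar s theta))))
    (fun s => Cmod c * M * K s)
    (fun s => Cre (Cmul c (Cmul (Cmul (f (polar s theta)) (dg (polar s theta)))
      (cos theta, sin theta))))
    (fun s => Cmod c * M * radial_density dg alpha theta s)); [assumption| | |].
  - intros x Hx. apply derivable_radial, Hh. unfold in_disk.
    rewrite Cmod_polar, Rabs_pos_eq; lra.
  - intros x Hx. apply (derivable_pt_lim_scal K), HK, Hx.
  - intros x Hx. eapply Rle_trans; [apply Rle_abs|].
    eapply Rle_trans; [apply Rabs_fst_le|].
    rewrite !Cmod_mul, Cmod_unit, Rmult_1_r, Rmult_assoc.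
    apply Rmult_le_compat_l; [apply Cmod_nonneg|].
    unfold radial_density, Rdiv. rewrite (Rmult_comm (Cmod (dg _))), <- Rmult_assoc.
    apply Rmult_le_compat_r; [apply Cmod_nonneg|].
    assert (B := Hf (polar x theta)). unfold in_disk, weight in B.
    rewrite Cmod_polar, Rabs_pos_eq in B by lra. specialize (B ltac:(lra)).
    assert (Hp := Rpower_pos (1 - x ^ 2) alpha).
    apply (Rmult_le_reg_l (Rpower (1 - x ^ 2) alpha)); [assumption|].
    eapply Rle_trans; [exact B|]. right. field. lra.
Qed.

(** The point is uniformity: [r0] depends on [eps] alone, so the same smaller disk serves all
    members of a bounded family and their differences. *)
Lemma radial_condition_tail (alpha beta : R) (dg : Cx -> Cx) :
  0 <= beta -> analytic_on_disk dg -> radial_condition dg alpha beta ->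
  forall eps, 0 < eps -> exists r0, 0 <= r0 < 1 /\
    forall (f h : Cx -> Cx) (M D : R), 0 <= M -> 0 <= D ->
      (forall z, in_disk z -> weight alpha z * Cmod (f z) <= M) ->
      (forall z, in_disk z -> Cderiv h z (Cmul (f z) (dg z))) ->
      (forall z, Cmod z <= r0 -> Cmod (h z) <= D) ->
      forall z, in_disk z -> weight beta z * Cmod (h z) <= D + M * eps.
Proof.
  intros Hbeta Hdg HR eps He. destruct (HR eps He) as [a [Ha Hat]].
  (* The midpoint of [a] and 1, raised to 1/2 because [a] may be negative and the radii must not
     be. *)
  set (t2 := Rmax ((a + 1) / 2) (1 / 2)).
  assert (Ht2 : a < t2 < 1 /\ 1 / 2 <= t2).
  { unfold t2, Rmax. destruct (Rle_dec ((a + 1) / 2) (1 / 2)); lra. }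
  destruct (Hat t2 ltac:(tauto)) as [b [Hb Hbt]].
  exists (Rmax t2 b).
  assert (M1 := Rmax_l t2 b). assert (M2 := Rmax_r t2 b).
  split; [split; [lra|apply Rmax_lub_lt; lra]|].
  intros f h M D HM HD Hf Hh Hsmall z Hz.
  assert (Hw1 := weight_le_1 beta z Hbeta Hz). assert (Hw0 := weight_pos beta z).
  assert (Hme := Rmult_le_pos _ _ HM (Rlt_le _ _ He)).
  destruct (Rle_dec (Cmod z) (Rmax t2 b)) as [Hle|Hgt].
  - specialize (Hsmall z Hle). assert (H := Cmod_nonneg (h z)). nra.
  - destruct (polar_surj z) as [theta [Hth Ez]]. unfold in_disk in Hz.
    assert (Hq := Hbt (Cmod z) ltac:(lra) theta Hth).
    assert (Hi := radial_increment_le alpha dg f h M theta (Cmod z) t2 Hdg HM Hf Hh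
      ltac:(lra) ltac:(lra) Hz).
    rewrite <- Ez in Hi.
    assert (Hs := Hsmall (polar t2 theta)). rewrite Cmod_polar, Rabs_pos_eq in Hs by lra.
    specialize (Hs M1). assert (T := Cmod_le_sub (h z) (h (polar t2 theta))).
    unfold radial_quantity in Hq. fold (weight beta z) in Hq.
    fold (radial_density dg alpha theta) in Hq.
    set (J := Defs.RInt (radial_density dg alpha theta) t2 (Cmod z)) in *.
    apply Rle_trans with (weight beta z * (D + M * J)).
    + apply Rmult_le_compat_l; lra.
    + replace (weight beta z * (D + M * J)) with
        (weight beta z * D + M * (weight beta z * J)) by ring.
      apply Rplus_le_compat; [nra|]. apply Rmult_le_compat_l; assumption.
Qed.

(** * Extraction of convergent subsequences *)

Definition infinite (A : nat -> Prop) : Prop := forall N, exists n, (N <= n)%nat /\ A n.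

Lemma infinite_split (A P : nat -> Prop) :
  infinite A -> infinite (fun n => A n /\ P n) \/ infinite (fun n => A n /\ ~ P n).
Proof.
  intros HA. destruct (classic (infinite (fun n => A n /\ P n))) as [H|H]; [left; assumption|].
  right. apply not_all_ex_not in H. destruct H as [N0 HN0]. intros N.
  destruct (HA (Nat.max N N0)) as [n [Hn An]]. exists n. split; [lia|]. split; [assumption|].
  intros Pn. apply HN0. exists n. split; [lia|tauto].
Qed.

(** Pigeonhole by peeling: either infinitely many values lie in the leftmost cell of length [eps],
    or infinitely many lie beyond it, where one cell fewer remains. *)
Lemma infinite_subset_R (A : nat -> Prop) (a : nat -> R) (B eps : R) :
  infinite A -> (forall n, A n -> Rabs (a n) <= B) -> 0 < eps ->
  exists A', infinite A' /\ (forall n, A' n -> A n) /\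
    forall n m, A' n -> A' m -> Rabs (a n - a m) <= eps.
Proof.
  intros HA HB He.
  assert (G : forall k A l, infinite A -> (forall n, A n -> l <= a n <= l + INR k * eps) ->
    exists A', infinite A' /\ (forall n, A' n -> A n) /\
      forall n m, A' n -> A' m -> Rabs (a n - a m) <= eps).
  { clear A HA HB. induction k as [|k IH]; intros A l HA Hl.
    - exists A. split; [assumption|]. split; [auto|]. intros n m Hn Hm.
      assert (H1 := Hl n Hn). assert (H2 := Hl m Hm). simpl in H1, H2.
      apply Rabs_le_between. lra.
    - destruct (infinite_split A (fun n => a n <= l + eps) HA) as [H|H].
      + eexists; split; [exact H|]. split; [tauto|]. intros n m [Hn1 Hn2] [Hm1 Hm2].
        assert (H1 := Hl n Hn1). assert (H2 := Hl m Hm1). apply Rabs_le_between. lra.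
      + destruct (IH _ (l + eps) H) as [A' [H1 [H2 H3]]].
        * intros n [Hn1 Hn2]. assert (Hn := Hl n Hn1). rewrite S_INR in Hn. lra.
        * exists A'. split; [assumption|]. split; [|assumption]. intros n Hn. apply H2, Hn. }
  destruct (nfloor_ex (2 * Rabs B / eps)) as [k Hk].
  { apply Rmult_le_pos; [|apply Rlt_le, Rinv_0_lt_compat, He].
    assert (H := Rabs_pos B); lra. }
  apply (G (S k) A (- Rabs B) HA). intros n Hn. specialize (HB n Hn).
  apply Rabs_le_between in HB. assert (Hab := Rle_abs B). rewrite S_INR.
  destruct Hk as [_ Hk]. apply (Rmult_lt_compat_r eps) in Hk; [|assumption].
  replace (2 * Rabs B / eps * eps) with (2 * Rabs B) in Hk by (field; lra). lra.
Qed.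

Lemma infinite_subset_Cx (A : nat -> Prop) (a : nat -> Cx) (B eps : R) :
  infinite A -> (forall n, A n -> Cmod (a n) <= B) -> 0 < eps ->
  exists A', infinite A' /\ (forall n, A' n -> A n) /\
    forall n m, A' n -> A' m -> Cmod (Csub (a n) (a m)) <= eps.
Proof.
  intros HA HB He.
  destruct (infinite_subset_R A (fun n => fst (a n)) B (eps / 2) HA) as [A1 [I1 [S1 E1]]]; [|lra|].
  { intros n Hn. eapply Rle_trans; [apply Rabs_fst_le|]. auto. }
  destruct (infinite_subset_R A1 (fun n => snd (a n)) B (eps / 2) I1) as [A2 [I2 [S2 E2]]]; [|lra|].
  { intros n Hn. eapply Rle_trans; [apply Rabs_snd_le|]. auto. }
  exists A2. split; [assumption|]. split; [auto|]. intros n m Hn Hm.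
  eapply Rle_trans; [apply Cmod_le_abs|]. simpl.
  assert (G1 := E1 n m (S2 n Hn) (S2 m Hm)). assert (G2 := E2 n m Hn Hm). lra.
Qed.

Lemma infinite_subset_list (pts : list Cx) (A : nat -> Prop) (a : nat -> Cx -> Cx) (B eps : R) :
  infinite A -> (forall n p, A n -> In p pts -> Cmod (a n p) <= B) -> 0 < eps ->
  exists A', infinite A' /\ (forall n, A' n -> A n) /\
    forall n m p, A' n -> A' m -> In p pts -> Cmod (Csub (a n p) (a m p)) <= eps.
Proof.
  revert A. induction pts as [|q pts IH]; intros A HA HB He.
  - exists A. split; [assumption|]. split; [auto|]. intros n m p _ _ [].
  - destruct (infinite_subset_Cx A (fun n => a n q) B eps HA) as [A1 [I1 [S1 E1]]]; [|assumption|].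
    { intros n Hn. apply HB; [assumption|left; reflexivity]. }
    destruct (IH A1 I1) as [A2 [I2 [S2 E2]]]; [|assumption|].
    { intros n p Hn Hp. apply HB; [auto|right; assumption]. }
    exists A2. split; [assumption|]. split; [auto|].
    intros n m p Hn Hm [<-|Hp]; [apply E1; auto|apply E2; assumption].
Qed.

(* Grid points are taken by rounding each coordinate towards 0, so they stay in the ball. *)
Lemma finite_net (d : R) : 0 < d -> exists pts : list Cx,
  forall z, Cmod z <= 1 -> exists p, In p pts /\ Cmod p <= Cmod z /\ Cmod (Csub z p) <= d.
Proof.
  intros Hd. set (e := d / 2). assert (He : 0 < e) by (unfold e; lra).
  destruct (nfloor_ex (1 / e)) as [N HN].
  { apply Rlt_le, Rdiv_lt_0_compat; lra. }
  set (vals := map (fun n => INR n * e) (seq 0 (S N)) ++ map (fun n => - (INR n * e)) (seq 0 (S N))).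
  assert (Hv : forall x, Rabs x <= 1 -> exists v, In v vals /\ Rabs v <= Rabs x /\ Rabs (x - v) <= e).
  { intros x Hx. destruct (nfloor_ex (Rabs x / e)) as [n Hn].
    { apply Rmult_le_pos; [apply Rabs_pos|apply Rlt_le, Rinv_0_lt_compat, He]. }
    assert (Hne : INR n * e <= Rabs x < INR n * e + e).
    { destruct Hn as [H1 H2]. apply (Rmult_le_compat_r e) in H1; [|lra].
      apply (Rmult_lt_compat_r e) in H2; [|lra].
      replace (Rabs x / e * e) with (Rabs x) in H1, H2 by (field; lra). lra. }
    assert (Hin : In n (seq 0 (S N))).
    { apply in_seq. split; [lia|]. simpl.
      assert (INR n < INR (S N)).
      { rewrite S_INR. apply Rle_lt_trans with (1 / e); [|lra].
        eapply Rle_trans; [apply Hn|]. unfold Rdiv. apply Rmult_le_compat_r; [|assumption].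
        apply Rlt_le, Rinv_0_lt_compat, He. }
      apply INR_lt in H. lia. }
    assert (Hp : 0 <= INR n * e) by (apply Rmult_le_pos; [apply pos_INR|lra]).
    destruct (Rle_dec 0 x) as [H0|H0].
    - exists (INR n * e). split; [|split].
      + apply in_or_app. left. apply (in_map (fun n => INR n * e)), Hin.
      + rewrite (Rabs_pos_eq (INR n * e)) by assumption. lra.
      + rewrite (Rabs_pos_eq x) in Hne by assumption. apply Rabs_le_between. lra.
    - exists (- (INR n * e)). split; [|split].
      + apply in_or_app. right. apply (in_map (fun n => - (INR n * e))), Hin.
      + rewrite Rabs_Ropp, (Rabs_pos_eq (INR n * e)) by assumption. lra.
      + rewrite (Rabs_left x) in Hne by lra. apply Rabs_le_between. lra. }
  exists (list_prod vals vals). intros z Hz.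
  destruct (Hv (fst z)) as [v [V1 [V2 V3]]]; [eapply Rle_trans; [apply Rabs_fst_le|assumption]|].
  destruct (Hv (snd z)) as [w [W1 [W2 W3]]]; [eapply Rle_trans; [apply Rabs_snd_le|assumption]|].
  exists (v, w). split; [apply in_prod; assumption|]. split.
  - apply sqrt_le_1_alt. simpl.
    assert (T : forall s t, Rabs s <= Rabs t -> s * s <= t * t).
    { intros s t H. apply Rsqr_le_abs_1 in H. exact H. }
    apply Rplus_le_compat; apply T; assumption.
  - eapply Rle_trans; [apply Cmod_le_abs|]. simpl. unfold e in *. lra.
Qed.

(** One step of Arzela-Ascoli: the values are made close on a finite net, and the common Lipschitz
    constant carries this to the whole ball. *)
Lemma infinite_subset_Lipschitz (A : nat -> Prop) (h : nat -> Cx -> Cx) (r B eps : R) :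
  infinite A -> 0 <= r <= 1 -> 0 <= B -> (forall n, h n C0 = C0) ->
  (forall n z w, Cmod z <= r -> Cmod w <= r -> Cmod (Csub (h n w) (h n z)) <= B * Cmod (Csub w z)) ->
  0 < eps ->
  exists A', infinite A' /\ (forall n, A' n -> A n) /\
    forall n m z, A' n -> A' m -> Cmod z <= r -> Cmod (Csub (h n z) (h m z)) <= eps.
Proof.
  intros HA Hr HB H0 HL He.
  destruct (finite_net (eps / (4 * (B + 1)))) as [pts Hpts]; [apply Rdiv_lt_0_compat; lra|].
  (* The net covers the unit ball; at its points outside the ball of radius [r] the value is
     replaced by 0. A point [z] only uses a net point of modulus at most |z|, which is inside. *)
  destruct (infinite_subset_list pts A
    (fun n p => if Rle_dec (Cmod p) r then h n p else C0) B (eps / 2) HA) as [A' [I' [S' E']]];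
    [|lra|].
  { intros n p _ _. destruct (Rle_dec (Cmod p) r) as [Hp|]; [|rewrite Cmod_C0; assumption].
    assert (G := HL n C0 p ltac:(rewrite Cmod_C0; lra) Hp). rewrite H0 in G.
    replace (Csub (h n p) C0) with (h n p) in G by ring.
    replace (Csub p C0) with p in G by ring. nra. }
  exists A'. split; [assumption|]. split; [assumption|].
  intros n m z Hn Hm Hz.
  destruct (Hpts z ltac:(lra)) as [p [P1 [P2 P3]]].
  assert (Hp : Cmod p <= r) by lra.
  specialize (E' n m p Hn Hm P1). destruct (Rle_dec (Cmod p) r); [|lra].
  assert (G1 := HL n p z Hp Hz). assert (G2 := HL m z p Hz Hp).
  rewrite (Cmod_sub_sym p z) in G2.
  assert (Hbd : B * Cmod (Csub z p) <= eps / 4).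
  { apply Rle_trans with ((B + 1) * (eps / (4 * (B + 1)))).
    - apply Rmult_le_compat; try lra. apply Cmod_nonneg.
    - right; field; lra. }
  assert (T1 := Cmod_sub_triangle (h n z) (h n p) (h m z)).
  assert (T2 := Cmod_sub_triangle (h n p) (h m p) (h m z)). lra.
Qed.

(** Diagonal extraction. A stage consists of an infinite set, on which [E] holds at tolerance
    1/(k+1), together with a selected element; the sets decrease and the selected elements
    increase. *)
Lemma Cauchy_subsequence (E : R -> nat -> nat -> Prop) :
  (forall A eps, infinite A -> 0 < eps -> exists A', infinite A' /\ (forall n, A' n -> A n) /\
    forall n m, A' n -> A' m -> E eps n m) ->
  exists phi : nat -> nat, (forall n, (phi n < phi (S n))%nat) /\
    forall k i j, (k <= i)%nat -> (k <= j)%nat -> E (/ (INR k + 1)) (phi i) (phi j).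
Proof.
  intros HE.
  assert (Hk : forall k, 0 < / (INR k + 1)).
  { intros k. apply Rinv_0_lt_compat. assert (H := pos_INR k). lra. }
  set (I := fun k (z : (nat -> Prop) * nat) => infinite (fst z) /\ fst z (snd z) /\
    forall n m, fst z n -> fst z m -> E (/ (INR k + 1)) n m).
  destruct (HE (fun _ => True) (/ (INR 0 + 1))) as [A0 [I0 [_ E0]]];
    [intros N; exists N; auto|apply Hk|].
  destruct (I0 0%nat) as [n0 [_ Hn0]].
  destruct (dependent_choice _ I
    (fun k z z' => (forall n, fst z' n -> fst z n) /\ (snd z < snd z')%nat) (A0, n0))
    as [s [_ Hs]].
  - split; [|split]; assumption.
  - intros k [A n] [IA [An EA]]. simpl fst in *; simpl snd in *.
    destruct (HE A (/ (INR (S k) + 1)) IA (Hk (S k))) as [A' [I' [S' E']]].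
    destruct (I' (S n)) as [n' [Hn' An']].
    exists (A', n'). unfold I; simpl fst; simpl snd. repeat split; auto.
  - exists (fun k => snd (s k)). split; [intros n; apply Hs|].
    assert (Hsub : forall k i, (k <= i)%nat -> forall n, fst (s i) n -> fst (s k) n).
    { intros k i Hki. induction Hki as [|i Hki IH]; [auto|]. intros n Hn.
      apply IH. apply Hs, Hn. }
    intros k i j Hi Hj. destruct (Hs k) as [[_ [_ H]] _]. apply H.
    + apply (Hsub k i Hi). exact (proj1 (proj2 (proj1 (Hs i)))).
    + apply (Hsub k j Hj). exact (proj1 (proj2 (proj1 (Hs j)))).
Qed.

(** * Limits of sequences of analytic functions *)

Lemma Cauchy_limit (a : nat -> Cx) :
  (forall eps, 0 < eps -> exists N, forall i j, (N <= i)%nat -> (N <= j)%nat ->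
    Cmod (Csub (a i) (a j)) <= eps) ->
  exists l, forall eps, 0 < eps -> exists N, forall i, (N <= i)%nat -> Cmod (Csub (a i) l) <= eps.
Proof.
  intros H.
  destruct (Rcomplete.R_complete (fun n => fst (a n))) as [x Hx].
  { intros eps He. destruct (H (eps / 2)) as [N HN]; [lra|]. exists N. intros i j Hi Hj.
    unfold R_dist. eapply Rle_lt_trans; [apply (Rabs_fst_le (Csub (a i) (a j)))|].
    specialize (HN i j Hi Hj). lra. }
  destruct (Rcomplete.R_complete (fun n => snd (a n))) as [y Hy].
  { intros eps He. destruct (H (eps / 2)) as [N HN]; [lra|]. exists N. intros i j Hi Hj.
    unfold R_dist. eapply Rle_lt_trans; [apply (Rabs_snd_le (Csub (a i) (a j)))|].
    specialize (HN i j Hi Hj). lra. }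
  exists (x, y). intros eps He.
  destruct (Hx (eps / 2)) as [N1 H1]; [lra|]. destruct (Hy (eps / 2)) as [N2 H2]; [lra|].
  exists (Nat.max N1 N2). intros i Hi. specialize (H1 i ltac:(lia)). specialize (H2 i ltac:(lia)).
  unfold R_dist in *. eapply Rle_trans; [apply Cmod_le_abs|]. simpl. lra.
Qed.

Lemma Cmod_sub_limit_le (a : nat -> Cx) (l c : Cx) (m : R) (N : nat) :
  (forall eps, 0 < eps -> exists N, forall i, (N <= i)%nat -> Cmod (Csub (a i) l) <= eps) ->
  (forall i, (N <= i)%nat -> Cmod (Csub c (a i)) <= m) -> Cmod (Csub c l) <= m.
Proof.
  intros Hl Hm. apply le_epsilon. intros eps He. destruct (Hl eps He) as [N' HN'].
  assert (T := Cmod_sub_triangle c (a (Nat.max N N')) l).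
  specialize (Hm (Nat.max N N') ltac:(lia)). specialize (HN' (Nat.max N N') ltac:(lia)). lra.
Qed.

Lemma Cderiv_shift (h : Cx -> Cx) (z w l : Cx) :
  Cderiv h (Cadd z w) l -> Cderiv (fun v => h (Cadd z v)) w l.
Proof.
  intros H eps He. destruct (H eps He) as [d [Hd Hh]]. exists d. split; [assumption|].
  intros k Hk. specialize (Hh k Hk).
  replace (Cadd z (Cadd w k)) with (Cadd (Cadd z w) k) by ring. exact Hh.
Qed.

(** Cauchy's estimate applied to h_i - h_j shows that the derivatives are uniformly Cauchy on half
    the radius; the limit of the derivatives at [z] is the derivative of [H]. *)
Lemma Weierstrass_convergence (h dh : nat -> Cx -> Cx) (H : Cx -> Cx) (z : Cx) (rho : R) :
  0 < rho -> (forall n k, Cmod k <= rho -> Cderiv (h n) (Cadd z k) (dh n (Cadd z k))) ->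
  (forall eps, 0 < eps -> exists N, forall i j k, (N <= i)%nat -> (N <= j)%nat ->
    Cmod k <= rho -> Cmod (Csub (h i (Cadd z k)) (h j (Cadd z k))) <= eps) ->
  (forall k, Cmod k <= rho -> forall eps, 0 < eps -> exists N, forall i, (N <= i)%nat ->
    Cmod (Csub (h i (Cadd z k)) (H (Cadd z k))) <= eps) ->
  Cdiff H z.
Proof.
  intros Hrho Hd Hc Hl.
  assert (Hdc : forall eps, 0 < eps -> exists N, forall i j k, (N <= i)%nat -> (N <= j)%nat ->
    Cmod k <= rho / 2 -> Cmod (Csub (dh i (Cadd z k)) (dh j (Cadd z k))) <= eps).
  (* The radius left around z + k is rho / 2, and 4 (eps rho / 8) / (rho / 2) = eps. *)
  { intros eps He. destruct (Hc (eps * rho / 8)) as [N HN].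
    { apply Rdiv_lt_0_compat; [|lra]. apply Rmult_lt_0_compat; assumption. }
    exists N. intros i j k Hi Hj Hk.
    assert (Hin : forall k', Cmod k' <= rho / 2 -> Cmod (Cadd k k') <= rho)
      by (intros k' Hk'; assert (T := Cmod_add k k'); lra).
    assert (Ea : forall k', Cadd (Cadd z k) k' = Cadd z (Cadd k k')) by (intros; ring).
    assert (G := Cauchy_estimate (fun w => Csub (h i w) (h j w)) (Cadd z k)
      (Csub (dh i (Cadd z k)) (dh j (Cadd z k))) (rho / 2) (eps * rho / 8)).
    replace (4 * (eps * rho / 8) / (rho / 2)) with eps in G by (field; lra).
    apply G; [lra| | |].
    - intros k' Hk'. rewrite Ea. eexists. apply Cderiv_sub; apply Hd, Hin, Hk'.
    - intros k' Hk'. rewrite Ea. apply HN; auto.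
    - apply Cderiv_sub; apply Hd; lra. }
  assert (E0 : Cadd z C0 = z) by ring.
  destruct (Cauchy_limit (fun n => dh n z)) as [l Hlim].
  { intros eps He. destruct (Hdc eps He) as [N HN]. exists N. intros i j Hi Hj.
    specialize (HN i j C0 Hi Hj). rewrite Cmod_C0, E0 in HN. apply HN; lra. }
  exists l. intros eps He.
  destruct (Hdc (eps / 3)) as [N1 HN1]; [lra|].
  destruct (Hlim (eps / 3)) as [N2 HN2]; [lra|].
  set (N := Nat.max N1 N2).
  assert (HdN := Hd N C0). rewrite E0, Cmod_C0 in HdN. specialize (HdN ltac:(lra)).
  destruct (HdN (eps / 3)) as [d [Hd0 Hdd]]; [lra|].
  exists (Rmin d (rho / 2)). split; [apply Rmin_glb_lt; lra|].
  intros k Hk. assert (Hk1 := Rlt_le_trans _ _ _ Hk (Rmin_l _ _)).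
  assert (Hk2 := Rlt_le_trans _ _ _ Hk (Rmin_r _ _)).
  specialize (Hdd k Hk1).
  (* For large [i] the derivative of h_N - h_i is at most eps / 3, hence so is its Lipschitz
     constant; this bound survives the limit in [i], which puts [H] in place of h_i. *)
  assert (Hdiff : Cmod (Csub (Csub (h N (Cadd z k)) (h N z)) (Csub (H (Cadd z k)) (H z)))
    <= eps / 3 * Cmod k).
  { apply (Cmod_sub_limit_le (fun i => Csub (h i (Cadd z k)) (h i z)) _ _ _ N).
    - intros e Hpe. destruct (Hl k ltac:(lra) (e / 2)) as [M1 HM1]; [lra|].
      destruct (Hl C0 ltac:(rewrite Cmod_C0; lra) (e / 2)) as [M2 HM2]; [lra|].
      rewrite E0 in HM2. exists (Nat.max M1 M2). intros i Hi.
      specialize (HM1 i ltac:(lia)). specialize (HM2 i ltac:(lia)).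
      replace (Csub (Csub (h i (Cadd z k)) (h i z)) (Csub (H (Cadd z k)) (H z))) with
        (Csub (Csub (h i (Cadd z k)) (H (Cadd z k))) (Csub (h i z) (H z))) by ring.
      eapply Rle_trans; [apply Cmod_sub|]. lra.
    - intros i Hi.
      assert (G := Lipschitz_ball (fun w => Csub (h N (Cadd z w)) (h i (Cadd z w)))
        (fun w => Csub (dh N (Cadd z w)) (dh i (Cadd z w))) (rho / 2) (eps / 3) ltac:(lra)).
      specialize (G ltac:(intros w Hw; apply (Cderiv_sub (fun w => h N (Cadd z w))
        (fun w => h i (Cadd z w))); apply Cderiv_shift, Hd; lra)).
      specialize (G ltac:(intros w Hw; apply HN1; [unfold N; lia|unfold N in Hi; lia|lra])).
      specialize (G C0 k ltac:(rewrite Cmod_C0; lra) ltac:(lra)). cbv beta in G. rewrite E0 in G.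
      replace (Csub k C0) with k in G by ring.
      replace (Csub (Csub (h N (Cadd z k)) (h N z)) (Csub (h i (Cadd z k)) (h i z))) with
        (Csub (Csub (h N (Cadd z k)) (h i (Cadd z k))) (Csub (h N z) (h i z))) by ring.
      exact G. }
  specialize (HN2 N ltac:(unfold N; lia)).
  assert (Hk0 := Cmod_nonneg k).
  set (u := Csub (Csub (h N (Cadd z k)) (h N z)) (Csub (H (Cadd z k)) (H z))) in *.
  set (v := Csub (Csub (h N (Cadd z k)) (h N z)) (Cmul (dh N z) k)) in *.
  set (w := Csub (dh N z) l) in *.
  replace (Csub (Csub (H (Cadd z k)) (H z)) (Cmul l k)) with
    (Cadd (Csub v u) (Cmul w k)) by (unfold u, v, w; ring).
  eapply Rle_trans; [apply Cmod_add|]. rewrite Cmod_mul.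
  assert (T := Cmod_sub v u). nra.
Qed.

(** * Sufficiency of the radial condition *)

Theorem radial_condition_compact (alpha beta : R) (dg L : Cx -> Cx) :
  0 <= alpha -> 0 <= beta -> analytic_on_disk dg ->
  (forall z, in_disk z -> Cexp (L z) = dg z) -> in_Bloch L ->
  radial_condition dg alpha beta -> Tg_compact dg alpha beta.
Proof.
  intros Ha Hb Hdg HL HB HR.
  assert (Htail := radial_condition_tail alpha beta dg Hb Hdg HR).
  (* The constant is chosen before [f] and [h]: on |z| <= r both |f| and |g'| are bounded in terms
     of [M] and [r] only. *)
  assert (HLip : forall M r, 0 <= M -> 0 <= r < 1 -> exists B, 0 <= B /\ forall f h,
    (forall z, in_disk z -> weight alpha z * Cmod (f z) <= M) -> is_Tg dg f h ->
    forall z w, Cmod z <= r -> Cmod w <= r -> Cmod (Csub (h w) (h z)) <= B * Cmod (Csub w z)).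
  { intros M r HM Hr. destruct (log_Lipschitz_bounded dg L HL HB r Hr) as [G [HG HGb]].
    set (wr := Rpower (1 - r ^ 2) alpha). assert (Hwr : 0 < wr) by apply Rpower_pos.
    assert (Hq : 0 <= M / wr) by (apply Rmult_le_pos; [assumption|apply Rlt_le, Rinv_0_lt_compat, Hwr]).
    exists (M / wr * G). split; [apply Rmult_le_pos; assumption|].
    intros f h Hf [_ Hh].
    apply (Lipschitz_ball h (fun z => Cmul (f z) (dg z)));
      [apply Rmult_le_pos; assumption| |].
    - intros z Hz. apply Hh. unfold in_disk; lra.
    - intros z Hz. rewrite Cmod_mul.
      apply Rmult_le_compat; try apply Cmod_nonneg; [|apply HGb, Hz].
      specialize (Hf z ltac:(unfold in_disk; lra)).
      assert (Hw := weight_ge alpha r z Ha Hr Hz). fold wr in Hw.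
      assert (Hn := Cmod_nonneg (f z)).
      apply (Rmult_le_reg_l wr); [assumption|].
      replace (wr * (M / wr)) with M by (field; lra). nra. }
  assert (Hmax : forall (f : Cx -> Cx) M, (forall z, in_disk z -> weight alpha z * Cmod (f z) <= M) ->
    0 <= M).
  { intros f M Hf. assert (H := Hf C0). unfold in_disk in H. rewrite Cmod_C0 in H.
    specialize (H Rlt_0_1). assert (H1 := weight_pos alpha C0). assert (H2 := Cmod_nonneg (f C0)). nra. }
  split.
  - intros f h [Hfa [M Hf]] HT. assert (HM := Hmax f M Hf). split.
    { intros z Hz. eexists. apply HT, Hz. }
    destruct (Htail 1 Rlt_0_1) as [r0 [Hr0 Ht]].
    destruct (HLip M r0 HM Hr0) as [B [HB0 HBl]].
    exists (B + M * 1). apply (Ht f h M B HM HB0 Hf); [apply HT|].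
    intros z Hz. assert (G := HBl f h Hf HT C0 z ltac:(rewrite Cmod_C0; lra) Hz).
    rewrite (proj1 HT) in G. replace (Csub (h z) C0) with (h z) in G by ring.
    replace (Csub z C0) with z in G by ring. nra.
  - intros f h Hfa [M Hf] HT. assert (HM := Hmax (f 0%nat) M (Hf 0%nat)).
    destruct (Cauchy_subsequence (fun eps n m => forall z, in_disk z ->
      weight beta z * Cmod (Csub (h n z) (h m z)) <= eps)) as [phi [Hphi HE]].
    { intros A eps HA He.
      (* The tail estimate is applied to differences, whose weighted bound is 2 M; their tail thus
         costs at most eps / 2. *)
      destruct (Htail (eps / (4 * (M + 1)))) as [r0 [Hr0 Ht]]; [apply Rdiv_lt_0_compat; lra|].
      destruct (HLip M r0 HM Hr0) as [B [HB0 HBl]].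
      destruct (infinite_subset_Lipschitz A h r0 B (eps / 2) HA) as [A' [I' [S' E']]];
        [lra|assumption| | |lra|].
      { intros n. apply HT. }
      { intros n. apply (HBl (f n)); auto. }
      exists A'. split; [assumption|]. split; [assumption|]. intros n m Hn Hm z Hz.
      apply Rle_trans with (eps / 2 + 2 * M * (eps / (4 * (M + 1)))).
      - apply (Ht (fun w => Csub (f n w) (f m w)) (fun w => Csub (h n w) (h m w)));
          [lra|lra| | | |exact Hz].
        + intros w Hw. assert (G1 := Hf n w Hw). assert (G2 := Hf m w Hw).
          assert (T := Cmod_sub (f n w) (f m w)). assert (Hp := weight_pos alpha w). nra.
        + intros w Hw.
          replace (Cmul (Csub (f n w) (f m w)) (dg w)) with
            (Csub (Cmul (f n w) (dg w)) (Cmul (f m w) (dg w))) by ring.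
          apply Cderiv_sub; apply HT, Hw.
        + intros w Hw. apply E'; assumption.
      - assert (2 * M * (eps / (4 * (M + 1))) <= eps / 2).
        { replace (eps / 2) with (2 * (M + 1) * (eps / (4 * (M + 1)))) by (field; lra).
          apply Rmult_le_compat_r; [|lra]. apply Rlt_le, Rdiv_lt_0_compat; lra. }
        lra. }
    assert (HEe : forall eps, 0 < eps -> exists N, forall i j, (N <= i)%nat -> (N <= j)%nat ->
      forall z, in_disk z -> weight beta z * Cmod (Csub (h (phi i) z) (h (phi j) z)) <= eps).
    { intros eps He. destruct (nfloor_ex (/ eps)) as [N HN]; [apply Rlt_le, Rinv_0_lt_compat, He|].
      exists N. intros i j Hi Hj z Hz. eapply Rle_trans; [apply (HE N i j Hi Hj z Hz)|].
      rewrite <- (Rinv_inv eps). apply Rinv_le_contravar; [apply Rinv_0_lt_compat, He|lra]. }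
    assert (Hlim : forall z, exists l, in_disk z -> forall eps, 0 < eps ->
      exists N, forall i, (N <= i)%nat -> Cmod (Csub (h (phi i) z) l) <= eps).
    { intros z. destruct (classic (in_disk z)) as [Hz|Hz]; [|exists C0; tauto].
      destruct (Cauchy_limit (fun i => h (phi i) z)) as [l Hl]; [|exists l; auto].
      intros eps He. assert (Hw := weight_pos beta z).
      destruct (HEe (weight beta z * eps)) as [N HN]; [apply Rmult_lt_0_compat; assumption|].
      exists N. intros i j Hi Hj. apply (Rmult_le_reg_l (weight beta z)); [assumption|].
      apply HN; assumption. }
    set (H := fun z => epsilon (inhabits C0) (fun l => in_disk z -> forall eps, 0 < eps ->
      exists N, forall i, (N <= i)%nat -> Cmod (Csub (h (phi i) z) l) <= eps)).
    assert (HH : forall z, in_disk z -> forall eps, 0 < eps ->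
      exists N, forall i, (N <= i)%nat -> Cmod (Csub (h (phi i) z) (H z)) <= eps).
    { intros z. apply (epsilon_spec (inhabits C0) (fun l => in_disk z -> forall eps, 0 < eps ->
      exists N, forall i, (N <= i)%nat -> Cmod (Csub (h (phi i) z) l) <= eps)). apply Hlim. }
    assert (Hconv : forall eps, 0 < eps -> exists N, forall n, (N <= n)%nat ->
      forall z, in_disk z -> weight beta z * Cmod (Csub (h (phi n) z) (H z)) <= eps).
    { intros eps He. destruct (HEe eps He) as [N HN]. exists N. intros n Hn z Hz.
      assert (Hw := weight_pos beta z).
      rewrite Rmult_comm. apply Rle_div_r; [assumption|].
      (* At a fixed [z] pointwise convergence suffices to let the second index tend to infinity; the
         rank [N] does not depend on [z]. *)
      apply (Cmod_sub_limit_le (fun i => h (phi i) z) _ _ _ N); [apply HH, Hz|].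
      intros i Hi. apply Rle_div_r; [assumption|]. rewrite Rmult_comm. apply HN; assumption. }
    exists phi, H. split; [assumption|]. split; [|assumption].
    split.
    + intros z Hz. unfold in_disk in Hz. assert (Hz0 := Cmod_nonneg z).
      set (rho := (1 - Cmod z) / 2). assert (Hrho : 0 < rho) by (unfold rho; lra).
      assert (Hin : forall k, Cmod k <= rho -> Cmod (Cadd z k) <= (1 + Cmod z) / 2)
        by (intros k Hk; assert (T := Cmod_add z k); unfold rho in Hk; lra).
      assert (Hin' : forall k, Cmod k <= rho -> in_disk (Cadd z k))
        by (intros k Hk; specialize (Hin k Hk); unfold in_disk; lra).
      apply (Weierstrass_convergence (fun i => h (phi i))
        (fun i w => Cmul (f (phi i) w) (dg w)) H z rho Hrho).
      * intros n k Hk. apply HT. auto.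
      * intros eps He.
        (* A lower bound of the weight on the small ball around [z]; it turns weighted closeness
           into uniform closeness there. *)
        set (wr := Rpower (1 - ((1 + Cmod z) / 2) ^ 2) beta).
        assert (Hwr : 0 < wr) by apply Rpower_pos.
        destruct (HEe (wr * eps)) as [N HN]; [apply Rmult_lt_0_compat; assumption|].
        exists N. intros i j k Hi Hj Hk. specialize (HN i j Hi Hj _ (Hin' k Hk)).
        assert (Hw := weight_ge beta ((1 + Cmod z) / 2) (Cadd z k) Hb ltac:(split; lra) (Hin k Hk)). fold wr in Hw.
        assert (Hn := Cmod_nonneg (Csub (h (phi i) (Cadd z k)) (h (phi j) (Cadd z k)))).
        apply (Rmult_le_reg_l wr); [assumption|]. nra.
      * intros k Hk. apply HH; auto.
    + destruct (Hconv 1 Rlt_0_1) as [N HN]. specialize (HN N (le_n N)).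
      destruct (Htail 1 Rlt_0_1) as [r0 [Hr0 Ht]].
      destruct (HLip M r0 HM Hr0) as [B [HB0 HBl]].
      exists (B + M * 1 + 1). intros z Hz. specialize (HN z Hz).
      assert (G : weight beta z * Cmod (h (phi N) z) <= B + M * 1).
      { apply (Ht (f (phi N)) (h (phi N)) M B HM HB0 (Hf (phi N))); [apply HT| |exact Hz].
        intros w Hw. assert (G := HBl _ _ (Hf (phi N)) (HT (phi N)) C0 w ltac:(rewrite Cmod_C0; lra) Hw).
        rewrite (proj1 (HT (phi N))) in G. replace (Csub (h (phi N) w) C0) with (h (phi N) w) in G by ring.
        replace (Csub w C0) with w in G by ring. nra. }
      assert (T := Cmod_le_sub (H z) (h (phi N) z)). rewrite Cmod_sub_sym in T.
      assert (Hw := weight_pos beta z). nra.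
Qed.

(** * Test functions *)

Lemma exp_le (x y : R) : x <= y -> exp x <= exp y.
Proof. intros [H| ->]; [left; apply exp_increasing, H|lra]. Qed.

Lemma pow_exp (x : R) (n : nat) : exp x ^ n = exp (INR n * x).
Proof.
  induction n as [|n IH]; [simpl; rewrite Rmult_0_l, exp_0; reflexivity|].
  rewrite S_INR. simpl. rewrite IH, <- exp_plus. f_equal; ring.
Qed.

(** This is 2 sinh y, whose derivative 2 cosh y is at least 2, and at most 3 + 1 on [0, 1/2]. *)
Lemma exp_sub_exp_opp_bounds (y : R) :
  0 <= y -> 2 * y <= exp y - exp (- y) /\ (y <= / 2 -> exp y - exp (- y) <= 4 * y).
Proof.
  intros Hy.
  assert (Hd : forall x, derivable_pt_lim (fun t => exp t - exp (- t)) x (exp x + exp (- x))).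
  { intros x. apply is_derive_Reals. auto_derive; [exact I|]. ring. }
  assert (Hl : forall c x, derivable_pt_lim (fun t => c * t) x c).
  { intros c x. apply is_derive_Reals. auto_derive; [exact I|]. ring. }
  assert (E0 : exp 0 - exp (- 0) = 0) by (rewrite Ropp_0; ring).
  split.
  - assert (G := derivable_increment_le (fun t => 2 * t) (fun t => exp t - exp (- t))
      (fun _ => 2) (fun x => exp x + exp (- x)) 0 y Hy ltac:(intros; apply Hl) ltac:(intros; apply Hd)).
    simpl in G. rewrite E0 in G.
    assert (2 * y - 2 * 0 <= exp y - exp (- y) - 0); [|lra]. apply G.
    intros x _. assert (Hp := exp_pos x). rewrite exp_Ropp.
    apply (Rmult_le_reg_r (exp x)); [assumption|].
    rewrite Rmult_plus_distr_r, Rinv_l by lra.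
    assert (Hs := Rle_0_sqr (exp x - 1)). unfold Rsqr in Hs. lra.
  - intros Hy2.
    assert (G := derivable_increment_le (fun t => exp t - exp (- t)) (fun t => 4 * t)
      (fun x => exp x + exp (- x)) (fun _ => 4) 0 y Hy ltac:(intros; apply Hd) ltac:(intros; apply Hl)).
    simpl in G. rewrite E0 in G.
    assert (exp y - exp (- y) - 0 <= 4 * y - 4 * 0); [|lra]. apply G.
    intros x Hx. assert (H1 := exp_le x 1 ltac:(lra)). assert (H2 := exp_le_3).
    assert (H3 := exp_le (- x) 0 ltac:(lra)). rewrite exp_0 in H3. lra.
Qed.

(** Uses 2 cosh t = 2 + (2 sinh (t/2))^2 and the bounds on sinh; the case t < 0 follows by
    parity. *)
Lemma exp_add_exp_opp_bounds (t : R) :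
  2 + t ^ 2 <= exp t + exp (- t) /\ exp (Rabs t) <= exp t + exp (- t) /\
  (Rabs t <= 1 -> exp t + exp (- t) <= 2 + 4 * t ^ 2).
Proof.
  assert (H : forall t, 0 <= t -> 2 + t ^ 2 <= exp t + exp (- t) /\
    exp t <= exp t + exp (- t) /\ (t <= 1 -> exp t + exp (- t) <= 2 + 4 * t ^ 2)).
  { clear. intros t Ht.
    destruct (exp_sub_exp_opp_bounds (t / 2)) as [H1 H2]; [lra|].
    assert (E : exp t + exp (- t) = 2 + (exp (t / 2) - exp (- (t / 2))) ^ 2).
    { assert (E1 : exp t = exp (t / 2) * exp (t / 2)) by (rewrite <- exp_plus; f_equal; field).
      assert (E2 : exp (- t) = exp (- (t / 2)) * exp (- (t / 2)))
        by (rewrite <- exp_plus; f_equal; field).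
      assert (E3 : exp (t / 2) * exp (- (t / 2)) = 1)
        by (rewrite <- exp_plus; replace (t / 2 + - (t / 2)) with 0 by ring; apply exp_0).
      rewrite E1, E2. simpl.
      transitivity (exp (t / 2) * exp (t / 2) + exp (- (t / 2)) * exp (- (t / 2)) + 2
        - 2 * (exp (t / 2) * exp (- (t / 2)))); [rewrite E3; ring|ring]. }
    split; [|split].
    - rewrite E. nra.
    - assert (Hp := exp_pos (- t)). lra.
    - intros Ht1. specialize (H2 ltac:(lra)). rewrite E.
      assert ((exp (t / 2) - exp (- (t / 2))) ^ 2 <= (4 * (t / 2)) ^ 2) by (apply pow_incr; lra).
      nra. }
  destruct (Rle_dec 0 t) as [Ht|Ht].
  - rewrite (Rabs_pos_eq t) by assumption. apply H, Ht.
  - rewrite (Rabs_left t) by lra. destruct (H (- t) ltac:(lra)) as [H1 [H2 H3]].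
    rewrite Ropp_involutive in H1, H2, H3. split; [nra|]. split; [lra|]. intros G.
    specialize (H3 G). nra.
Qed.

Lemma cos_ge_half (x : R) : Rabs x <= 1 -> / 2 <= cos x.
Proof.
  intros Hx. assert (HP := PI2_3_2).
  assert (E : cos x = cos (Rabs x)).
  { unfold Rabs. destruct (Rcase_abs x); [rewrite cos_neg|]; reflexivity. }
  assert (Hp := Rabs_pos x).
  rewrite E. replace (/ 2) with (cos (PI / 3)) by (rewrite cos_PI3; field).
  apply cos_decr_1; lra.
Qed.

(** Each term is at most three times an increment of the arctangent over a unit step; the sum
    telescopes to at most 3 pi <= 12, uniformly in [sigma] and [K]. *)
Lemma sum_inv_1_sqr_le (sigma : R) (K : nat) :
  sum_f_R0 (fun k => / (1 + (sigma - INR k) ^ 2)) K <= 12.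
Proof.
  assert (Hstep : forall x, / (1 + x ^ 2) <= 3 * (atan (x + 1) - atan x)).
  { intros x.
    destruct (MVT_cor2 atan (fun x => / (1 + x ^ 2)) x (x + 1)) as [c [E Hc]]; [lra| |].
    - intros y _. apply derivable_pt_lim_atan.
    - rewrite E. replace (x + 1 - x) with 1 by ring. rewrite Rmult_1_r.
      replace (3 * / (1 + c ^ 2)) with (/ ((1 + c * c) / 3)) by (field; nra).
      assert (Hcs : c * c <= 2 + 3 * x ^ 2).
      { assert (G : c * c <= 2 * ((c - x) * (c - x)) + 2 * (x * x)).
        { assert (Hs := Rle_0_sqr (c - 2 * x)). unfold Rsqr in Hs. nra. }
        assert ((c - x) * (c - x) <= 1 * 1) by (apply Rmult_le_compat; lra). nra. }
      apply Rinv_le_contravar; nra. }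
  assert (Hsum : sum_f_R0 (fun k => / (1 + (sigma - INR k) ^ 2)) K <=
    3 * (atan (INR (S K) - sigma) - atan (- sigma))).
  { induction K as [|K IH].
    - cbn [sum_f_R0]. assert (G := Hstep (0 - sigma)). simpl INR.
      replace (0 - sigma + 1) with (1 - sigma) in G by ring.
      replace (0 - sigma) with (- sigma) in G by ring.
      replace ((sigma - 0) ^ 2) with ((- sigma) ^ 2) by ring. exact G.
    - rewrite tech5. assert (G := Hstep (INR (S K) - sigma)).
      replace (INR (S K) - sigma + 1) with (INR (S (S K)) - sigma) in G
        by (rewrite (S_INR (S K)); ring).
      replace ((sigma - INR (S K)) ^ 2) with ((INR (S K) - sigma) ^ 2) by ring. lra. }
  assert (B1 := atan_bound (INR (S K) - sigma)). assert (B2 := atan_bound (- sigma)).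
  assert (HP := PI_4). lra.
Qed.

(** The term [k0] supplies the gain [g]; [e] is the budget for the possible negativity of the
    others. *)
Lemma sum_ge_single (t e : nat -> R) (g : R) (k0 K : nat) :
  (k0 <= K)%nat -> g <= t k0 -> (forall k, 0 <= e k) -> (forall k, - e k <= t k) ->
  g - sum_f_R0 e K <= sum_f_R0 t K.
Proof.
  intros Hk Hg He Ht.
  assert (Hall : forall N, - sum_f_R0 e N <= sum_f_R0 t N).
  { induction N as [|N IH]; simpl; [apply Ht|]. specialize (Ht (S N)). lra. }
  induction Hk as [|K Hk IH].
  - destruct k0 as [|k0]; simpl; [specialize (He 0%nat); lra|].
    specialize (He (S k0)). specialize (Hall k0). lra.
  - simpl. specialize (Ht (S K)). lra.
Qed.

(** * Finite sums of powers of a rational kernel *)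

Fixpoint Cpow (z : Cx) (n : nat) : Cx :=
  match n with O => Cone | S n => Cmul z (Cpow z n) end.

Fixpoint Csum (u : nat -> Cx) (n : nat) : Cx :=
  match n with O => u O | S n' => Cadd (Csum u n') (u n) end.

Lemma Cmod_pow (z : Cx) (n : nat) : Cmod (Cpow z n) = Cmod z ^ n.
Proof. induction n as [|n IH]; simpl; [apply Cmod_C1|]. rewrite Cmod_mul, IH. reflexivity. Qed.

Lemma Cpow_real (x : R) (n : nat) : Cpow (RtoCx x) n = RtoCx (x ^ n).
Proof.
  induction n as [|n IH]; simpl; [reflexivity|]. rewrite IH.
  apply injective_projections; simpl; ring.
Qed.

Lemma Cdiff_pow (f : Cx -> Cx) (z : Cx) (n : nat) :
  Cdiff f z -> Cdiff (fun w => Cpow (f w) n) z.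
Proof.
  intros H. induction n as [|n IH]; simpl; [apply Cdiff_const|].
  apply (Cdiff_mul f); assumption.
Qed.

Lemma Cmod_sum_le (u : nat -> Cx) (v : nat -> R) (K : nat) :
  (forall k, Cmod (u k) <= v k) -> Cmod (Csum u K) <= sum_f_R0 v K.
Proof.
  intros H. induction K as [|K IH]; simpl; [apply H|].
  eapply Rle_trans; [apply Cmod_add|]. specialize (H (S K)). lra.
Qed.

Lemma Cdiff_sum (u : nat -> Cx -> Cx) (z : Cx) (K : nat) :
  (forall k, Cdiff (u k) z) -> Cdiff (fun w => Csum (fun k => u k w) K) z.
Proof.
  intros H. induction K as [|K IH]; simpl; [apply H|].
  apply (Cdiff_add (fun w => Csum (fun k => u k w) K)); [assumption|apply H].
Qed.

Lemma Cre_mul_sum (c : Cx) (u : nat -> Cx) (K : nat) :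
  Cre (Cmul c (Csum u K)) = sum_f_R0 (fun k => Cre (Cmul c (u k))) K.
Proof.
  induction K as [|K IH]; [reflexivity|].
  rewrite tech5, <- IH. unfold Cre; simpl; ring.
Qed.

(* In the variable log u this is sech^2 ((log u - log a) / 2): on the right half-plane it is
   bounded by 2, on the positive axis it peaks at u = a with value 1, and its large powers
   are concentrated near a. *)
Definition kernel (a : R) (u : Cx) : Cx :=
  Cmul (Cmul (RtoCx (4 * a)) u) (Cinv (Cmul (Cadd (RtoCx a) u) (Cadd (RtoCx a) u))).

Lemma Cmul_neq0 (z w : Cx) : z <> C0 -> w <> C0 -> Cmul z w <> C0.
Proof.
  intros Hz Hw E. assert (H := Cmod_mul z w). rewrite E, Cmod_C0 in H.
  assert (H1 := Cmod_pos z Hz). assert (H2 := Cmod_pos w Hw). nra.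
Qed.

Lemma kernel_den_neq0 (a : R) (u : Cx) : 0 < a -> 0 < fst u -> Cadd (RtoCx a) u <> C0.
Proof. intros Ha Hu E. apply (f_equal fst) in E. simpl in E. lra. Qed.

Lemma Cdiff_kernel (a : R) (f : Cx -> Cx) (z : Cx) :
  0 < a -> 0 < fst (f z) -> Cdiff f z -> Cdiff (fun w => kernel a (f w)) z.
Proof.
  intros Ha Hu Hf. unfold kernel.
  assert (Hs : Cdiff (fun w => Cadd (RtoCx a) (f w)) z)
    by (apply (Cdiff_add (fun _ => RtoCx a) f); [apply Cdiff_const|assumption]).
  apply (Cdiff_mul (fun w => Cmul (RtoCx (4 * a)) (f w))).
  - apply (Cdiff_mul (fun _ => RtoCx (4 * a)) f); [apply Cdiff_const|assumption].
  - apply (Cdiff_comp Cinv (fun w => Cmul (Cadd (RtoCx a) (f w)) (Cadd (RtoCx a) (f w)))).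
    + apply Cdiff_mul; assumption.
    + eexists. apply Cderiv_inv. apply Cmul_neq0; apply kernel_den_neq0; assumption.
Qed.

(** Divide numerator and denominator of 4 a u / (a + u)^2 by a u. *)
Lemma kernel_real (p s : R) :
  kernel (exp (- p)) (RtoCx (exp (- s))) =
  RtoCx (4 / (2 + (exp (s - p) + exp (- (s - p))))).
Proof.
  assert (Ha := exp_pos (- p)). assert (Hx := exp_pos (- s)).
  assert (E1 : exp (s - p) = exp (- p) / exp (- s)).
  { unfold Rdiv. rewrite <- exp_Ropp, <- exp_plus. f_equal; ring. }
  assert (E2 : exp (- (s - p)) = exp (- s) / exp (- p)).
  { unfold Rdiv. rewrite <- exp_Ropp, <- exp_plus. f_equal; ring. }
  rewrite E1, E2. unfold kernel, Cinv.
  apply injective_projections; simpl; field; repeat split; nra.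
Qed.

(** On the right half-plane |a + u|^2 >= a^2 + |u|^2. The lost cross term raises the peak of the
    bound from 1 to 2, hence the power 2^(2 n^2) in [test_function_le]. *)
Lemma kernel_le (p s : R) (u : Cx) :
  0 < fst u -> Cmod u = exp (- s) ->
  Cmod (kernel (exp (- p)) u) <= 4 / (exp (s - p) + exp (- (s - p))).
Proof.
  intros Hu Es. assert (Ha := exp_pos (- p)). assert (Hx := exp_pos (- s)).
  assert (E1 : exp (s - p) = exp (- p) / exp (- s)).
  { unfold Rdiv. rewrite <- exp_Ropp, <- exp_plus. f_equal; ring. }
  assert (E2 : exp (- (s - p)) = exp (- s) / exp (- p)).
  { unfold Rdiv. rewrite <- exp_Ropp, <- exp_plus. f_equal; ring. }
  rewrite E1, E2. set (a := exp (- p)) in *. set (x := exp (- s)) in *.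
  assert (Hn := kernel_den_neq0 a u Ha Hu).
  unfold kernel. rewrite !Cmod_mul, Cmod_real, Cmod_inv by (apply Cmul_neq0; assumption).
  rewrite Cmod_mul, Es, Rabs_pos_eq by lra.
  assert (Hd := Cmod_sqr (Cadd (RtoCx a) u)). assert (Hq := Cmod_sqr u). rewrite Es in Hq.
  simpl in Hd.
  replace (4 / (a / x + x / a)) with (4 * a * x * / (a * a + x * x)) by (field; nra).
  apply Rmult_le_compat_l; [nra|]. apply Rinv_le_contravar; nra.
Qed.

Lemma Bernoulli (x : R) (n : nat) : 0 <= x -> 1 + INR n * x <= (1 + x) ^ n.
Proof.
  intros [Hx|<-]; [apply poly, Hx|]. rewrite Rmult_0_r, Rplus_0_r, pow1. lra.
Qed.

(* The factor exp (- alpha t) is absorbed by m of the powers of P, the remaining 2 N powers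
   give the decay. *)
Lemma kernel_power_le (alpha t P q : R) (m N : nat) :
  0 <= alpha <= INR m -> 0 <= P -> 0 <= q -> P <= 4 * exp (- Rabs t) -> P <= q / (1 + t ^ 2 / 4) ->
  exp (- alpha * t) * P ^ (2 * N + m) <= 4 ^ m * q ^ (2 * N) * (/ (1 + INR N * t ^ 2 / 4)) ^ 2.
Proof.
  intros Ha HP Hq H1 H2.
  assert (Ht2 : 0 <= t ^ 2) by nra.
  assert (HN := pos_INR N).
  assert (A1 : exp (- alpha * t) * P ^ m <= 4 ^ m).
  { assert (G : exp (- alpha * t) <= exp (Rabs t) ^ m).
    { rewrite pow_exp. apply exp_le. assert (T1 := Rle_abs (- t)). rewrite Rabs_Ropp in T1.
      assert (T2 := Rabs_pos t).
      apply Rle_trans with (alpha * Rabs t); [nra|]. apply Rmult_le_compat_r; lra. }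
    assert (Hp := exp_pos (Rabs t)).
    apply Rle_trans with (exp (Rabs t) ^ m * P ^ m).
    - apply Rmult_le_compat_r; [apply pow_le, HP|exact G].
    - rewrite <- Rpow_mult_distr. apply pow_incr. split; [nra|].
      replace 4 with (exp (Rabs t) * (4 * exp (- Rabs t))).
      + apply Rmult_le_compat_l; lra.
      + rewrite exp_Ropp. field. lra. }
  (* Bernoulli's inequality on each of two blocks of [N] powers; the resulting square leaves one
     factor for summation and one for smallness. *)
  assert (A2 : P ^ (2 * N) <= q ^ (2 * N) * (/ (1 + INR N * t ^ 2 / 4)) ^ 2).
  { apply Rle_trans with ((q / (1 + t ^ 2 / 4)) ^ (2 * N)); [apply pow_incr; lra|].
    unfold Rdiv at 1. rewrite Rpow_mult_distr.
    apply Rmult_le_compat_l; [apply pow_le, Hq|].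
    rewrite Nat.mul_comm, pow_mult. apply pow_incr.
    assert (Hb := Bernoulli (t ^ 2 / 4) N ltac:(lra)).
    assert (Hp : 0 < 1 + INR N * t ^ 2 / 4) by nra.
    split; [apply pow_le, Rlt_le, Rinv_0_lt_compat; lra|].
    rewrite pow_inv. apply Rinv_le_contravar; lra. }
  rewrite pow_add.
  replace (exp (- alpha * t) * (P ^ (2 * N) * P ^ m)) with
    ((exp (- alpha * t) * P ^ m) * P ^ (2 * N)) by ring.
  rewrite (Rmult_assoc (4 ^ m)). apply Rmult_le_compat; auto.
  - apply Rmult_le_pos; [apply Rlt_le, exp_pos|apply pow_le, HP].
  - apply pow_le, HP.
Qed.

Definition node (n k : nat) : R := INR k / INR n.

(* The bumps are centred at the radii 1 - e^(-k/n); b is the phase to be compensated, as a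
   function of the variable s = - ln (1 - r). *)
Definition test_function (alpha : R) (n m : nat) (b : R -> R) (K : nat) (zeta : Cx) : Cx :=
  Csum (fun k => Cmul (Cmul (RtoCx (exp (alpha * node n k)))
                            (cos (b (node n k)), - sin (b (node n k))))
                      (Cpow (kernel (exp (- node n k)) (Csub Cone zeta)) (2 * (n * n) + m))) K.

Lemma in_disk_re (zeta : Cx) : in_disk zeta -> 0 < fst (Csub Cone zeta).
Proof.
  unfold in_disk. intros H. assert (T := Rabs_fst_le zeta). assert (G := Rle_abs (fst zeta)).
  simpl. lra.
Qed.

Lemma test_function_Cdiff (alpha : R) (n m : nat) (b : R -> R) (K : nat) (zeta : Cx) :
  in_disk zeta -> Cdiff (test_function alpha n m b K) zeta.
Proof.
  intros Hz. unfold test_function.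
  apply (Cdiff_sum (fun k zeta => Cmul (Cmul (RtoCx (exp (alpha * node n k)))
    (cos (b (node n k)), - sin (b (node n k))))
    (Cpow (kernel (exp (- node n k)) (Csub Cone zeta)) (2 * (n * n) + m)))).
  intros k. apply Cdiff_mul; [apply Cdiff_const|].
  apply (Cdiff_pow (fun w => kernel (exp (- node n k)) (Csub Cone w))).
  apply (Cdiff_kernel _ (fun w => Csub Cone w)); [apply exp_pos|apply in_disk_re, Hz|].
  eexists. apply (Cderiv_sub (fun _ => Cone) (fun w => w)); [apply Cderiv_const|apply Cderiv_id].
Qed.

(** The reason for n^2 in the exponent: n^2 powers narrow a bump to the spacing 1/n, and the decay
    then depends on the index distance n s - k alone. *)
Lemma node_scale (n k : nat) (s : R) :
  (0 < n)%nat -> INR (n * n) * (s - node n k) ^ 2 = (INR n * s - INR k) ^ 2.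
Proof.
  intros Hn. assert (0 < INR n) by (apply lt_0_INR, Hn).
  rewrite mult_INR. unfold node. field. lra.
Qed.

(** With |1 - zeta| = e^(-s) and t = s - p, the coefficient e^(alpha p) is e^(alpha s) e^(-alpha t),
    and [kernel_power_le] absorbs the last factor. Each bump then decays like 4 / (1 + (n s - k)^2),
    and 48 = 4 * 12 by [sum_inv_1_sqr_le]. *)
Lemma test_function_le (alpha : R) (n m : nat) (b : R -> R) (K : nat) (zeta : Cx) :
  0 <= alpha <= INR m -> (0 < n)%nat -> in_disk zeta ->
  Cmod (test_function alpha n m b K zeta)
    <= 4 ^ m * 2 ^ (2 * (n * n)) * 48 * Rpower (Cmod (Csub Cone zeta)) (- alpha).
Proof.
  intros Ha Hn Hz. set (u := Csub Cone zeta). set (N := (n * n)%nat).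
  assert (Hu := in_disk_re zeta Hz). fold u in Hu.
  assert (Hm : 0 < Cmod u).
  { apply Cmod_pos. intros E. rewrite E in Hu. simpl in Hu. lra. }
  set (s := - ln (Cmod u)).
  assert (Es : Cmod u = exp (- s)) by (unfold s; rewrite Ropp_involutive, exp_ln; auto).
  assert (Er : Rpower (Cmod u) (- alpha) = exp (alpha * s))
    by (unfold Rpower, s; f_equal; ring).
  rewrite Er.
  apply Rle_trans with (sum_f_R0 (fun k => / (1 + (INR n * s - INR k) ^ 2) *
    (4 * (4 ^ m * 2 ^ (2 * N) * exp (alpha * s)))) K).
  - apply Cmod_sum_le. intros k. fold u N. set (p := node n k).
    rewrite !Cmod_mul, Cmod_real, Cmod_pow.
    rewrite Cmod_unit_conj, Rabs_pos_eq by (apply Rlt_le, exp_pos). rewrite Rmult_1_r.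
    set (t := s - p).
    destruct (exp_add_exp_opp_bounds t) as [B1 [B2 _]].
    assert (HE : 0 < exp t + exp (- t)) by (assert (X := exp_pos t); assert (Y := exp_pos (- t)); lra).
    assert (HP := kernel_le p s u Hu Es). fold t in HP.
    assert (Hpow := kernel_power_le alpha t (Cmod (kernel (exp (- p)) u)) 2 m N Ha (Cmod_nonneg _)).
    assert (G : exp (- alpha * t) * Cmod (kernel (exp (- p)) u) ^ (2 * N + m) <=
      4 ^ m * 2 ^ (2 * N) * (/ (1 + INR N * t ^ 2 / 4)) ^ 2).
    { apply Hpow; [lra| |].
      - eapply Rle_trans; [exact HP|]. rewrite (exp_Ropp (Rabs t)). apply Rmult_le_compat_l; [lra|].
        apply Rinv_le_contravar; [apply exp_pos|exact B2].
      - eapply Rle_trans; [exact HP|].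
        replace (2 / (1 + t ^ 2 / 4)) with (4 * / (2 + t ^ 2 / 2)) by (field; nra).
        apply Rmult_le_compat_l; [lra|]. apply Rinv_le_contravar; nra. }
    assert (Et : exp (alpha * p) = exp (alpha * s) * exp (- alpha * t))
      by (rewrite <- exp_plus; f_equal; unfold t; ring).
    rewrite Et, Rmult_assoc.
    assert (Ev : INR N * t ^ 2 = (INR n * s - INR k) ^ 2) by (apply node_scale, Hn).
    rewrite Ev in G. set (v := (INR n * s - INR k) ^ 2) in *.
    assert (Hv : 0 <= v) by (apply pow2_ge_0).
    assert (Hv2 : (/ (1 + v / 4)) ^ 2 <= 4 * / (1 + v)).
    { replace (4 * / (1 + v)) with (/ ((1 + v) / 4)) by (field; lra).
      rewrite pow_inv. apply Rinv_le_contravar; nra. }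
    assert (Hq : 0 <= 4 ^ m * 2 ^ (2 * N)) by (apply Rmult_le_pos; apply pow_le; lra).
    apply Rle_trans with (exp (alpha * s) * (4 ^ m * 2 ^ (2 * N) * (4 * / (1 + v)))).
    + apply Rmult_le_compat_l; [apply Rlt_le, exp_pos|]. eapply Rle_trans; [exact G|].
      apply Rmult_le_compat_l; assumption.
    + right; ring.
  - rewrite <- scal_sum. assert (G := sum_inv_1_sqr_le (INR n * s) K).
    assert (Hq : 0 <= 4 * (4 ^ m * 2 ^ (2 * N) * exp (alpha * s))).
    { apply Rmult_le_pos; [lra|]. apply Rmult_le_pos; [|apply Rlt_le, exp_pos].
      apply Rmult_le_pos; apply pow_le; lra. }
    eapply Rle_trans; [apply Rmult_le_compat_l; [exact Hq|exact G]|]. right; ring.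
Qed.

(** The first constant comes from the bump just below [s], the second (192 = 16 * 12) from the sum
    of the bumps too far away for their phase to be controlled. *)
Lemma test_function_ge (alpha M s : R) (n m : nat) (b : R -> R) (K : nat) :
  0 <= alpha <= INR m -> 1 <= M <= INR n -> 0 <= s -> INR n * s <= INR K ->
  (forall s', 0 <= s' -> Rabs (b s - b s') <= M * Rabs (s - s')) ->
  (exp (- (2 + alpha + INR m)) / 2 - 4 ^ m * 192 * M ^ 2 / INR n) * exp (alpha * s)
    <= Cre (Cmul (cos (b s), sin (b s)) (test_function alpha n m b K (RtoCx (1 - exp (- s))))).
Proof.
  intros Ha HM Hs HK Hb.
  assert (Hn : (0 < n)%nat) by (apply INR_lt; simpl; lra).
  set (N := (n * n)%nat).
  assert (HNn : INR N = INR n * INR n) by apply mult_INR.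
  set (P := fun k => 4 / (2 + (exp (s - node n k) + exp (- (s - node n k))))).
  set (t := fun k => exp (alpha * node n k) * P k ^ (2 * N + m) * cos (b s - b (node n k))).
  assert (Et : Cre (Cmul (cos (b s), sin (b s)) (test_function alpha n m b K (RtoCx (1 - exp (- s)))))
    = sum_f_R0 t K).
  { unfold test_function. rewrite Cre_mul_sum. apply sum_eq. intros k _. unfold t.
    fold N.
    replace (Csub Cone (RtoCx (1 - exp (- s)))) with (RtoCx (exp (- s)))
      by (apply injective_projections; simpl; ring).
    rewrite kernel_real, Cpow_real. fold (P k). rewrite cos_minus.
    unfold Cre; simpl. ring. }
  rewrite Et. clear Et.
  assert (Hp0 : forall k, 0 <= node n k).
  { intros k. apply Rmult_le_pos; [apply pos_INR|]. apply Rlt_le, Rinv_0_lt_compat; lra. }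
  assert (Ex : forall k, exp (alpha * node n k) = exp (alpha * s) * exp (- alpha * (s - node n k)))
    by (intros k; rewrite <- exp_plus; f_equal; ring).
  assert (Hes := exp_pos (alpha * s)).
  assert (HPpos : forall k, 0 < P k).
  { intros k. unfold P. assert (X := exp_pos (s - node n k)).
    assert (Y := exp_pos (- (s - node n k))). apply Rdiv_lt_0_compat; lra. }
  set (e := fun k => / (1 + (INR n * s - INR k) ^ 2) *
    (4 ^ m * 16 * M ^ 2 / INR n * exp (alpha * s))).
  assert (Hcst : 0 <= 4 ^ m * 16 * M ^ 2 / INR n * exp (alpha * s)).
  { apply Rmult_le_pos; [|lra]. apply Rmult_le_pos; [|apply Rlt_le, Rinv_0_lt_compat; lra].
    apply Rmult_le_pos; [|nra]. apply Rmult_le_pos; [apply pow_le; lra|lra]. }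
  assert (He : forall k, 0 <= e k).
  { intros k. apply Rmult_le_pos; [|exact Hcst]. apply Rlt_le, Rinv_0_lt_compat. assert (Hq := pow2_ge_0 (INR n * s - INR k)). lra. }
  assert (Ht : forall k, - e k <= t k).
  { intros k. set (d := s - node n k).
    (* Near bumps differ in phase by at most 1, so their cosine is positive; far bumps may have any
       sign and are bounded in modulus. *)
    destruct (Rle_dec (M * Rabs d) 1) as [Hnear|Hfar].
    - apply Rle_trans with 0; [specialize (He k); lra|].
      assert (Hc := cos_ge_half (b s - b (node n k))).
      specialize (Hc (Rle_trans _ _ _ (Hb _ (Hp0 k)) Hnear)).
      unfold t. apply Rmult_le_pos; [|lra]. apply Rmult_le_pos; [apply Rlt_le, exp_pos|].
      apply pow_le, Rlt_le, HPpos.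
    - destruct (exp_add_exp_opp_bounds d) as [B1 [B2 _]].
      assert (HE := exp_pos (Rabs d)).
      assert (Hpow := kernel_power_le alpha d (P k) 1 m N Ha (Rlt_le _ _ (HPpos k)) Rle_0_1).
      assert (G : exp (- alpha * d) * P k ^ (2 * N + m) <=
        4 ^ m * 1 ^ (2 * N) * (/ (1 + INR N * d ^ 2 / 4)) ^ 2).
      { apply Hpow.
        - rewrite (exp_Ropp (Rabs d)). apply Rmult_le_compat_l; [lra|].
          apply Rinv_le_contravar; [exact HE|fold d; lra].
        - replace (1 / (1 + d ^ 2 / 4)) with (4 * / (4 + d ^ 2)) by (field; nra).
          apply Rmult_le_compat_l; [lra|]. apply Rinv_le_contravar; [nra|fold d; lra]. }
      rewrite pow1, Rmult_1_r in G.
      assert (Ev : INR N * d ^ 2 = (INR n * s - INR k) ^ 2) by (apply node_scale, Hn).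
      assert (Hv : INR n <= M ^ 2 * (INR n * s - INR k) ^ 2).
      { rewrite <- Ev, HNn. assert (Hd : 1 <= M * Rabs d) by lra.
        assert (Hd2 : 1 * 1 <= (M * Rabs d) * (M * Rabs d)) by (apply Rmult_le_compat; lra).
        replace (d ^ 2) with (Rabs d * Rabs d) by (rewrite <- Rabs_mult, Rabs_pos_eq; simpl; nra).
        apply Rle_trans with (INR n * INR n * 1); [nra|].
        replace (M ^ 2 * (INR n * INR n * (Rabs d * Rabs d))) with
          (INR n * INR n * ((M * Rabs d) * (M * Rabs d))) by ring.
        apply Rmult_le_compat_l; nra. }
      rewrite Ev in G. unfold e. set (v := (INR n * s - INR k) ^ 2) in *.
      assert (Hvp : 0 < v) by (assert (0 < INR n) by lra; assert (0 < M ^ 2) by nra; nra).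
      (* Of the two decay factors one stays summable in [k]; the other gives the gain M^2 / n,
         because a far bump has n <= M^2 v. *)
      assert (G2 : (/ (1 + v / 4)) ^ 2 <= / (1 + v) * (16 * M ^ 2 / INR n)).
      { rewrite pow_inv.
        replace (/ (1 + v) * (16 * M ^ 2 / INR n)) with
          (/ ((1 + v) * (INR n / (16 * M ^ 2)))) by (field; repeat split; nra).
        assert (Hq : INR n / (16 * M ^ 2) <= v / 16).
        { apply (Rmult_le_reg_r (16 * M ^ 2)); [nra|].
          replace (INR n / (16 * M ^ 2) * (16 * M ^ 2)) with (INR n) by (field; nra). nra. }
        apply Rinv_le_contravar.
        - apply Rmult_lt_0_compat; [lra|]. apply Rdiv_lt_0_compat; nra.
        - nra. }
      assert (H4 : 0 <= 4 ^ m) by (apply pow_le; lra).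
      assert (G3 : exp (alpha * node n k) * P k ^ (2 * N + m) <=
        / (1 + v) * (4 ^ m * 16 * M ^ 2 / INR n * exp (alpha * s))).
      { rewrite Ex. fold d. rewrite Rmult_assoc.
        apply Rle_trans with (exp (alpha * s) * (4 ^ m * (/ (1 + v) * (16 * M ^ 2 / INR n)))).
        - apply Rmult_le_compat_l; [lra|]. eapply Rle_trans; [exact G|].
          apply Rmult_le_compat_l; assumption.
        - right. unfold Rdiv. ring. }
      unfold t. assert (Hc := COS_bound (b s - b (node n k))).
      assert (Hpos : 0 <= exp (alpha * node n k) * P k ^ (2 * N + m))
        by (apply Rmult_le_pos; [apply Rlt_le, exp_pos|apply pow_le, Rlt_le, HPpos]).
      nra. }
  (* The last node not beyond [s]: then 0 <= n d <= 1, and [M] <= n keeps its phase error at most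
     1. *)
  destruct (nfloor_ex (INR n * s)) as [k0 Hk0]; [apply Rmult_le_pos; lra|].
  assert (Hk0K : (k0 <= K)%nat) by (apply INR_le; lra).
  assert (Hg : exp (alpha * s) * (exp (- (2 + alpha + INR m)) / 2) <= t k0).
  { set (d := s - node n k0).
    assert (Hd : 0 <= INR n * d <= 1).
    { unfold d, node. replace (INR n * (s - INR k0 / INR n)) with (INR n * s - INR k0) by (field; lra).
      lra. }
    assert (Hd1 : 0 <= d <= 1) by nra.
    assert (Hc : / 2 <= cos (b s - b (node n k0))).
    { apply cos_ge_half. eapply Rle_trans; [apply Hb, Hp0|]. fold d. rewrite Rabs_pos_eq by lra. nra. }
    assert (HPk : / (1 + d ^ 2) <= P k0).
    { destruct (exp_add_exp_opp_bounds d) as [_ [_ B]].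
      rewrite Rabs_pos_eq in B by lra. specialize (B ltac:(lra)).
      unfold P. fold d. replace (/ (1 + d ^ 2)) with (4 * / (4 + 4 * d ^ 2)) by (field; nra).
      apply Rmult_le_compat_l; [lra|].
      assert (X := exp_pos d). assert (Y := exp_pos (- d)).
      apply Rinv_le_contravar; lra. }
    (* From 1 + d^2 <= exp (d^2) and n d <= 1: the exponent loses at most (2 n^2 + m) d^2 <= 2 +
       m. *)
    assert (HPpow : exp (- (2 + INR m)) <= P k0 ^ (2 * N + m)).
    { apply Rle_trans with ((/ (1 + d ^ 2)) ^ (2 * N + m)).
      - rewrite pow_inv, exp_Ropp. assert (Hq : 0 < 1 + d ^ 2) by nra.
        apply Rinv_le_contravar; [apply pow_lt, Hq|].
        apply Rle_trans with (exp (d ^ 2) ^ (2 * N + m)).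
        + apply pow_incr. split; [lra|]. assert (T := exp_ineq1_le (d ^ 2)). lra.
        + rewrite pow_exp. apply exp_le. rewrite plus_INR, mult_INR, HNn. simpl (INR 2).
          assert (Hm := pos_INR m).
          assert ((INR n * d) * (INR n * d) <= 1 * 1) by (apply Rmult_le_compat; lra).
          assert (d ^ 2 <= 1) by nra. nra.
      - apply pow_incr. split; [|exact HPk]. apply Rlt_le, Rinv_0_lt_compat. nra. }
    unfold t. rewrite Ex. fold d.
    assert (Had : exp (- alpha) <= exp (- alpha * d)) by (apply exp_le; nra).
    replace (exp (- (2 + alpha + INR m))) with (exp (- alpha) * exp (- (2 + INR m)))
      by (rewrite <- exp_plus; f_equal; ring).
    assert (X1 := exp_pos (- alpha)). assert (X2 := exp_pos (- (2 + INR m))).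
    unfold Rdiv. rewrite !Rmult_assoc. apply Rmult_le_compat_l; [lra|].
    apply Rmult_le_compat; [lra| |exact Had|].
    - apply Rmult_le_pos; lra.
    - apply Rmult_le_compat; lra. }
  assert (G := sum_ge_single t e _ k0 K Hk0K Hg He Ht).
  assert (Hsum : sum_f_R0 e K <= 4 ^ m * 192 * M ^ 2 / INR n * exp (alpha * s)).
  { unfold e. rewrite <- scal_sum. assert (G2 := sum_inv_1_sqr_le (INR n * s) K).
    eapply Rle_trans; [apply Rmult_le_compat_l; [exact Hcst|exact G2]|].
    right. field. lra. }
  rewrite Rmult_minus_distr_r. rewrite (Rmult_comm (_ / 2)). lra.
Qed.

(** * Necessity of the radial condition *)

(** On the radius the Bloch bound gives |dL| <= M / (1 - r^2) <= M / (1 - r), and ds = dr / (1 - r)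
    for s = - ln (1 - r). *)
Lemma radial_phase_Lipschitz (L dL : Cx -> Cx) (M theta : R) :
  is_deriv_on_disk L dL -> 0 <= M ->
  (forall z, in_disk z -> (1 - Cmod z ^ 2) * Cmod (dL z) <= M) ->
  forall s s', 0 <= s -> 0 <= s' ->
    Rabs (snd (L (polar (1 - exp (- s)) theta)) - snd (L (polar (1 - exp (- s')) theta)))
      <= M * Rabs (s - s').
Proof.
  intros Hd HM Hb.
  set (beta := fun r => snd (L (polar r theta))).
  (* [c] is 1 or -1, for the two sides of the absolute value; the real part of (0, -c) times L is
     [c] times the imaginary part of L. *)
  assert (Hinc : forall c r r', Rabs c = 1 -> 0 <= r -> r <= r' -> r' < 1 ->
    c * (beta r' - beta r) <= M * (ln (1 - r) - ln (1 - r'))).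
  { intros c r r' Hc H0 Hrr H1.
    replace (c * (beta r' - beta r)) with
      (Cre (Cmul (0, - c) (L (polar r' theta))) - Cre (Cmul (0, - c) (L (polar r theta))))
      by (unfold beta, Cre; simpl; ring).
    replace (M * (ln (1 - r) - ln (1 - r'))) with (- M * ln (1 - r') - - M * ln (1 - r)) by ring.
    apply (derivable_increment_le (fun x => Cre (Cmul (0, - c) (L (polar x theta))))
      (fun x => - M * ln (1 - x))
      (fun x => Cre (Cmul (0, - c) (Cmul (dL (polar x theta)) (cos theta, sin theta))))
      (fun x => M / (1 - x))); [assumption| | |].
    - intros x Hx. apply derivable_radial, Hd. unfold in_disk.
      rewrite Cmod_polar, Rabs_pos_eq; lra.
    - intros x Hx. apply is_derive_Reals. auto_derive; [lra|]. field. lra.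
    - intros x Hx. eapply Rle_trans; [apply Rle_abs|].
      eapply Rle_trans; [apply Rabs_fst_le|].
      rewrite !Cmod_mul, Cmod_unit, Rmult_1_r.
      replace (Cmod (0, - c)) with 1.
      2: { symmetry. apply Cmod_eq_intro; [lra|]. simpl.
           assert (E : Rabs c * Rabs c = c * c) by (rewrite <- Rabs_mult, Rabs_pos_eq; nra).
           rewrite Hc in E. lra. }
      rewrite Rmult_1_l. assert (B := Hb (polar x theta)). unfold in_disk in B.
      rewrite Cmod_polar, Rabs_pos_eq in B by lra. specialize (B ltac:(lra)).
      assert (Hn := Cmod_nonneg (dL (polar x theta))).
      apply Rle_div_r; [lra|]. nra. }
  assert (Hle : forall s s', 0 <= s -> s <= s' ->
    Rabs (beta (1 - exp (- s')) - beta (1 - exp (- s))) <= M * (s' - s)).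
  { intros s s' H0 Hss.
    assert (E1 := exp_le (- s) 0 ltac:(lra)). rewrite exp_0 in E1.
    assert (E2 := exp_le (- s') (- s) ltac:(lra)). assert (E3 := exp_pos (- s')).
    assert (G : forall c, Rabs c = 1 ->
      c * (beta (1 - exp (- s')) - beta (1 - exp (- s))) <= M * (s' - s)).
    { intros c Hc. assert (G := Hinc c (1 - exp (- s)) (1 - exp (- s')) Hc ltac:(lra) ltac:(lra) ltac:(lra)).
      replace (1 - (1 - exp (- s))) with (exp (- s)) in G by ring.
      replace (1 - (1 - exp (- s'))) with (exp (- s')) in G by ring.
      rewrite !ln_exp in G. lra. }
    assert (G1 := G 1 Rabs_R1). assert (G2 := G (-1) ltac:(rewrite Rabs_left; lra)).
    apply Rabs_le_between. lra. }
  intros s s' H0 H0'. fold (beta (1 - exp (- s))). fold (beta (1 - exp (- s'))).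
  destruct (Rle_dec s s').
  - rewrite Rabs_minus_sym, (Rabs_minus_sym s), (Rabs_pos_eq (s' - s)) by lra. apply Hle; assumption.
  - rewrite (Rabs_pos_eq (s - s')) by lra. apply Hle; lra.
Qed.

(** Since |1 - zeta| >= 1 - |z|, the base 1 - |z|^2 is at most 2 |1 - zeta|. *)
Lemma weight_le_Rpower (alpha : R) (z zeta : Cx) :
  0 <= alpha -> in_disk z -> Cmod zeta = Cmod z ->
  weight alpha z * Rpower (Cmod (Csub Cone zeta)) (- alpha) <= Rpower 2 alpha.
Proof.
  intros Ha Hz E. unfold in_disk in Hz. assert (Hz0 := Cmod_nonneg z).
  assert (T := Cmod_le_sub Cone zeta). rewrite Cmod_C1, E in T.
  set (x := Cmod (Csub Cone zeta)) in *. assert (Hx : 0 < x) by lra.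
  apply Rle_trans with (Rpower (2 * x) alpha * Rpower x (- alpha)).
  - apply Rmult_le_compat_r; [apply Rlt_le, Rpower_pos|].
    apply Rle_Rpower_l; [assumption|]. nra.
  - rewrite <- Rpower_mult_distr, Rpower_Ropp by lra.
    assert (Hp := Rpower_pos x alpha). right. field. lra.
Qed.

(* f g' is nearly positive on the radius: f carries the weight and, through the Bloch bound on
   L, the conjugate phase of g'; the power of z makes the family tend to 0 pointwise. *)
Lemma test_family (alpha : R) (dg L : Cx -> Cx) :
  0 <= alpha -> (forall z, in_disk z -> Cexp (L z) = dg z) -> in_Bloch L ->
  exists C c, 0 < C /\ 0 < c /\ forall theta T j, T < 1 ->
    exists f, analytic_on_disk f /\
      (forall z, in_disk z -> weight alpha z * Cmod (f z) <= C * Cmod z ^ j) /\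
      forall r, 0 <= r <= T ->
        c * r ^ j * radial_density dg alpha theta r
          <= Cre (Cmul (f (polar r theta)) (dg (polar r theta))).
Proof.
  intros Ha HL [dL [HdL [M0 HM0]]].
  set (M := Rmax M0 1). assert (HM1 : 1 <= M) by apply Rmax_r.
  assert (HM : forall z, in_disk z -> (1 - Cmod z ^ 2) * Cmod (dL z) <= M)
    by (intros z Hz; eapply Rle_trans; [apply HM0, Hz|apply Rmax_l]).
  destruct (INR_unbounded alpha) as [m Hm].
  set (g0 := exp (- (2 + alpha + INR m)) / 2).
  assert (Hg0 : 0 < g0) by (unfold g0; assert (X := exp_pos (- (2 + alpha + INR m))); lra).
  set (A := 4 ^ m * 192 * M ^ 2).
  assert (HA : 0 < A).
  { unfold A. assert (0 < 4 ^ m) by (apply pow_lt; lra). assert (0 < M ^ 2) by nra. nra. }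
  (* Large enough for [M] <= n and for the far bumps to cost at most half of [g0]. The choice
     precedes [theta], [T] and [j], so [C] and [c] are uniform in them. *)
  destruct (INR_unbounded (M + 2 * A / g0)) as [n Hn].
  assert (HAg : 0 < 2 * A / g0) by (apply Rdiv_lt_0_compat; lra).
  assert (HnA : A / INR n <= g0 / 2).
  { apply Rle_div_l; [lra|]. replace A with (g0 / 2 * (2 * A / g0)) at 1 by (field; lra).
    apply Rmult_le_compat_l; lra. }
  assert (Hnp : (0 < n)%nat) by (apply INR_lt; simpl; lra).
  set (C := 4 ^ m * 2 ^ (2 * (n * n)) * 48).
  assert (HC : 0 < C).
  { unfold C. apply Rmult_lt_0_compat; [|lra]. apply Rmult_lt_0_compat; apply pow_lt; lra. }
  exists (C * Rpower 2 alpha), (g0 / 2).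
  split; [apply Rmult_lt_0_compat; [assumption|apply Rpower_pos]|]. split; [lra|].
  intros theta T j HT.
  (* Enough nodes to reach the radius [T]; none of the bounds depends on [K]. *)
  destruct (INR_unbounded (INR n * - ln (1 - T))) as [K HK].
  set (b := fun s => snd (L (polar (1 - exp (- s)) theta))).
  (* Turns the radius at angle [theta] onto the positive axis, where the bumps are centred. *)
  set (rot := fun z : Cx => Cmul (cos theta, - sin theta) z).
  assert (Hrot : forall z, Cmod (rot z) = Cmod z).
  { intros z. unfold rot. rewrite Cmod_mul, Cmod_unit_conj. ring. }
  assert (Hrotd : forall z, Cdiff rot z)
    by (intros z; apply (Cdiff_mul (fun _ => (cos theta, - sin theta)) (fun w => w));
        [apply Cdiff_const|apply Cdiff_id]).
  exists (fun z => Cmul (Cpow (rot z) j) (test_function alpha n m b K (rot z))).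
  split; [|split].
  - intros z Hz. apply (Cdiff_mul (fun z => Cpow (rot z) j)).
    + apply (Cdiff_pow rot), Hrotd.
    + apply (Cdiff_comp (test_function alpha n m b K) rot); [apply Hrotd|].
      apply test_function_Cdiff. unfold in_disk. rewrite Hrot. exact Hz.
  - intros z Hz. rewrite Cmod_mul, Cmod_pow, Hrot.
    assert (G := test_function_le alpha n m b K (rot z) ltac:(lra) Hnp
      ltac:(unfold in_disk; rewrite Hrot; exact Hz)). fold C in G.
    assert (G2 := weight_le_Rpower alpha z (rot z) Ha Hz (Hrot z)).
    assert (Hp : 0 <= Cmod z ^ j) by (apply pow_le, Cmod_nonneg).
    assert (Hw := weight_pos alpha z).
    apply Rle_trans with (Cmod z ^ j * (C * (weight alpha z *
      Rpower (Cmod (Csub Cone (rot z))) (- alpha)))).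
    + replace (weight alpha z * (Cmod z ^ j * Cmod (test_function alpha n m b K (rot z)))) with
        (Cmod z ^ j * (weight alpha z * Cmod (test_function alpha n m b K (rot z)))) by ring.
      apply Rmult_le_compat_l; [assumption|].
      replace (C * (weight alpha z * Rpower (Cmod (Csub Cone (rot z))) (- alpha))) with
        (weight alpha z * (C * Rpower (Cmod (Csub Cone (rot z))) (- alpha))) by ring.
      apply Rmult_le_compat_l; lra.
    + rewrite Rmult_comm. apply Rmult_le_compat_r; [assumption|].
      apply Rmult_le_compat_l; lra.
  - intros r Hr.
    assert (Er : rot (polar r theta) = RtoCx r).
    { unfold rot. assert (S := sin2_cos2 theta). unfold Rsqr in S.
      apply injective_projections; simpl; [|ring].
      transitivity (r * (sin theta * sin theta + cos theta * cos theta)); [ring|].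
      rewrite S; ring. }
    rewrite Er, Cpow_real.
    set (s := - ln (1 - r)).
    assert (Es : exp (- s) = 1 - r) by (unfold s; rewrite Ropp_involutive, exp_ln; lra).
    assert (Hs : 0 <= s).
    { unfold s. assert (ln (1 - r) <= ln 1) by (apply ln_le; lra). rewrite ln_1 in H. lra. }
    assert (HsK : INR n * s <= INR K).
    { eapply Rle_trans; [|apply Rlt_le, HK]. apply Rmult_le_compat_l; [lra|].
      unfold s. apply Ropp_le_contravar, ln_le; lra. }
    assert (G := test_function_ge alpha M s n m b K ltac:(lra) ltac:(lra) Hs HsK).
    fold g0 A in G. rewrite Es in G. replace (1 - (1 - r)) with r in G by ring.
    assert (Hphase : forall s', 0 <= s' -> Rabs (b s - b s') <= M * Rabs (s - s')).
    { intros s' Hs'. apply (radial_phase_Lipschitz L dL M theta); auto; lra. }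
    specialize (G Hphase).
    assert (Hin : in_disk (polar r theta))
      by (unfold in_disk; rewrite Cmod_polar, Rabs_pos_eq; lra).
    assert (Edg : dg (polar r theta) = Cmul (RtoCx (Cmod (dg (polar r theta)))) (cos (b s), sin (b s))).
    { rewrite <- HL by exact Hin. rewrite Cmod_exp. unfold b. rewrite Es.
      replace (1 - (1 - r)) with r by ring.
      apply injective_projections; simpl; ring. }
    set (D := Cmod (dg (polar r theta))) in *.
    assert (HD : 0 <= D) by apply Cmod_nonneg.
    rewrite Edg.
    set (F := test_function alpha n m b K (RtoCx r)) in *.
    replace (Cre (Cmul (Cmul (RtoCx (r ^ j)) F) (Cmul (RtoCx D) (cos (b s), sin (b s))))) with
      (r ^ j * D * Cre (Cmul (cos (b s), sin (b s)) F)) by (unfold Cre; simpl; ring).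
    assert (Hexp : / Rpower (1 - r ^ 2) alpha <= exp (alpha * s)).
    { replace (exp (alpha * s)) with (/ Rpower (1 - r) alpha).
      - apply Rinv_le_contravar; [apply Rpower_pos|]. apply Rle_Rpower_l; [assumption|]. nra.
      - unfold Rpower. rewrite <- exp_Ropp. f_equal. unfold s. ring. }
    assert (Hrj : 0 <= r ^ j) by (apply pow_le; lra).
    unfold radial_density. fold D.
    apply Rle_trans with (r ^ j * D * (g0 / 2 * exp (alpha * s))).
    + replace (g0 / 2 * r ^ j * (D / Rpower (1 - r ^ 2) alpha)) with
        (r ^ j * D * (g0 / 2 * / Rpower (1 - r ^ 2) alpha)) by (unfold Rdiv; ring).
      apply Rmult_le_compat_l; [apply Rmult_le_pos; assumption|].
      apply Rmult_le_compat_l; lra.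
    + apply Rmult_le_compat_l; [apply Rmult_le_pos; assumption|].
      eapply Rle_trans; [|exact G]. apply Rmult_le_compat_r; [apply Rlt_le, exp_pos|]. lra.
Qed.

(** If no such triple existed beyond some [a], the condition would hold for this [eps] with b =
    [t2]. *)
Lemma not_radial_condition (dg : Cx -> Cx) (alpha beta : R) :
  ~ radial_condition dg alpha beta ->
  exists eps, 0 < eps /\ forall a, a < 1 -> exists t2 t1 theta,
    a < t2 /\ t2 < t1 /\ t1 < 1 /\ eps < radial_quantity dg alpha beta t1 t2 theta.
Proof.
  intros H. apply NNPP. intros Hn. apply H. intros eps He. apply NNPP. intros Ha.
  apply Hn. exists eps. split; [assumption|]. intros a Ha1. apply NNPP. intros Hno.
  apply Ha. exists a. split; [assumption|]. intros t2 Ht2. exists t2. split; [tauto|].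
  intros t1 Ht1 theta _. apply Rnot_lt_le. intros Hlt. apply Hno.
  exists t2, t1, theta. tauto.
Qed.

(** Bernoulli: t^j >= 1 - j (1 - t) >= 1 - j / (2 (j + 1)). *)
Lemma pow_ge_half (t : R) (j : nat) : 1 - / (2 * (INR j + 1)) <= t <= 1 -> / 2 <= t ^ j.
Proof.
  intros Ht. assert (Hj := pos_INR j).
  assert (G : forall k, 0 <= t -> 1 - INR k * (1 - t) <= t ^ k).
  { induction k as [|k IH]; intros H0; [simpl; lra|]. rewrite S_INR. simpl.
    specialize (IH H0). assert (Hk := pos_INR k).
    assert (t * (1 - INR k * (1 - t)) <= t * t ^ k) by (apply Rmult_le_compat_l; assumption).
    assert (0 <= INR k * ((1 - t) * (1 - t))) by (apply Rmult_le_pos; [assumption|apply Rle_0_sqr]).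
    lra. }
  assert (Hq : / (2 * (INR j + 1)) * (2 * (INR j + 1)) = 1) by (field; lra).
  assert (Hq0 : 0 < / (2 * (INR j + 1))) by (apply Rinv_0_lt_compat; lra).
  set (q := / (2 * (INR j + 1))) in *.
  assert (Hq1 : INR j * q = / 2 - q) by lra.
  assert (0 <= INR j * q) by (apply Rmult_le_pos; lra).
  specialize (G j ltac:(lra)).
  assert (INR j * (1 - t) <= INR j * q) by (apply Rmult_le_compat_l; lra). lra.
Qed.

(** The function u = Re (e^(-i theta) h) has derivative Re (f g') >= 0 along the radius, so u is
    nonnegative at [t2] and gains at least c/2 times the radial integral up to [t1]; hence delta = c
    eps / 2. *)
Lemma nonvanishing_family (alpha beta : R) (dg L : Cx -> Cx) :
  0 <= alpha -> analytic_on_disk dg -> (forall z, in_disk z -> Cexp (L z) = dg z) ->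
  in_Bloch L -> ~ radial_condition dg alpha beta ->
  exists C delta, 0 < C /\ 0 < delta /\ forall j, exists f h : Cx -> Cx,
    analytic_on_disk f /\
    (forall z, in_disk z -> weight alpha z * Cmod (f z) <= C * Cmod z ^ j) /\
    is_Tg dg f h /\ exists z, in_disk z /\ delta <= weight beta z * Cmod (h z).
Proof.
  intros Ha Hdg HL HB HR.
  destruct (not_radial_condition dg alpha beta HR) as [eps [He Hbad]].
  destruct (test_family alpha dg L Ha HL HB) as [C [c [HC [Hc Hfam]]]].
  exists C, (c / 2 * eps). split; [assumption|]. split; [nra|].
  intros j. assert (Hj := pos_INR j).
  assert (Hq0 : 0 < / (2 * (INR j + 1))) by (apply Rinv_0_lt_compat; lra).
  assert (Hq1 : / (2 * (INR j + 1)) <= / 1) by (apply Rinv_le_contravar; lra).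
  rewrite Rinv_1 in Hq1.
  (* Beyond this radius r^j >= 1/2, by [pow_ge_half]. *)
  destruct (Hbad (1 - / (2 * (INR j + 1))) ltac:(lra)) as (t2 & t1 & theta & H2 & H21 & H1 & HQ).
  destruct (Hfam theta t1 j H1) as [f [Hfa [Hfb Hfr]]].
  destruct (primitive_on_disk (fun z => Cmul (f z) (dg z))) as [h [Hh0 Hh]].
  { intros z Hz. apply Cdiff_mul; [apply Hfa|apply Hdg]; assumption. }
  exists f, h. split; [assumption|]. split; [assumption|]. split; [split; assumption|].
  exists (polar t1 theta).
  assert (Hin : in_disk (polar t1 theta))
    by (unfold in_disk; rewrite Cmod_polar, Rabs_pos_eq; lra).
  split; [assumption|].
  set (u := fun r => Cre (Cmul (cos theta, - sin theta) (h (polar r theta)))).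
  set (du := fun r => Cre (Cmul (f (polar r theta)) (dg (polar r theta)))).
  assert (Hu : forall r, 0 <= r <= t1 -> derivable_pt_lim u r (du r)).
  { intros r Hr. unfold u.
    replace (du r) with (Cre (Cmul (cos theta, - sin theta)
      (Cmul (Cmul (f (polar r theta)) (dg (polar r theta))) (cos theta, sin theta)))).
    - apply derivable_radial, Hh. unfold in_disk. rewrite Cmod_polar, Rabs_pos_eq; lra.
    - unfold du. assert (S := sin2_cos2 theta). unfold Rsqr in S.
      set (w := Cmul (f (polar r theta)) (dg (polar r theta))). clearbody w. unfold Cre; simpl.
      transitivity (fst w * (sin theta * sin theta + cos theta * cos theta)); [ring|].
      rewrite S; ring. }
  assert (Hdu : forall r, 0 <= r <= t1 -> 0 <= du r).
  { intros r Hr. eapply Rle_trans; [|apply Hfr, Hr].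
    apply Rmult_le_pos; [|apply radial_density_nonneg].
    apply Rmult_le_pos; [lra|apply pow_le; lra]. }
  assert (Hu2 : 0 <= u t2).
  { assert (G := derivable_increment_le (fun _ => 0) u (fun _ => 0) du 0 t2 ltac:(lra)
      ltac:(intros; apply derivable_pt_lim_const) ltac:(intros; apply Hu; lra)
      ltac:(intros; apply Hdu; lra)).
    assert (E : u 0 = 0).
    { unfold u. replace (polar 0 theta) with C0
        by (apply injective_projections; simpl; ring).
      rewrite Hh0. unfold Cre; simpl; ring. }
    lra. }
  destruct (Defs_RInt_antiderivative (radial_density dg alpha theta) (-1) 1 t2 t1)
    as [G [HG EG]]; [|lra|lra|lra|].
  { intros x Hx. apply radial_density_continuous; assumption. }
  assert (Hinc : c / 2 * G t1 - c / 2 * G t2 <= u t1 - u t2).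
  { apply (derivable_increment_le (fun r => c / 2 * G r) u
      (fun r => c / 2 * radial_density dg alpha theta r) du); [lra| | |].
    - intros r Hr. apply (derivable_pt_lim_scal G), HG, Hr.
    - intros r Hr. apply Hu; lra.
    - intros r Hr. eapply Rle_trans; [|apply Hfr; lra].
      assert (Hp := pow_ge_half r j ltac:(lra)).
      apply Rmult_le_compat_r; [apply radial_density_nonneg|]. nra. }
  assert (Hle : u t1 <= Cmod (h (polar t1 theta))).
  { unfold u. eapply Rle_trans; [apply Rle_abs|]. eapply Rle_trans; [apply Rabs_fst_le|].
    rewrite Cmod_mul, Cmod_unit_conj. lra. }
  unfold radial_quantity in HQ. fold (radial_density dg alpha theta) in HQ.
  rewrite EG in HQ.
  assert (Ew : weight beta (polar t1 theta) = Rpower (1 - t1 ^ 2) beta)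
    by (unfold weight; rewrite Cmod_polar, Rabs_pos_eq; [reflexivity|lra]).
  rewrite Ew. assert (Hw := Rpower_pos (1 - t1 ^ 2) beta).
  apply Rle_trans with (Rpower (1 - t1 ^ 2) beta * (c / 2 * (G t1 - G t2))); [nra|].
  apply Rmult_le_compat_l; lra.
Qed.

Theorem compact_radial_condition (alpha beta : R) (dg L : Cx -> Cx) :
  0 <= alpha -> analytic_on_disk dg -> (forall z, in_disk z -> Cexp (L z) = dg z) ->
  in_Bloch L -> Tg_compact dg alpha beta -> radial_condition dg alpha beta.
Proof.
  intros Ha Hdg HL HB [_ Hcomp]. apply NNPP. intros HR.
  destruct (nonvanishing_family alpha beta dg L Ha Hdg HL HB HR) as [C [delta [HC [Hdelta Hfam]]]].
  set (ok := fun j (p : (Cx -> Cx) * (Cx -> Cx)) =>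
    analytic_on_disk (fst p) /\
    (forall z, in_disk z -> weight alpha z * Cmod (fst p z) <= C * Cmod z ^ j) /\
    is_Tg dg (fst p) (snd p) /\
    exists z, in_disk z /\ delta <= weight beta z * Cmod (snd p z)).
  assert (Hex : forall j, exists p, ok j p).
  { intros j. destruct (Hfam j) as [f [h H]]. exists (f, h). exact H. }
  set (p := fun j => proj1_sig (constructive_indefinite_description _ (Hex j))).
  assert (Hp : forall j, ok j (p j))
    by (intros j; exact (proj2_sig (constructive_indefinite_description _ (Hex j)))).
  assert (Hbound : forall j z, in_disk z -> weight alpha z * Cmod (fst (p j) z) <= C).
  { intros j z Hz. eapply Rle_trans; [apply (Hp j), Hz|].
    unfold in_disk in Hz. assert (Hz0 := Cmod_nonneg z).
    assert (Cmod z ^ j <= 1 ^ j) by (apply pow_incr; lra). rewrite pow1 in H. nra. }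
  (* On |v| <= r the integrand f_j g' is at most a constant times r^j, and so is the image on that
     ball. *)
  assert (Hzero : forall z, in_disk z -> forall eps, 0 < eps -> exists N, forall j, (N <= j)%nat ->
    Cmod (snd (p j) z) <= eps).
  { intros z Hz eps He. unfold in_disk in Hz. set (r := Cmod z) in *.
    assert (Hr : 0 <= r) by apply Cmod_nonneg.
    destruct (log_Lipschitz_bounded dg L HL HB r ltac:(lra)) as [B [HB0 HBb]].
    set (w := Rpower (1 - r ^ 2) alpha). assert (Hw : 0 < w) by apply Rpower_pos.
    assert (HCw : 0 <= C / w * B) by (apply Rmult_le_pos; [apply Rlt_le, Rdiv_lt_0_compat|]; assumption).
    destruct (pow_lt_1_zero r) with (y := eps / (C / w * B + 1)) as [N HN].
    { rewrite Rabs_pos_eq; assumption. }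
    { apply Rdiv_lt_0_compat; lra. }
    exists N. intros j Hj. specialize (HN j Hj).
    assert (Hrj : 0 <= r ^ j) by (apply pow_le, Hr). rewrite Rabs_pos_eq in HN by assumption.
    destruct (Hp j) as [_ [Hf [[Hh0 Hh] _]]].
    assert (G := Lipschitz_ball (snd (p j)) (fun z => Cmul (fst (p j) z) (dg z)) r
      (C / w * B * r ^ j) ltac:(apply Rmult_le_pos; assumption)).
    specialize (G ltac:(intros v Hv; apply Hh; unfold in_disk; lra)).
    assert (Hder : forall v, Cmod v <= r -> Cmod (Cmul (fst (p j) v) (dg v)) <= C / w * B * r ^ j).
    { intros v Hv. rewrite Cmod_mul.
      replace (C / w * B * r ^ j) with (C / w * r ^ j * B) by ring.
      apply Rmult_le_compat; try apply Cmod_nonneg; [|apply HBb, Hv].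
      assert (Hfv := Hf v ltac:(unfold in_disk; lra)).
      assert (Hwv := weight_ge alpha r v Ha ltac:(lra) Hv). fold w in Hwv.
      assert (Hn := Cmod_nonneg (fst (p j) v)).
      assert (Hpj : Cmod v ^ j <= r ^ j) by (apply pow_incr; split; [apply Cmod_nonneg|assumption]).
      apply (Rmult_le_reg_l w); [assumption|].
      replace (w * (C / w * r ^ j)) with (C * r ^ j) by (field; lra).
      apply Rle_trans with (weight alpha v * Cmod (fst (p j) v)); [nra|].
      eapply Rle_trans; [exact Hfv|]. apply Rmult_le_compat_l; lra. }
    specialize (G Hder C0 z ltac:(rewrite Cmod_C0; lra) (Rle_refl _)). rewrite Hh0 in G.
    replace (Csub (snd (p j) z) C0) with (snd (p j) z) in G by ring.
    replace (Csub z C0) with z in G by ring. fold r in G.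
    eapply Rle_trans; [exact G|]. clear G Hder. set (q := C / w * B) in *.
    apply Rle_trans with ((q + 1) * (eps / (q + 1))); [|right; field; lra].
    assert (Hrj1 : q * r ^ j <= (q + 1) * (eps / (q + 1))) by (apply Rmult_le_compat; lra).
    assert (H0 : 0 <= q * r ^ j) by (apply Rmult_le_pos; assumption).
    apply Rle_trans with (q * r ^ j * 1); [apply Rmult_le_compat_l; lra|lra]. }
  destruct (Hcomp (fun j => fst (p j)) (fun j => snd (p j))) as (phi & H & Hphi & _ & Hconv).
  - intros j. split; [apply (Hp j)|]. exists C. apply Hbound.
  - exists C. exact Hbound.
  - intros j. apply (Hp j).
  - assert (Hphi' : forall n, (n <= phi n)%nat)
      by (induction n as [|n IH]; [lia|specialize (Hphi n); lia]).
    assert (HH : forall z, in_disk z -> Cmod (H z) = 0).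
    { intros z Hz. apply Rle_antisym; [|apply Cmod_nonneg]. apply le_epsilon. intros eps He.
      assert (Hw := weight_pos beta z).
      destruct (Hzero z Hz (eps / 2)) as [N1 HN1]; [lra|].
      destruct (Hconv (weight beta z * (eps / 2))) as [N2 HN2]; [apply Rmult_lt_0_compat; lra|].
      set (N := Nat.max N1 N2). specialize (HN2 N ltac:(unfold N; lia) z Hz).
      specialize (HN1 (phi N)). assert (HNp := Hphi' N). specialize (HN1 ltac:(unfold N in *; lia)).
      apply Rmult_le_reg_l in HN2; [|assumption].
      assert (T := Cmod_le_sub (H z) (snd (p (phi N)) z)). rewrite Cmod_sub_sym in T. lra. }
    (* The norm limit vanishes on the disk, whereas every image has weighted modulus at least
       [delta] somewhere. *)
    destruct (Hconv (delta / 2)) as [N HN]; [lra|]. specialize (HN N (le_n N)).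
    destruct (Hp (phi N)) as [_ [_ [_ [z [Hz Hlow]]]]].
    specialize (HN z Hz). assert (T := Cmod_le_sub (snd (p (phi N)) z) (H z)).
    rewrite (HH z Hz) in T. assert (Hw := weight_pos beta z). nra.
Qed.

Theorem theorem4 (alpha beta : R) (g dg : Cx -> Cx) :
  0 <= alpha -> 0 <= beta ->
  is_deriv_on_disk g dg ->
  (forall z, in_disk z -> dg z <> C0) ->
  (exists L : Cx -> Cx, analytic_on_disk L /\
     (forall z, in_disk z -> Cexp (L z) = dg z) /\ in_Bloch L) ->
  (Tg_compact dg alpha beta <-> radial_condition dg alpha beta).
Proof.
  intros Ha Hb _ _ [L [HLa [HL HB]]].
  (* Analyticity of g' is read off from g' = exp L by the chain rule, rather than from a theorem on
     derivatives of analytic functions. *)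
  assert (Hdg : analytic_on_disk dg).
  { intros z Hz.
    destruct (Cdiff_comp Cexp L z (HLa z Hz) (ex_intro _ _ (Cderiv_exp _))) as [l Hl].
    exists l. exact (Cderiv_ext_disk _ _ z l Hz HL Hl). }
  split.
  - apply compact_radial_condition with L; assumption.
  - apply radial_condition_compact with L; assumption.
Qed.
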